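(* Let $f\in (PW,l^1)$, let $\{x_n:n\in\mathbb{Z}\}$ be a complete interpolating sequence for $L^2([-\pi,\pi])$, and let $\{\phi_\alpha:\alpha\in A\}$ be a regular family of interpolators. For $m\in\mathbb{Z}$ let $g_m\in PW_\pi$ be defined by $\hat g_m(\xi)=\hat f(\xi+2\pi m)\chi_{[-\pi,\pi]}(\xi)$, let $I_\alpha g_m$ be the $\phi_\alpha$-interpolant of $g_m$ at $\{x_n\}$, and let $J_\alpha f(x)=\sum_{m\in\mathbb{Z}}e^{2\pi i m x}I_\alpha g_m(x)$ (all as defined in the context). Then: (A) $\displaystyle\lim_{\alpha\to\infty}\|f-J_\alpha f\|_{L^2(\mathbb{R})}=0$; (B) $\displaystyle\lim_{\alpha\to\infty}\|f-J_\alpha f\|_{(PW,l^1)}=0$; and (C) $\displaystyle\lim_{\alpha\to\infty}|f(x)-J_\alpha f(x)|=0$, uniformly for $x\in\mathbb{R}$.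
   Context: **Fourier transform.** For $g\in L^1(\mathbb{R})$, $\hat g(\xi)=(2\pi)^{-1/2}\int_{\mathbb{R}}g(x)e^{-ix\xi}\,dx$, extended to $L^2(\mathbb{R})$ as a unitary operator in the usual way. **Paley-Wiener space.** $PW_\pi=\{g\in L^2(\mathbb{R}): \hat g=0 \text{ a.e. outside } [-\pi,\pi]\}$; its elements are identified with their continuous representatives. **Amalgam space.** $$(PW,l^1)=\Big\{f\in L^2(\mathbb{R}):\ \|f\|_{(PW,l^1)}:=\sum_{m\in\mathbb{Z}}\|\hat f(\xi+2\pi m)\|_{L^2([-\pi,\pi])}<\infty\Big\},$$ where the $L^2([-\pi,\pi])$ norm is taken in the variable $\xi$. For $f\in(PW,l^1)$ one has $\hat f\in L^1(\mathbb{R})$, and in pointwise statements elements of $(PW,l^1)$ are identified with their continuous representatives. **Complete interpolating sequence.** A sequence of real numbers $\{x_n:n\in\mathbb{Z}\}$ is a complete interpolating sequence for $L^2([-\pi,\pi])$ if the exponentials $\{e^{-ix_n\xi}:n\in\mathbb{Z}\}$ form a Riesz basis of $L^2([-\pi,\pi])$ (equivalently, $g\mapsto\{g(x_n)\}_{n\in\mathbb{Z}}$ is a bounded bijection from $PW_\pi$ onto $l^2(\mathbb{Z})$). **Interpolator.** A function $\phi:\mathbb{R}\to\mathbb{R}$ is an interpolator for $PW_\pi$ if: - (A1) $\phi\in L^1(\mathbb{R})\cap C(\mathbb{R})$ and $\hat\phi\in L^1(\mathbb{R})$; - (A2) $\hat\phi(\xi)\ge 0$ for all $\xi\in\mathbb{R}$,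 and there is $\delta>0$ with $\hat\phi(\xi)\ge\delta$ on $[-\pi,\pi]$; - (A3) with $M_j=\sup_{|\xi|\le\pi}\hat\phi(\xi+2\pi j)$, one has $\{M_j\}_{j\in\mathbb{Z}}\in l^1(\mathbb{Z})$. **Regular family.** Let $A\subset(0,\infty)$ be unbounded; limits as $\alpha\to\infty$ are taken along $\alpha\in A$. A one-parameter family $\{\phi_\alpha:\alpha\in A\}$ is a regular family of interpolators if: - (H1) $\phi_\alpha$ is an interpolator for $PW_\pi$ for each $\alpha\in A$; - (H2) $\sum_{j\ne0}M_j(\alpha)\le C\,m_\alpha$ for all $\alpha\in A$, where $M_j(\alpha)=\sup_{|\xi|\le\pi}\hat\phi_\alpha(\xi+2\pi j)$, $m_\alpha=\inf_{|\xi|\le\pi}\hat\phi_\alpha(\xi)$, and $C$ is a constant independent of $\alpha$; - (H3) for almost every $|\xi|\le\pi$, $\lim_{\alpha\to\infty}\dfrac{m_\alpha}{\hat\phi_\alpha(\xi)}=0$. **Interpolants.** Given a complete interpolating sequence $\{x_n\}$ and a regular family $\{\phi_\alpha\}$, for every $g\in PW_\pi$ and $\alpha\in A$ there is a unique (complex) sequence $\{a_n\}_{n\in\mathbb{Z}}\in l^2(\mathbb{Z})$, depending on $g$ and $\alpha$, such that $$I_\alpha g(x)=\sum_{n\in\mathbb{Z}}a_n\phi_\alpha(x-x_n)$$ satisfies $I_\alpha g(x_n)=g(x_n)$ for all $n\in\mathbb{Z}$. **The approximant $J_\alpha f$.** For $f\in(PW,l^1)$ and $m\in\mathbb{Z}$,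 let $\hat f_m(\xi)=\hat f(\xi)\chi_{[-\pi,\pi]}(\xi-2\pi m)$ and define $g_m\in PW_\pi$ by $\hat g_m(\xi)=\hat f_m(\xi+2\pi m)$, i.e. $\hat g_m(\xi)=\hat f(\xi+2\pi m)\chi_{[-\pi,\pi]}(\xi)$. Then $$J_\alpha f(x)=\sum_{m\in\mathbb{Z}}e^{2\pi i m x}I_\alpha g_m(x).$$ *)

(* Defs.v *)
(* Topological notions on R[i] go through R[i]^o, which carries the topology
   of the modulus. *)
From HB Require Import structures.
From mathcomp Require Import all_boot all_order all_algebra.
From mathcomp Require Import complex.
From mathcomp Require Import all_classical all_reals all_analysis.

Set Implicit Arguments.
Unset Strict Implicit.
Unset Printing Implicit Defensive.

Import Order.TTheory GRing.Theory Num.Theory.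
Import numFieldNormedType.Exports.

Local Open Scope classical_set_scope.
Local Open Scope ring_scope.
Local Open Scope complex_scope.

Section Defs.
Variable R : realType.
Implicit Types (f g h F G : R -> R[i]) (D : set R) (phi : R -> R).

Local Notation mu := (@lebesgue_measure R).

Definition cabs (z : R[i]) : R := Normc.normc z.

Definition expi (t : R) : R[i] := cos t +i* sin t.

Definition base : set R := `[- pi, pi]%classic.

Definition cmeasurable D f : Prop :=
  measurable_fun D (fun x => complex.Re (f x)) /\
  measurable_fun D (fun x => complex.Im (f x)).

Definition cintegral D f : R[i] :=
  Rintegral mu D (fun x => complex.Re (f x)) +i*
  Rintegral mu D (fun x => complex.Im (f x)).

Definition L1 D f : Prop :=
  mu.-integrable D (fun x => (complex.Re (f x))%:E) /\
  mu.-integrable D (fun x => (complex.Im (f x))%:E).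

Definition L2norm D f : \bar R :=
  Lnorm mu 2%:E (fun x => (\1_D x * cabs (f x))%:E).

Definition L2 D f : Prop := cmeasurable D f /\ (L2norm D f < +oo)%E.

(* The sum of a two-sided series is the limit of its symmetric partial sums;
   it agrees with the unconditional sum when the latter exists. *)
Definition zpsum (V : nmodType) (u : int -> V) (N : nat) : V :=
  \sum_(k < N.*2.+1) u (k%:Z - N%:Z).

Definition zsum (u : int -> R[i]) : R[i] := limn (zpsum u : nat -> R[i]^o).

Definition l2 (a : int -> R[i]) : Prop :=
  (\esum_(n in [set: int]) (cabs (a n) ^+ 2)%:E < +oo)%E.

Definition fourier g (xi : R) : R[i] :=
  (Num.sqrt (2 * pi))^-1%:C *
  cintegral setT (fun x => g x * expi (- (x * xi))).

(* Extension to L^2 by density of L^1 \cap L^2 and the Plancherel isometry. *)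
Definition is_fourier2 g G : Prop :=
  L2 setT g /\ L2 setT G /\
  exists u : nat -> R -> R[i],
    [/\ forall k, L1 setT (u k) /\ L2 setT (u k),
        L2norm setT (fun x => u k x - g x) @[k --> \oo] --> 0%E &
        L2norm setT (fun xi => fourier (u k) xi - G xi) @[k --> \oo] --> 0%E].

(* A representative of the L^2 Fourier transform, which is determined only up
   to almost everywhere equality; meaningful for g in L^2. *)
Definition fourier2 g : R -> R[i] := xget (cst 0) [set G | is_fourier2 g G].

(* Elements are the continuous representatives. *)
Record PW g : Prop := MkPW {
  PW_L2 : L2 setT g ;
  PW_continuous : continuous (g : R -> R[i]^o) ;
  PW_band : {ae mu, forall xi, ~ base xi -> fourier2 g xi = 0} }.

(* Extended by +oo off L^2. *)
Definition amalgam_norm f : \bar R :=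
  if `[< L2 setT f >] then
    (\esum_(m in [set: int])
       L2norm base (fun xi => fourier2 f (xi + 2 * pi * m%:~R)%R))%E
  else +oo%E.

Definition PWl1 f : Prop := L2 setT f /\ (amalgam_norm f < +oo)%E.

(* Riesz sequence bounds for finite linear combinations, which are taken over
   the blocks |n| <= N since c may vanish, together with completeness. *)
Definition riesz_basis D (e : int -> R -> R[i]) : Prop :=
  [/\ forall n, L2 D (e n),
      exists p q : R, [/\ 0 < p, 0 < q &
        forall (c : int -> R[i]) (N : nat),
          let s := zpsum (fun n => cabs (c n) ^+ 2) N in
          let t := L2norm D (fun xi => zpsum (fun n => c n * e n xi) N) in
          ((p * s)%:E <= t ^+ 2 /\ t ^+ 2 <= (q * s)%:E)%E] &
      forall h, L2 D h -> forall eps : R, 0 < eps ->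
        exists (c : int -> R[i]) (N : nat),
          (L2norm D (fun xi => (h xi - zpsum (fun n => c n * e n xi) N)%R)
             < eps%:E)%E].

Definition complete_interpolating (x : int -> R) : Prop :=
  riesz_basis base (fun n xi => expi (- (x n * xi))).

Definition cplx phi : R -> R[i] := fun x => (phi x)%:C.

(* The transform of an interpolator is real and bounded, so that the sup and
   the inf below are over nonempty bounded sets of reals. *)
Definition Msup phi (j : int) : R :=
  sup [set complex.Re (fourier (cplx phi) (xi + 2 * pi * j%:~R)) | xi in base].

Definition minf phi : R :=
  inf [set complex.Re (fourier (cplx phi) xi) | xi in base].

(* In R[i], 0 <= z means that z is real and nonnegative. *)
Record interpolator phi : Prop := MkInterpolator {
  interp_L1 : mu.-integrable setT (EFin \o phi) ;
  interp_continuous : continuous phi ;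
  interp_fourier_L1 : L1 setT (fourier (cplx phi)) ;
  interp_ge0 : forall xi, 0 <= fourier (cplx phi) xi ;
  interp_lower : exists2 delta : R, 0 < delta &
    forall xi, base xi -> delta%:C <= fourier (cplx phi) xi ;
  interp_M_l1 : (\esum_(j in [set: int]) (`|Msup phi j|)%:E < +oo)%E }.

Record regular_family (A : set R) (phi : R -> R -> R) : Prop := MkRegular {
  regular_index_gt0 : forall alpha, A alpha -> 0 < alpha ;
  regular_index_unbounded : ~ has_ubound A ;
  regular_interpolator : forall alpha, A alpha -> interpolator (phi alpha) ;
  regular_tail : exists C : R, forall alpha, A alpha ->
    (\esum_(j in [set j : int | (j != 0)%R]) (Msup (phi alpha) j)%:E
       <= (C * minf (phi alpha))%:E)%E ;
  regular_ratio : {ae mu, forall xi, base xi ->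
    minf (phi alpha) / complex.Re (fourier (cplx (phi alpha)) xi)
      @[alpha --> within A +oo_R] --> (0 : R)} }.

Definition is_interpolant phi (x : int -> R) g h : Prop :=
  exists a : int -> R[i],
    [/\ l2 a,
        forall t, h t = zsum (fun n => a n * (phi (t - x n))%:C) &
        forall n, h (x n) = g (x n)].

Definition is_band_piece f (m : int) g : Prop :=
  PW g /\
  fourier2 g =
    (fun xi => fourier2 f (xi + 2 * pi * m%:~R) * (\1_base xi)%:C) %[ae mu].

(* J_alpha f, given the interpolants Ig m of the pieces g_m. *)
Definition modulated_sum (Ig : int -> R -> R[i]) (t : R) : R[i] :=
  zsum (fun m => expi (2 * pi * m%:~R * t) * Ig m t).

End Defs.

(* Main.v *)
Require Import Defs.
From HB Require Import structures.
From mathcomp Require Import all_boot all_order all_algebra.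
From mathcomp Require Import complex.
From mathcomp Require Import all_classical all_reals all_analysis.
From mathcomp Require Import measurable_realfun.
From mathcomp Require Import zify ring lra.
Import Order.TTheory GRing.Theory Num.Theory.
Import numFieldNormedType.Exports.
Local Open Scope classical_set_scope.
Local Open Scope ring_scope.

Set Implicit Arguments.
Unset Strict Implicit.
Unset Printing Implicit Defensive.

(* Write hat I = sigma Psi for the transform of an interpolant of g, where sigma
   is the transform of phi and Psi = sum_n a_n e^{-i x_n xi}, let gamma = hat g on
   [-pi, pi], and let D = hat I - gamma. The interpolation conditions say that D
   is orthogonal to every exponential e^{-i x_n xi}.
   Testing D against Psi gives int sigma |Psi|^2 = <gamma, Psi>, whence
     m ||Psi|| <= tau(gamma),  tau(gamma)^2 = int |gamma|^2 m / sigma,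
   with m = inf sigma on [-pi, pi]; by (H2) and the Riesz bounds, which transfer
   to each translate of [-pi, pi], the part of hat I outside [-pi, pi] is
   O(tau(gamma)) in the amalgam norm. Testing D against combinations close to D
   on [-pi, pi] bounds D there by the same quantity.
   Summing over the frequency blocks, every norm of f - J_alpha f is
   O(sum_m tau_alpha(gamma_m)). Each term tends to 0 by (H3) and dominated
   convergence, and tau_alpha(gamma_m) <= ||gamma_m||, which is summable. *)

(** * Complex numbers as a real inner product space *)

(** The series Psi is never formed. What is needed is the limit of the partial sums of sigma Psi in
    the amalgam norm, so the test of D against Psi is carried out with a partial sum, up to an error
    that tends to 0. One inequality serves both tests. A combination of exponentials does not decay,
    but its norm on every translate of [-pi, pi] is at most sqrt(q / p) times its norm on [-pi, pi],
    p and q being the Riesz bounds; hence it pairs with anything of finite amalgam norm. The factor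
    m is what matches (H2): off the band sigma Psi has size C m ||Psi||, and the first test controls
    exactly m ||Psi||. On the band, completeness gives a combination v close to D, and orthogonality
    moves <D, v> to the complement of the band, where D is already small. The constant depends only
    on p, q and C, hence neither on alpha nor on the frequency block. Modulations permute the blocks
    and preserve the amalgam norm, and this norm dominates both the L^2 norm and the supremum of the
    inverse transform. All three conclusions therefore follow from one bound. *)

Section Complex.
Variable R : realType.
Local Open Scope complex_scope.
Implicit Types (z w : R[i]).
Local Notation Re := complex.Re.
Local Notation Im := complex.Im.

(* Only the real inner product of R[i] = R^2 is used: it suffices to test against
   [1] and [i], and it keeps all integrals real-valued. *)
Definition dot z w : R := Re z * Re w + Im z * Im w.

Lemma cReD z w : Re (z + w) = Re z + Re w. Proof. by case: z w => [? ?] [? ?]. Qed.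
Lemma cImD z w : Im (z + w) = Im z + Im w. Proof. by case: z w => [? ?] [? ?]. Qed.
Lemma cReN z : Re (- z) = - Re z. Proof. by case: z. Qed.
Lemma cImN z : Im (- z) = - Im z. Proof. by case: z. Qed.
Lemma cReM z w : Re (z * w) = Re z * Re w - Im z * Im w. Proof. by case: z w => [? ?] [? ?]. Qed.
Lemma cImM z w : Im (z * w) = Re z * Im w + Im z * Re w. Proof. by case: z w => [? ?] [? ?]. Qed.
Lemma cReC (a : R) : Re a%:C = a. Proof. by []. Qed.
Lemma cImC (a : R) : Im a%:C = 0. Proof. by []. Qed.
Definition cE := (cReD, cImD, cReN, cImN, cReM, cImM, cReC, cImC).

Lemma complex_ext z w : Re z = Re w -> Im z = Im w -> z = w.
Proof. by case: z w => [? ?] [? ?] /= -> ->. Qed.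

Lemma cabsE z : cabs z = Num.sqrt (Re z ^+ 2 + Im z ^+ 2).
Proof. by case: z. Qed.

Lemma cabs_sqr z : cabs z ^+ 2 = Re z ^+ 2 + Im z ^+ 2.
Proof. by rewrite cabsE sqr_sqrtr// addr_ge0// sqr_ge0. Qed.

Lemma cabs_sqr_dot z : cabs z ^+ 2 = dot z z.
Proof. by rewrite cabs_sqr /dot !expr2. Qed.

Lemma cabs_ge0 z : 0 <= cabs z. Proof. by rewrite cabsE sqrtr_ge0. Qed.
Lemma cabs0 : cabs 0 = 0 :> R. Proof. exact: Normc.normc0. Qed.
Lemma cabs0_eq0 z : cabs z = 0 -> z = 0. Proof. exact: Normc.eq0_normc. Qed.
Lemma cabsM z w : cabs (z * w) = cabs z * cabs w. Proof. exact: Normc.normcM. Qed.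
Lemma cabsD z w : cabs (z + w) <= cabs z + cabs w. Proof. exact: le_normcD. Qed.
Lemma cabsN z : cabs (- z) = cabs z. Proof. exact: normcN. Qed.
Lemma cabsC (a : R) : cabs a%:C = `|a|.
Proof. by rewrite cabsE /= expr0n addr0 sqrtr_sqr. Qed.
Lemma cabsB z w : cabs (z - w) = cabs (w - z).
Proof. by rewrite -cabsN opprB. Qed.
Lemma normr_cabs z : `|z| = (cabs z)%:C.
Proof. by rewrite normc_def cabsE. Qed.

Lemma Re_le_cabs z : `|Re z| <= cabs z.
Proof. by rewrite cabsE -sqrtr_sqr ler_wsqrtr// lerDl sqr_ge0. Qed.
Lemma Im_le_cabs z : `|Im z| <= cabs z.
Proof. by rewrite cabsE -sqrtr_sqr ler_wsqrtr// lerDr sqr_ge0. Qed.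
Lemma cabs_le_ReIm z : cabs z <= `|Re z| + `|Im z|.
Proof.
rewrite -[leRHS]ger0_norm ?addr_ge0// -sqrtr_sqr cabsE ler_wsqrtr//.
rewrite sqrrD -[`|Re z| ^+ 2]normrX -[`|Im z| ^+ 2]normrX !(ger0_norm (sqr_ge0 _)).
by rewrite lerD2r lerDl mulrn_wge0// mulr_ge0.
Qed.

Lemma cabs_expi t : cabs (expi t) = 1 :> R.
Proof. by rewrite cabsE /= cos2Dsin2 sqrtr1. Qed.
Lemma expiD s t : expi (s + t) = expi s * expi t :> R[i].
Proof. by apply: complex_ext; rewrite !cE /= ?cosD ?sinD//; ring. Qed.
Lemma dotC z w : dot z w = dot w z. Proof. by rewrite /dot; ring. Qed.
Lemma dotDl z1 z2 w : dot (z1 + z2) w = dot z1 w + dot z2 w.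
Proof. by rewrite /dot !cE; ring. Qed.
Lemma dotDr z w1 w2 : dot z (w1 + w2) = dot z w1 + dot z w2.
Proof. by rewrite /dot !cE; ring. Qed.
Lemma dotBl z1 z2 w : dot (z1 - z2) w = dot z1 w - dot z2 w.
Proof. by rewrite /dot !cE; ring. Qed.
Lemma dot0l z : dot 0 z = 0. Proof. by rewrite /dot/= !mul0r addr0. Qed.
Lemma dot0r z : dot z 0 = 0. Proof. by rewrite /dot/= !mulr0 addr0. Qed.
Lemma dotZl (a : R) z w : dot (a%:C * z) w = a * dot z w.
Proof. by rewrite /dot !cE; ring. Qed.
Lemma dot_expi t z w : dot (z * expi t) w = dot z (w * expi (- t)).
Proof. by rewrite /dot !cE /= cosN sinN; ring. Qed.

Lemma dot_ext z1 z2 : (forall w, dot z1 w = dot z2 w) -> z1 = z2.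
Proof.
move=> h; apply: complex_ext.
  by have := h 1; rewrite /dot/= !mulr1 !mulr0 !addr0.
by have := h 'i; rewrite /dot/= !mulr1 !mulr0 !add0r.
Qed.
Lemma dot_mull c z w : dot (c * z) w = dot z (conjc c * w).
Proof. by case: c z w => [? ?] [? ?] [? ?]; rewrite /dot/=; ring. Qed.

Lemma dotr1 z : dot z 1 = Re z.
Proof. by rewrite /dot/= mulr1 mulr0 addr0. Qed.
Lemma dotri z : dot z (Complex 0 1) = Im z.
Proof. by rewrite /dot/= mulr1 mulr0 add0r. Qed.

Lemma dot_le_cabs z w : `|dot z w| <= cabs z * cabs w.
Proof.
rewrite -[leRHS]ger0_norm ?mulr_ge0 ?cabs_ge0// -!sqrtr_sqr ler_wsqrtr//.
rewrite exprMn !cabs_sqr /dot -subr_ge0.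
suff -> : (Re z ^+ 2 + Im z ^+ 2) * (Re w ^+ 2 + Im w ^+ 2) -
  (Re z * Re w + Im z * Im w) ^+ 2 = (Re z * Im w - Im z * Re w) ^+ 2 by exact: sqr_ge0.
by ring.
Qed.

End Complex.

Section Measurability.
Variable R : realType.
Local Open Scope complex_scope.
Implicit Types (f g : R -> R[i]) (h : R -> R).
Local Notation Re := complex.Re.
Local Notation Im := complex.Im.

Local Notation cmeas := (@cmeasurable R setT).

Lemma cmeas_cst (z : R[i]) : cmeas (cst z).
Proof. by split; exact: measurable_cst. Qed.

Lemma cmeasD f g : cmeas f -> cmeas g -> cmeas (fun x => f x + g x).
Proof.
move=> [f1 f2] [g1 g2]; split.
- by rewrite (_ : (fun x => _) = (fun x => Re (f x) + Re (g x)));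
   [exact: measurable_funD|apply/funext => x; rewrite cE].
- by rewrite (_ : (fun x => _) = (fun x => Im (f x) + Im (g x)));
   [exact: measurable_funD|apply/funext => x; rewrite cE].
Qed.

Lemma cmeasM f g : cmeas f -> cmeas g -> cmeas (fun x => f x * g x).
Proof.
move=> [f1 f2] [g1 g2]; split.
- rewrite (_ : (fun x => _) = (fun x => Re (f x) * Re (g x) - Im (f x) * Im (g x))).
    by apply: measurable_funB; exact: measurable_funM.
  by apply/funext => x; rewrite cE.
- rewrite (_ : (fun x => _) = (fun x => Re (f x) * Im (g x) + Im (f x) * Re (g x))).
    by apply: measurable_funD; exact: measurable_funM.
  by apply/funext => x; rewrite cE.
Qed.

Lemma cmeas_real h : measurable_fun setT h -> cmeas (fun x => (h x)%:C).
Proof. by move=> mh; split => //=; exact: measurable_cst. Qed.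

Lemma cmeasN f : cmeas f -> cmeas (fun x => - f x).
Proof.
move=> [f1 f2]; split.
- by rewrite (_ : (fun x => _) = (fun x => - Re (f x)));
   [exact: measurableT_comp|apply/funext => x; rewrite cE].
- by rewrite (_ : (fun x => _) = (fun x => - Im (f x)));
   [exact: measurableT_comp|apply/funext => x; rewrite cE].
Qed.

Lemma cmeasB f g : cmeas f -> cmeas g -> cmeas (fun x => f x - g x).
Proof. by move=> mf mg; apply: cmeasD => //; exact: cmeasN. Qed.

Lemma cmeas_sum (I : Type) (s : seq I) (F : I -> R -> R[i]) :
  (forall i, cmeas (F i)) -> cmeas (fun x => \sum_(i <- s) F i x).
Proof.
move=> mF; elim: s => [|i s IH].
  by rewrite (_ : (fun x => _) = cst 0); [exact: cmeas_cst|apply/funext => x; rewrite big_nil].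
rewrite (_ : (fun x => _) = (fun x => F i x + \sum_(j <- s) F j x)).
  exact: cmeasD.
by apply/funext => x; rewrite big_cons.
Qed.

Lemma measurable_dot f g : cmeas f -> cmeas g -> measurable_fun setT (fun x => dot (f x) (g x)).
Proof.
by move=> [f1 f2] [g1 g2]; apply: measurable_funD; exact: measurable_funM.
Qed.

Lemma measurable_cabs f : cmeas f -> measurable_fun setT (fun x => cabs (f x)).
Proof.
move=> mf; rewrite (_ : (fun x => _) = (fun x => Num.sqrt (dot (f x) (f x)))).
  apply: (measurableT_comp _ (measurable_dot mf mf)).
  by apply: continuous_measurable_fun; exact: sqrt_continuous.
by apply/funext => x; rewrite -cabs_sqr_dot sqrtr_sqr ger0_norm ?cabs_ge0.
Qed.

Lemma measurable_expi (h : R -> R) : measurable_fun setT h -> cmeas (fun x => expi (h x)).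
Proof.
move=> mh; split => /=; apply: (measurableT_comp _ mh).
- by apply: continuous_measurable_fun; exact: continuous_cos.
- by apply: continuous_measurable_fun; exact: continuous_sin.
Qed.

Lemma cmeas_comp f (h : R -> R) : cmeas f -> measurable_fun setT h -> cmeas (f \o h).
Proof. by move=> [f1 f2] mh; split; [apply: (measurableT_comp f1)|apply: (measurableT_comp f2)]. Qed.

Lemma measurable_shift (a : R) : measurable_fun setT (fun x : R => x + a).
Proof. exact: measurable_funD. Qed.

Lemma measurable_oppR : measurable_fun setT (fun x : R => - x).
Proof. exact: measurableT_comp. Qed.

Lemma measurable_oppR2 h : measurable_fun setT h -> measurable_fun setT (fun x => - h x).
Proof. by move=> mh; exact: measurableT_comp. Qed.

Lemma measurable_indicR (D : set R) : measurable D -> measurable_fun setT (\1_D : R -> R).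
Proof. by move=> mD; exact: measurable_indic. Qed.

End Measurability.

(** * Lebesgue integration on the line *)

Section AffineChange.
Variable R : realType.
Local Notation mu := (@lebesgue_measure R).
Local Notation T := (measurableTypeR R).

Lemma ocitv_lebesgue (u v : R) : mu (`]u, v]%classic : set R) =
  if (u < v)%R then (v - u)%:E else 0%E.
Proof. by rewrite lebesgue_measure_itv/= lte_fin EFinN. Qed.

Variables (f : T -> T) (c : R).
Hypothesis mf : measurable_fun setT f.
Hypothesis c0 : 0 < c.
Hypothesis fitv : forall u v : R, u < v ->
  (c%:E * mu (f @^-1` `]u, v]) = (v - u)%:E)%E.

Let pf : {measure set T -> \bar R} :=
  measure_function_pushforward__canonical__measure_function_Measure mu mf.
Let nu := mscale (NngNum (ltW c0)) pf.

(** Uniqueness of Lebesgue measure only asks for agreement on half-open intervals, which is [fitv].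
    Translation, reflection and dilation thus share one change of variables. *)
Let lebesgue_nu (A : set T) : measurable A -> mu A = nu A.
Proof.
apply: lebesgue_measure_unique => X /ocitvP[->|[[u v] /= uv ->]].
  by rewrite !measure0.
by rewrite /nu /mscale /pushforward/= fitv// ocitv_lebesgue uv.
Qed.

Lemma ge0_integral_change (h : R -> \bar R) : measurable_fun setT h ->
  (forall x, (0 <= h x)%E) -> (c%:E * \int[mu]_x h (f x) = \int[mu]_x h x)%E.
Proof.
move=> mh h0; symmetry; rewrite (eq_measure_integral nu); last first.
  by move=> A mA _; exact: lebesgue_nu.
by rewrite ge0_integral_mscale//= ge0_integral_pushforward.
Qed.

Lemma integrable_change (h : R -> R) : mu.-integrable setT (EFin \o h) ->
  mu.-integrable setT (EFin \o (h \o f)).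
Proof.
move=> /integrableP[mh hoo]; have mh' := (measurable_EFinP _ _).1 mh.
apply/integrableP; split.
  by apply/measurable_EFinP; exact: measurableT_comp.
rewrite ltey; apply/negP => /eqP /= oo; move: hoo.
rewrite /= -(@ge0_integral_change (fun x => `|h x|%:E))//.
  by rewrite oo gt0_muley ?ltxx ?lte_fin.
by apply/measurable_EFinP; exact: measurableT_comp.
Qed.

Lemma integral_change (h : R -> R) : mu.-integrable setT (EFin \o h) ->
  c * \int[mu]_x h (f x) = \int[mu]_x h x.
Proof.
move=> ih; have ihf := integrable_change ih.
have mh := measurable_int mu ih.
rewrite -RintegralZl// /Rintegral; congr fine.
under eq_integral do rewrite EFinM.
rewrite integralZl// [in RHS]integralE [X in (_ * X)%E]integralE.
rewrite -[X in (_ = X - _)%E]ge0_integral_change//; last exact: measurable_funepos.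
rewrite -[X in (_ = _ - X)%E]ge0_integral_change//; last exact: measurable_funeneg.
rewrite muleBr; [|by []|].
  by congr (_ * _ - _ * _)%E; apply: eq_integral => x _; rewrite ?funeposE ?funenegE.
(* Distributing [c] over the difference of positive and negative parts requires that it not be of
   the form infinity minus infinity. *)
rewrite fin_num_adde_defr ?fin_numN; [by []|]; exact: (integrable_pos_fin_num measurableT ihf).
Qed.

End AffineChange.

Section Translation.
Variable R : realType.
Local Notation mu := (@lebesgue_measure R).

Lemma shift_itv (a u v : R) : u < v ->
  (1 * mu ((fun x : R => (x + a)%R) @^-1` `]u, v]) = (v - u)%:E)%E.
Proof.
move=> uv; rewrite mul1e (_ : _ @^-1` _ = `]u - a, v - a]%classic).
  by rewrite !ocitv_lebesgue ltrD2r uv opprB addrA subrK.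
by apply/seteqP; split => x /=; rewrite !in_itv/= => /andP[? ?]; apply/andP; split; lra.
Qed.

Lemma opp_itv (u v : R) : u < v ->
  (1 * mu ((fun x : R => (- x)%R) @^-1` `]u, v]) = (v - u)%:E)%E.
Proof.
move=> uv; rewrite mul1e (_ : _ @^-1` _ = `[- v, - u[%classic).
  by rewrite !lebesgue_measure_itv/= !lte_fin ltrN2 uv -EFinD opprK addrC.
by apply/seteqP; split => x /=; rewrite !in_itv/= => /andP[? ?]; apply/andP; split; lra.
Qed.

Lemma scale_itv (a u v : R) : 0 < a -> u < v ->
  (a%:E * mu ((fun x : R => (a * x)%R) @^-1` `]u, v]) = (v - u)%:E)%E.
Proof.
move=> a0 uv; rewrite (_ : _ @^-1` _ = `]u / a, v / a]%classic).
  rewrite !ocitv_lebesgue ltr_pM2r ?invr_gt0// uv.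
  by rewrite -EFinM -mulrBl mulrCA divff ?gt_eqF// mulr1.
apply/seteqP; split => x /=; rewrite !in_itv/= => /andP[ux xv].
  by rewrite ltr_pdivrMr// ler_pdivlMr// mulrC ux xv.
by move: ux xv; rewrite ltr_pdivrMr// ler_pdivlMr// mulrC => -> ->.
Qed.

Lemma measurable_scale (a : R) : measurable_fun setT (fun x : R => a * x).
Proof. exact: measurable_funM. Qed.

Lemma ge0_integral_shift (a : R) (h : R -> \bar R) : measurable_fun setT h ->
  (forall x, (0 <= h x)%E) -> (\int[mu]_x h (x + a)%R = \int[mu]_x h x)%E.
Proof.
move=> mh h0.
by rewrite -[RHS](ge0_integral_change (measurable_shift a) ltr01 (shift_itv a))// mul1e.
Qed.

End Translation.

Section RealIntegral.
Variable R : realType.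
Local Notation mu := (@lebesgue_measure R).
Implicit Types (h k u v : R -> R).

Definition integ h : Prop := mu.-integrable setT (EFin \o h).
Definition rint h : R := \int[mu]_x h x.

Lemma ae_all (P : R -> Prop) : (forall x, P x) -> {ae mu, forall x, P x}.
Proof. by move=> aP; apply: aeW. Qed.

Lemma ae_imp (P Q : R -> Prop) : (forall x, P x -> Q x) ->
  {ae mu, forall x, P x} -> {ae mu, forall x, Q x}.
Proof. by move=> PQ; apply: negligibleS => x /=; apply: contra_not; exact: PQ. Qed.

Lemma meas_EFin h : measurable_fun setT h ->
  @measurable_fun _ _ (measurableTypeR R) (\bar R) setT (EFin \o h).
Proof. by move=> mh; exact: (measurable_EFinP _ _).2 mh. Qed.

Lemma integ_meas h : integ h -> measurable_fun setT h.
Proof. by move=> /measurable_int/measurable_EFinP. Qed.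

Lemma integ_dom h k : measurable_fun setT h -> integ k -> (forall x, `|h x| <= k x) -> integ h.
Proof.
move=> mh ik hk; apply: le_integrable ik => //; first exact/measurable_EFinP.
by move=> x _; rewrite lee_fin/= (le_trans (hk x))// ler_norm.
Qed.

Lemma eq_integ h k : (forall x, h x = k x) -> integ h -> integ k.
Proof. by move=> /funext ->. Qed.

Lemma eq_rint h k : (forall x, h x = k x) -> rint h = rint k.
Proof. by move=> /funext ->. Qed.

Lemma integ0 : integ (fun=> 0). Proof. exact: integrable0. Qed.

Lemma integD h k : integ h -> integ k -> integ (fun x => h x + k x).
Proof. by move=> ih ik; exact: (integrableD measurableT ih ik). Qed.
Lemma integB h k : integ h -> integ k -> integ (fun x => h x - k x).
Proof. by move=> ih ik; exact: (integrableB measurableT ih ik). Qed.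
Lemma integZ c h : integ h -> integ (fun x => c * h x).
Proof. by move=> ih; exact: (integrableZl measurableT c ih). Qed.
Lemma integ_norm h : integ h -> integ (fun x => `|h x|).
Proof. exact: integrable_norm. Qed.

Lemma integMb h k (M : R) : integ h -> measurable_fun setT k -> (forall x, `|k x| <= M) ->
  integ (fun x => h x * k x).
Proof.
move=> ih mk kM; apply: (integ_dom _ (integZ M (integ_norm ih))).
  by apply: measurable_funM => //; exact: integ_meas.
by move=> x; rewrite normrM mulrC ler_wpM2r.
Qed.

Lemma rintD h k : integ h -> integ k -> rint (fun x => h x + k x) = rint h + rint k.
Proof. by move=> ih ik; rewrite /rint RintegralD. Qed.
Lemma rintB h k : integ h -> integ k -> rint (fun x => h x - k x) = rint h - rint k.
Proof. by move=> ih ik; rewrite /rint RintegralB. Qed.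
Lemma rintZ c h : integ h -> rint (fun x => c * h x) = c * rint h.
Proof. by move=> ih; rewrite /rint RintegralZl. Qed.
Lemma rintN h : integ h -> rint (fun x => - h x) = - rint h.
Proof. by move=> ih; rewrite -mulN1r -rintZ//; apply: eq_rint => x; rewrite mulN1r. Qed.
Lemma rint0 : rint (fun=> 0) = 0. Proof. by rewrite /rint /Rintegral integral0. Qed.
Lemma rint_ge0 h : (forall x, 0 <= h x) -> 0 <= rint h.
Proof. by move=> h0; apply: Rintegral_ge0. Qed.
Lemma le_rint h k : integ h -> integ k -> (forall x, h x <= k x) -> rint h <= rint k.
Proof. by move=> ih ik hk; apply: le_Rintegral. Qed.
Lemma normr_rint h : integ h -> `|rint h| <= rint (fun x => `|h x|).
Proof. by move=> ih; exact: le_normr_Rintegral. Qed.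
Lemma normr_rint_le h k : integ h -> integ k -> (forall x, `|h x| <= k x) -> `|rint h| <= rint k.
Proof.
move=> ih ik hk; apply: (le_trans (normr_rint ih)); apply: le_rint => //.
exact: integ_norm.
Qed.

Lemma rintE h : integ h -> (rint h)%:E = (\int[mu]_x (h x)%:E)%E.
Proof. by move=> ih; rewrite /rint /Rintegral fineK//; exact: integrable_fin_num. Qed.

Lemma integ_ge0P h : measurable_fun setT h -> (forall x, 0 <= h x) ->
  (\int[mu]_x (h x)%:E < +oo)%E -> integ h.
Proof.
move=> mh h0 hoo; apply/integrableP; split; first exact/measurable_EFinP.
by under eq_integral do rewrite gee0_abs ?lee_fin//.
Qed.

Lemma integ_lty h : integ h -> (\int[mu]_x `|h x|%:E < +oo)%E.
Proof. by move=> /integrableP[]. Qed.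

Lemma integ_sum (I : Type) (s : seq I) (F : I -> R -> R) :
  (forall i, integ (F i)) -> integ (fun x => \sum_(i <- s) F i x).
Proof.
move=> iF; elim: s => [|i s IH]; first by apply: eq_integ integ0 => x; rewrite big_nil.
by apply: eq_integ (integD (iF i) IH) => x; rewrite big_cons.
Qed.

Lemma rint_sum (I : Type) (s : seq I) (F : I -> R -> R) :
  (forall i, integ (F i)) -> rint (fun x => \sum_(i <- s) F i x) = \sum_(i <- s) rint (F i).
Proof.
move=> iF; elim: s => [|i s IH].
  by rewrite big_nil -[RHS]rint0; apply: eq_rint => x; rewrite big_nil.
rewrite big_cons -IH -rintD//; last exact: integ_sum.
by apply: eq_rint => x; rewrite big_cons.
Qed.

Lemma rint_dct (H : nat -> R -> R) h k :
  (forall n, measurable_fun setT (H n)) -> measurable_fun setT h -> integ k ->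
  (forall n x, `|H n x| <= k x) -> {ae mu, forall x, H n x @[n --> \oo] --> h x} ->
  integ h /\ rint (H n) @[n --> \oo] --> rint h.
Proof.
move=> mH mh ik Hk Hh.
have iH n : integ (H n) by exact: integ_dom (Hk n).
have [||||ih _ cv] := @dominated_convergence _ _ _ mu setT measurableT
  (fun n => EFin \o H n) (EFin \o h) _ _ _ _ ik.
- by move=> n; exact: meas_EFin.
- exact: meas_EFin.
- apply: ae_imp Hh => x Hx _; apply: cvg_EFin => //; exact: nearW.
- by apply: aeW => x n _; exact: Hk.
split => //.
rewrite /rint /Rintegral; apply: fine_cvg; rewrite fineK//; exact: integrable_fin_num.
Qed.

Lemma rint_dct0 (H : nat -> R -> R) k :
  (forall n, measurable_fun setT (H n)) -> integ k ->
  (forall n x, `|H n x| <= k x) -> {ae mu, forall x, H n x @[n --> \oo] --> (0 : R)} ->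
  rint (H n) @[n --> \oo] --> (0 : R).
Proof.
move=> mH ik Hk H0; rewrite -rint0.
by apply: (proj2 (rint_dct mH _ ik Hk H0)); exact: measurable_cst.
Qed.

Lemma integ_shift a h : integ h -> integ (fun x => h (x + a)).
Proof. exact: (integrable_change (measurable_shift a) ltr01 (shift_itv a)). Qed.
Lemma integ_opp h : integ h -> integ (fun x => h (- x)).
Proof. exact: (integrable_change (@measurable_oppR R) ltr01 (@opp_itv R)). Qed.
Lemma integ_scale a h : 0 < a -> integ h -> integ (fun x => h (a * x)).
Proof. by move=> a0; exact: (integrable_change (measurable_scale a) a0 (fun b c => @scale_itv R a b c a0)). Qed.

Lemma rint_shift a h : integ h -> rint (fun x => h (x + a)) = rint h.
Proof.
by move=> ih; rewrite -[RHS](integral_change (measurable_shift a) ltr01 (shift_itv a) ih) mul1r.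
Qed.
Lemma rint_opp h : integ h -> rint (fun x => h (- x)) = rint h.
Proof.
by move=> ih; rewrite -[RHS](integral_change (@measurable_oppR R) ltr01 (@opp_itv R) ih) mul1r.
Qed.
Lemma rint_scale a h : 0 < a -> integ h -> a * rint (fun x => h (a * x)) = rint h.
Proof.
by move=> a0 ih; exact: (integral_change (measurable_scale a) a0 (fun b c => @scale_itv R a b c a0)).
Qed.

Lemma rint_odd h : integ h -> (forall x, h (- x) = - h x) -> rint h = 0.
Proof.
move=> ih oh; have := rint_opp ih.
rewrite (_ : rint _ = - rint h); first by lra.
by rewrite -rintN//; apply: eq_rint.
Qed.

End RealIntegral.

(** * Fubini for kernels of two real variables *)

Section Fubini2.
Variable R : realType.
Local Notation mu := (@lebesgue_measure R).
Implicit Types (u v : R -> R) (K : R -> R -> R).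

Definition meas2 K : Prop :=
  measurable_fun setT (fun z : measurableTypeR R * measurableTypeR R => K z.1 z.2).
Definition integ2 K : Prop :=
  (mu \x mu)%E.-integrable setT
   (fun z : measurableTypeR R * measurableTypeR R => (K z.1 z.2)%:E).

Lemma meas2_fst u : measurable_fun setT u -> meas2 (fun x _ => u x).
Proof. by move=> mu_; exact: (measurableT_comp mu_ measurable_fst). Qed.
Lemma meas2_snd u : measurable_fun setT u -> meas2 (fun _ y => u y).
Proof. by move=> mu_; exact: (measurableT_comp mu_ measurable_snd). Qed.
Lemma meas2M K L : meas2 K -> meas2 L -> meas2 (fun x y => K x y * L x y).
Proof. exact: measurable_funM. Qed.
Lemma meas2D K L : meas2 K -> meas2 L -> meas2 (fun x y => K x y + L x y).
Proof. exact: measurable_funD. Qed.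
Lemma meas2_comp u K : measurable_fun setT u -> meas2 K -> meas2 (fun x y => u (K x y)).
Proof. by move=> mu_ mK; exact: (measurableT_comp mu_ mK). Qed.

Lemma integ2_dom K L : meas2 K -> integ2 L -> (forall x y, `|K x y| <= L x y) -> integ2 K.
Proof.
move=> mK iL KL; apply: le_integrable iL => //; first exact/measurable_EFinP.
by move=> z _; rewrite lee_fin/= (le_trans (KL _ _))// ler_norm.
Qed.

Lemma integ2_prod u v : integ u -> integ v -> integ2 (fun x y => u x * v y).
Proof.
move=> iu iv.
have m2 : meas2 (fun x y => u x * v y).
  by apply: meas2M; [apply: meas2_fst|apply: meas2_snd]; exact: integ_meas.
apply/integrable12ltyP; first exact/measurable_EFinP.
rewrite (_ : (\int[mu]_x _)%E = (\int[mu]_x (`|u x| * rint (fun y => `|v y|))%:E)%E).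
  have : integ (fun x => rint (fun y => `|v y|) * `|u x|) by exact/integZ/integ_norm.
  move=> /integ_lty; apply: le_lt_trans; apply: ge0_le_integral => //.
  - by move=> x _; rewrite lee_fin mulr_ge0// rint_ge0.
  - by apply/measurable_EFinP/measurable_funM => //; apply: measurableT_comp => //; exact: integ_meas.
  - by apply/measurable_EFinP/measurableT_comp => //; apply: measurable_funM => //;
      apply: measurableT_comp => //; exact: integ_meas.
  - by move=> x _; rewrite lee_fin mulrC ler_norm.
apply: eq_integral => x _; rewrite -rintZ; last exact: integ_norm.
rewrite rintE; last exact/integZ/integ_norm.
by apply: eq_integral => y _; rewrite /= normrM.
Qed.

(** Integrating in [x] first, translation invariance makes the inner integral the constant L^1 norm
    of [v]. *)
Lemma integ2_conv u v : integ u -> integ v -> integ2 (fun x y => u y * v (x + y)).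
Proof.
move=> iu iv.
have m2 : meas2 (fun x y => u y * v (x + y)).
  apply: meas2M; first by apply: meas2_snd; exact: integ_meas.
  apply: meas2_comp; first exact: integ_meas.
  by apply: meas2D; [apply: (@meas2_fst id)|apply: (@meas2_snd id)]; exact: measurable_id.
apply/integrable21ltyP; first exact/measurable_EFinP.
rewrite (_ : (\int[mu]_x _)%E = (\int[mu]_y (`|u y| * rint (fun y => `|v y|))%:E)%E).
  have : integ (fun x => rint (fun y => `|v y|) * `|u x|) by exact/integZ/integ_norm.
  move=> /integ_lty; apply: le_lt_trans; apply: ge0_le_integral => //.
  - by move=> x _; rewrite lee_fin mulr_ge0// rint_ge0.
  - by apply/measurable_EFinP/measurable_funM => //; apply: measurableT_comp => //; exact: integ_meas.
  - by apply/measurable_EFinP/measurableT_comp => //; apply: measurable_funM => //;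
      apply: measurableT_comp => //; exact: integ_meas.
  - by move=> x _; rewrite lee_fin mulrC ler_norm.
apply: eq_integral => y _.
have iy := integ_shift y (integ_norm iv).
rewrite -(rint_shift y (integ_norm iv)) -rintZ//.
rewrite rintE; last exact: integZ.
by apply: eq_integral => x _; rewrite /= normrM.
Qed.

(** The inner integrals in Fubini's theorem are extended reals, finite only almost everywhere; this
    passes to real-valued ones. *)
Lemma fine_integ (F : R -> \bar R) : mu.-integrable setT F ->
  integ (fun x => fine (F x)) /\ (rint (fun x => fine (F x)) = fine (\int[mu]_x F x)).
Proof.
move=> iF.
have mF := measurable_int mu iF.
have iF' : integ (fun x => fine (F x)).
  apply: le_integrable iF => //.
    by apply/measurable_EFinP; exact: measurableT_comp.
  by move=> x _ /=; case: (F x) => [r||] //=; rewrite ?normr0 ?leey.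
split => //; rewrite /rint /Rintegral; congr fine.
apply: ae_eq_integral => //; first exact: (measurable_int mu iF').
have := integrable_ae measurableT iF; apply: filterS => x /(_ I) Fx _ /=.
by rewrite fineK.
Qed.

Lemma integ_fubiniF K : integ2 K -> integ (fun x => rint (K x)).
Proof.
by move=> iK; have [] := fine_integ (integrable_fubini_F iK).
Qed.

Lemma integ_swap K : integ2 K -> integ2 (fun x y => K y x).
Proof.
move=> /[dup] iK /integrableP[mK _].
have mK' : meas2 (fun x y => K y x).
  apply: (measurableT_comp ((measurable_EFinP _ _).1 mK) (f := fun z => K z.1 z.2) (g := fun z => (z.2, z.1))).
  exact: measurable_swap.
by apply/integrable21ltyP; [exact/measurable_EFinP|exact/(integrable12ltyP mu mu mK).1].
Qed.

Lemma rint_fubini K : integ2 K ->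
  rint (fun x => rint (K x)) = rint (fun y => rint (fun x => K x y)).
Proof.
move=> iK; have [_ e1] := fine_integ (integrable_fubini_F iK).
have [_ e2] := fine_integ (integrable_fubini_F (integ_swap iK)).
rewrite /rint in e1 e2 *; rewrite e1 e2; congr fine.
exact: (Fubini iK).
Qed.

End Fubini2.

(** * Plancherel theorem and Fourier inversion *)

Section Abel.
Variable R : realType.
Local Notation mu := (@lebesgue_measure R).
Implicit Types (e t x xi : R).

Lemma normr_cos_le1 x : `|cos x| <= 1.
Proof. by rewrite ler_norml cos_geN1 cos_le1. Qed.
Lemma normr_sin_le1 x : `|sin x| <= 1.
Proof. by rewrite ler_norml sin_geN1 sin_le1. Qed.

Lemma measurable_cosR : measurable_fun setT (@cos R).
Proof. by apply: continuous_measurable_fun; exact: continuous_cos. Qed.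
Lemma measurable_sinR : measurable_fun setT (@sin R).
Proof. by apply: continuous_measurable_fun; exact: continuous_sin. Qed.
Lemma measurable_cosMr t : measurable_fun setT (fun x => cos (x * t)).
Proof. by apply: (measurableT_comp measurable_cosR); exact: measurable_funM. Qed.
Lemma measurable_cosMl t : measurable_fun setT (fun x => cos (t * x)).
Proof. by apply: (measurableT_comp measurable_cosR); exact: measurable_funM. Qed.

Lemma integ_even_half (f : R -> R) l : (forall x, 0 <= f x) -> continuous f ->
  (forall x, f (- x) = f x) ->
  (\int[mu]_(x in `[0%R, +oo[) (f x)%:E = l%:E)%E ->
  integ f /\ rint f = 2 * l.
Proof.
move=> f0 cf ef fl.
have : (\int[mu]_x (f x)%:E = (2 * l)%:E)%E.
  rewrite ge0_symfun_integralT//; last by move=> x; rewrite /= ef.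
  by rewrite EFinM -fl set_itvcy.
move=> e; split; last by rewrite /rint /Rintegral e.
apply: integ_ge0P => //; first exact: continuous_measurable_fun.
by rewrite e ltry.
Qed.

Lemma integ_oneDsqr : integ (fun x : R => (1 + x ^+ 2)^-1) /\
  rint (fun x : R => (1 + x ^+ 2)^-1) = pi.
Proof.
have [||||i ->] := @integ_even_half (fun x : R => (1 + x ^+ 2)^-1) (pi / 2).
- by move=> x; rewrite invr_ge0 addr_ge0// sqr_ge0.
- exact: continuous_oneDsqrV.
- by move=> x; rewrite sqrrN.
- exact: integral0y_oneDsqr.
by split => //; field.
Qed.

(** An antiderivative of exp(- e xi) (1 + cos(t xi)) that vanishes at infinity. The summand 1 keeps
    the integrand nonnegative, as the fundamental theorem on a half-line used below requires. *)
Let abelF (e t xi : R) : R := - e^-1 * expR (- e * xi) +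
  (e ^+ 2 + t ^+ 2)^-1 * (expR (- e * xi) * (t * sin (t * xi) - e * cos (t * xi))).

Let abelF_derive e t xi : 0 < e ->
  is_derive xi 1 (abelF e t) (expR (- e * xi) * (1 + cos (t * xi))).
Proof.
move=> e0; have et : e ^+ 2 + t ^+ 2 != 0.
  by rewrite gt_eqF// ltr_pwDl ?exprn_gt0// sqr_ge0.
rewrite /abelF; apply: is_derive_eq.
rewrite /GRing.scale/=; field.
by rewrite et gt_eqF.
Qed.

Let abelF_cvg e t : 0 < e -> abelF e t x @[x --> +oo%R] --> (0 : R).
Proof.
move=> e0.
have ec : expR (- e * x) @[x --> +oo%R] --> (0 : R).
  rewrite (_ : (fun x => expR (- e * x)) =
               (fun z => expR (- z)) \o (fun z => e * z)); last first.
    by apply: eq_fun => x; rewrite mulNr.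
  apply: (@cvg_comp _ _ _ _ _ _ (pinfty_nbhs R)); last exact: cvgr_expR.
  exact: gt0_cvgMry.
pose M := e^-1 + `|(e ^+ 2 + t ^+ 2)^-1| * (`|t| + e).
apply/cvgr0Pnorm_le => eps eps0.
have M0 : 0 <= M by rewrite /M addr_ge0 ?invr_ge0 ?mulr_ge0// ?addr_ge0// ltW.
have eM : 0 < eps / (M + 1) by rewrite divr_gt0// ltr_wpDl.
move/cvgr0Pnorm_le : ec => /(_ _ eM); apply: filterS => x ex.
apply: (@le_trans _ _ (M * expR (- e * x))).
  rewrite /abelF (le_trans (ler_normD _ _))// /M mulrDl lerD//.
    by rewrite normrM normrN (ger0_norm (expR_ge0 _)) ger0_norm// invr_ge0 ltW.
  rewrite !normrM -mulrA (ger0_norm (expR_ge0 _)) ler_wpM2l// mulrC ler_wpM2r ?expR_ge0//.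
  rewrite (le_trans (ler_normB _ _))// !normrM (gtr0_norm e0) lerD//.
    by rewrite ler_piMr ?normr_sin_le1.
  by rewrite ler_piMr ?normr_cos_le1// ltW.
move: ex; rewrite (ger0_norm (expR_ge0 _)) => ex.
apply: (@le_trans _ _ (M * (eps / (M + 1)))); first exact: ler_wpM2l.
rewrite mulrCA ger_pMr// ler_pdivrMr ?ltr_wpDl// mul1r lerDl//.
Qed.

Definition abelw e xi := expR (- e * `|xi|).

Lemma continuous_abelw e : continuous (abelw e).
Proof.
move=> x; rewrite /abelw; apply: continuous_comp; last exact: continuous_expR.
by apply: cvgM; [exact: cvg_cst|exact: norm_continuous].
Qed.

Lemma measurable_abelw e : measurable_fun setT (abelw e).
Proof. by apply: continuous_measurable_fun; exact: continuous_abelw. Qed.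

Lemma abelw_ge0 e x : 0 <= abelw e x. Proof. exact: expR_ge0. Qed.

Let abel_aux e t : 0 < e -> integ (fun xi => abelw e xi * (1 + cos (t * xi))) /\
  rint (fun xi => abelw e xi * (1 + cos (t * xi))) = 2 * (e^-1 + e / (e ^+ 2 + t ^+ 2)).
Proof.
move=> e0; have e0' : e != 0 by rewrite gt_eqF.
apply: integ_even_half.
- by move=> x; rewrite mulr_ge0 ?abelw_ge0// -lerBlDl sub0r cos_geN1.
- move=> x; apply: cvgM; first exact: continuous_abelw.
  apply: cvgD; first exact: cvg_cst.
  apply: (continuous_comp (g := cos)); last exact: continuous_cos.
  by apply: cvgM; [exact: cvg_cst|exact: cvg_id].
- by move=> x; rewrite /abelw normrN mulrN cosN.
transitivity (\int[mu]_(x in `[0%R, +oo[) (expR (- e * x) * (1 + cos (t * x)))%:E)%E.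
  by apply: eq_integral => x; rewrite inE/= in_itv/= andbT => x0; rewrite /abelw ger0_norm.
have dF xi := @abelF_derive e t xi e0.
have cf : continuous (fun x : R => expR (- e * x) * (1 + cos (t * x))).
  move=> x; apply: cvgM.
    apply: (continuous_comp (g := expR)); last exact: continuous_expR.
    by apply: cvgM; [exact: cvg_cst|exact: cvg_id].
  apply: cvgD; first exact: cvg_cst.
  apply: (continuous_comp (g := cos)); last exact: continuous_cos.
  by apply: cvgM; [exact: cvg_cst|exact: cvg_id].
rewrite (ge0_continuous_FTC2y _ _ (@abelF_cvg e t e0)).
- rewrite -EFinB; congr EFin; rewrite /abelF mulr0 mulr0 expR0 sin0 cos0.
  by field; rewrite e0' gt_eqF// ltr_pwDl ?exprn_gt0// sqr_ge0.
- by move=> x _; rewrite mulr_ge0 ?expR_ge0// -lerBlDl sub0r cos_geN1.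
- exact: continuous_subspaceT.
- by move=> x x0; apply: ex_derive.
- apply: cvg_at_right_filter; apply: differentiable_continuous.
  by apply/derivable1_diffP; apply: ex_derive.
- by move=> x _; rewrite derive1E; exact: derive_val.
Qed.

Lemma integ_abelw e : 0 < e -> integ (abelw e).
Proof.
move=> e0; have [i _] := abel_aux 0 e0.
apply: eq_integ (integZ (2^-1) i) => x; rewrite mul0r cos0.
by field.
Qed.

Lemma rint_abelw_cos e t : 0 < e ->
  rint (fun xi => abelw e xi * cos (t * xi)) = 2 * e / (e ^+ 2 + t ^+ 2).
Proof.
move=> e0; have e0' : e != 0 by rewrite gt_eqF.
have [i1 r1] := abel_aux t e0.
have [i0 r0] := abel_aux 0 e0.
(* The weight alone is half of the case t = 0, because 1 + cos 0 = 2. *)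
transitivity (rint (fun xi => abelw e xi * (1 + cos (t * xi)) -
    2^-1 * (abelw e xi * (1 + cos (0 * xi))))).
  by apply: eq_rint => x; rewrite mul0r cos0; field.
rewrite rintB//; last exact: integZ.
rewrite rintZ// r0 r1; field.
by rewrite e0' gt_eqF// ltr_pwDl ?exprn_gt0// sqr_ge0.
Qed.

(** This is 2 pi times the Poisson kernel of the half-plane at height [e]. *)
Let kern e x := 2 * e / (e ^+ 2 + x ^+ 2).

Let kern_ge0 e x : 0 < e -> 0 <= kern e x.
Proof. by move=> e0; rewrite divr_ge0 ?mulr_ge0 ?addr_ge0 ?sqr_ge0// ltW. Qed.

Let den_gt0 e x : 0 < e -> 0 < e ^+ 2 + x ^+ 2.
Proof. by move=> e0; rewrite ltr_pwDl ?exprn_gt0// sqr_ge0. Qed.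

Let measurable_kern e : 0 < e -> measurable_fun setT (kern e).
Proof.
move=> e0; apply: continuous_measurable_fun => x; apply: cvgM; first exact: cvg_cst.
apply: cvgV; first by rewrite gt_eqF// den_gt0.
by apply: cvgD; [exact: cvg_cst|exact: exprn_continuous].
Qed.

Let kern_le e x : 0 < e -> kern e x <= 2 / e.
Proof.
move=> e0; rewrite /kern ler_pdivrMr ?den_gt0// -subr_ge0.
suff -> : 2 / e * (e ^+ 2 + x ^+ 2) - 2 * e = 2 / e * x ^+ 2.
  by rewrite mulr_ge0 ?sqr_ge0// divr_ge0// ltW.
by field; rewrite gt_eqF.
Qed.

Let integ_kern e (r : R -> R) : 0 < e -> integ r -> integ (fun x => r x * kern e x).
Proof.
move=> e0 ir; apply: (integMb (M := 2 / e)) => //; first exact: measurable_kern.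
by move=> x; rewrite ger0_norm ?kern_ge0// kern_le.
Qed.

(** Fubini, the weight providing integrability in [xi]; the inner integral is then the explicit
    cosine transform of the weight. *)
Let abel_swap e (r : R -> R) : 0 < e -> integ r ->
  rint (fun xi => abelw e xi * rint (fun x => r x * cos (x * xi))) =
  rint (fun x => r x * kern e x).
Proof.
move=> e0 ir.
pose K x xi := r x * abelw e xi * cos (x * xi).
have mc : meas2 (fun x xi : R => cos (x * xi)).
  apply: (@meas2_comp R cos (fun x y => x * y)).
    by apply: continuous_measurable_fun; exact: continuous_cos.
  by apply: meas2M; [apply: (@meas2_fst R id)|apply: (@meas2_snd R id)]; exact: measurable_id.
have iK : integ2 K.
  apply: (@integ2_dom R K (fun x xi => `|r x| * abelw e xi)).
  - apply: meas2M => //; apply: meas2M.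
      by apply: meas2_fst; exact: integ_meas.
    by apply: meas2_snd; exact: measurable_abelw.
  - by apply: integ2_prod; [exact: integ_norm|exact: integ_abelw].
  - by move=> x y; rewrite !normrM (ger0_norm (abelw_ge0 _ _)) ler_piMr ?mulr_ge0 ?abelw_ge0 ?normr_cos_le1.
transitivity (rint (fun xi => rint (fun x => K x xi))).
  apply: eq_rint => xi; rewrite -rintZ.
    by apply: eq_rint => x; rewrite /K; ring.
  apply: (@integMb _ _ _ 1) => //.
    exact: measurable_cosMr.
  by move=> x; exact: normr_cos_le1.
rewrite -(rint_fubini iK); apply: eq_rint => x.
rewrite /kern -rint_abelw_cos// -rintZ.
  by apply: eq_rint => y; rewrite /K; ring.
apply: (@integMb _ _ _ 1) => //; first exact: integ_abelw.
  exact: measurable_cosMl.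
by move=> y; exact: normr_cos_le1.
Qed.

Let kern_scale e x (s : R) : 0 < e -> e * (s * kern e (e * x)) = s * (2 * (1 + x ^+ 2)^-1).
Proof.
move=> e0; have d1 : 1 + x ^+ 2 != 0 by rewrite gt_eqF// ltr_pwDl// sqr_ge0.
rewrite /kern (_ : e ^+ 2 + (e * x) ^+ 2 = e ^+ 2 * (1 + x ^+ 2)); last by ring.
by field; rewrite d1 gt_eqF.
Qed.

Let ee (n : nat) : R := n.+1%:R^-1.
Let ee0 n : 0 < ee n. Proof. by rewrite invr_gt0. Qed.
Let ee_cvg : ee n @[n --> \oo] --> (0 : R).
Proof. exact: cvg_harmonic. Qed.

(** At distance more than [d] from 0 the kernel is at most 2 e / d^2, so the integral is O(e). *)
Let abel_far (d : R) (r : R -> R) : 0 < d -> integ r -> (forall x, `|x| <= d -> r x = 0) ->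
  rint (fun x => r x * kern (ee n) x) @[n --> \oo] --> (0 : R).
Proof.
move=> d0 ir r0.
have bnd n x : `|r x * kern (ee n) x| <= ee n * (2 / d ^+ 2 * `|r x|).
  have [xd|xd] := leP `|x| d; first by rewrite r0// mul0r normr0 !mulr0.
  rewrite normrM (ger0_norm (kern_ge0 _ _))// mulrC mulrA ler_wpM2r//.
  rewrite /kern (_ : ee n * (2 / d ^+ 2) = 2 * ee n / d ^+ 2); last by ring.
  apply: ler_wpM2l; first by rewrite mulr_ge0 ?ltW.
  rewrite lef_pV2 ?posrE ?den_gt0 ?exprn_gt0//.
  apply: ler_wpDl; first exact: sqr_ge0.
  by rewrite -[leRHS](real_normK (num_real x)) lerXn2r ?nnegrE ?ltW// (lt_trans d0).
apply/cvgr0Pnorm_le => eps eps0.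
pose M := rint (fun x => 2 / d ^+ 2 * `|r x|).
have M0 : 0 <= M by apply: rint_ge0 => x; rewrite mulr_ge0// divr_ge0// sqr_ge0.
have eM : 0 < eps / (M + 1) by rewrite divr_gt0// ltr_wpDl.
move/cvgr0Pnorm_le : ee_cvg => /(_ _ eM); apply: filterS => n en.
have iM : integ (fun x => 2 / d ^+ 2 * `|r x|) by exact/integZ/integ_norm.
apply: (@le_trans _ _ (ee n * M)).
  rewrite /M -rintZ//; apply: normr_rint_le => //; last exact: integZ.
  apply: integ_dom (integZ (ee n) iM) _ => //.
  by apply: measurable_funM; [exact: integ_meas|exact: measurable_kern].
move: en; rewrite gtr0_norm// => en.
apply: (@le_trans _ _ (eps / (M + 1) * M)); first exact: ler_wpM2r.
by rewrite mulrAC -mulrA ger_pMr// ler_pdivrMr ?ltr_wpDl// mul1r lerDl.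
Qed.

(** The substitution x = e u moves the parameter from the kernel into [r]; the fixed kernel 2 / (1 +
    u^2), of integral 2 pi, then gives an integrable majorant because [r] is bounded. *)
Let abel_near (B : R) (r : R -> R) : integ r -> (forall x, `|r x| <= B) ->
  r x @[x --> 0] --> r 0 ->
  rint (fun x => r x * kern (ee n) x) @[n --> \oo] --> 2 * pi * r 0.
Proof.
move=> ir rB cr.
have [io ro] := integ_oneDsqr.
have mr := integ_meas ir.
have -> : (fun n => rint (fun x => r x * kern (ee n) x)) =
    fun n => rint (fun u => r (ee n * u) * (2 * (1 + u ^+ 2)^-1)).
  apply/funext => n; rewrite -(rint_scale (ee0 n)).
    rewrite -rintZ; last first.
      apply: (@integ_scale R (ee n) (fun x => r x * kern (ee n) x)) => //.
      exact: integ_kern.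
    by apply: eq_rint => x; exact: kern_scale.
  exact: integ_kern.
rewrite (_ : 2 * pi * r 0 = rint (fun u => r 0 * (2 * (1 + u ^+ 2)^-1))); last first.
  by rewrite !rintZ ?ro//; [ring|exact: integZ].
apply: (proj2 (@rint_dct R _ _ (fun u => B * (2 * (1 + u ^+ 2)^-1)) _ _ _ _ _)).
- move=> n; apply: measurable_funM; last by apply: integ_meas; exact: integZ.
  by apply: (measurableT_comp mr); exact: measurable_scale.
- by apply: integ_meas; do 2 apply: integZ.
- by do 2 apply: integZ.
- move=> n x; rewrite normrM (@ger0_norm _ (2 * _)) ?mulr_ge0 ?invr_ge0 ?addr_ge0 ?sqr_ge0//.
  by rewrite ler_wpM2r ?mulr_ge0 ?invr_ge0 ?addr_ge0 ?sqr_ge0.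
- apply: aeW => u /=; apply: cvgM; last exact: cvg_cst.
  apply: (@cvg_comp _ _ _ (fun n => ee n * u) r _ (nbhs (0 : R))) => //.
  have : ee n * u @[n --> \oo] --> 0 * u by apply: cvgM => //; exact: cvg_cst.
  by rewrite mul0r.
Qed.

(* By Fubini the left-hand side is the Poisson mean of [r]. *)
Lemma abel_summation (r : R -> R) : integ r -> {for 0, continuous r} ->
  rint (fun xi => abelw (n.+1%:R^-1) xi * rint (fun x => r x * cos (x * xi)))
    @[n --> \oo] --> 2 * pi * r 0.
Proof.
move=> ir cr.
have [d d0 rd] : exists2 d : R, 0 < d & forall x, `|x| <= d -> `|r x| <= `|r 0| + 1.
  move/cvgrPdist_le : cr => /(_ 1 ltr01) /nbhs_ballP[d /= d0 dr].
  exists (d / 2); first by rewrite divr_gt0.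
  move=> x xd; have h : `|r 0 - r x| <= 1.
    apply: dr; rewrite /ball/= sub0r normrN (le_lt_trans xd)// ltr_pdivrMr//.
    by rewrite ltr_pMr// ltr1n.
  rewrite -{1}(subrK (r 0) (r x)) (le_trans (ler_normD _ _))// addrC lerD2l.
  by rewrite distrC.
pose D : set R := `[- d, d]%classic.
have mD : measurable D by exact: measurable_itv.
pose r1 x := r x * \1_D x; pose r2 x := r x * (1 - \1_D x).
have mi : measurable_fun setT (\1_D : R -> R) by exact: measurable_indicR.
have in1 x : `|(\1_D x : R)| <= 1.
  by rewrite indicE; case: (_ \in _); rewrite ?normr1 ?normr0.
have ir1 : integ r1 by apply: (integMb (M := 1)).
have ir2 : integ r2.
  apply: (integMb (M := 2)) => //; first exact: measurable_funB.
  by move=> x; rewrite (le_trans (ler_normB _ _))// normr1 (_ : 2 = 1 + 1)// lerD2l.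
have DE x : (x \in D) = (`|x| <= d) by rewrite mem_setE in_itv/= ler_norml.
have -> : (fun n => rint (fun xi => abelw (n.+1%:R^-1) xi * rint (fun x => r x * cos (x * xi)))) =
   fun n => rint (fun x => r1 x * kern (ee n) x) + rint (fun x => r2 x * kern (ee n) x).
  apply/funext => n; rewrite abel_swap// -rintD.
  - by apply: eq_rint => x; rewrite /r1 /r2; ring.
  - exact: integ_kern.
  - exact: integ_kern.
have r10 : r1 0 = r 0 by rewrite /r1 indicE DE normr0 (ltW d0) mulr1.
rewrite -[X in _ --> X]addr0; apply: cvgD; last first.
  apply: (abel_far d0) => // x xd; by rewrite /r2 indicE DE xd subrr mulr0.
rewrite -r10; apply: (@abel_near (`|r 0| + 1)) => //.
  move=> x; rewrite /r1 indicE DE; case: (leP `|x| d) => xd.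
    by rewrite mulr1 rd.
  by rewrite mulr0 normr0 addr_ge0.
rewrite r10; apply: cvg_trans cr; apply: near_eq_cvg.
near=> x; rewrite /r1 indicE DE.
suff -> : `|x| <= d by rewrite mulr1.
near: x; apply/nbhs_ballP; exists d => //= x; rewrite /ball/= sub0r normrN; exact: ltW.
Unshelve. all: by end_near. Qed.

End Abel.

(** * The L^2 norm and the real inner product *)

Section L2.
Variable R : realType.
Local Notation mu := (@lebesgue_measure R).
Local Open Scope complex_scope.
Implicit Types (u v w : R -> R[i]).
Local Notation cmeas := (@cmeasurable R setT).

Definition L2f u : Prop := cmeas u /\ integ (fun x => cabs (u x) ^+ 2).
(** A real number even off L^2, where [fine] turns an infinite integral into 0; hence the [L2f]
    hypotheses in the estimates. *)
Definition nrm u : R := Num.sqrt (rint (fun x => cabs (u x) ^+ 2)).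
Definition ip u v : R := rint (fun x => dot (u x) (v x)).

Lemma measurable_cabs2 u : cmeas u -> measurable_fun setT (fun x => cabs (u x) ^+ 2).
Proof. by move=> mu_; apply: measurable_funX; exact: measurable_cabs. Qed.

Lemma L2f_dom u v : cmeas u -> L2f v -> (forall x, cabs (u x) <= cabs (v x)) -> L2f u.
Proof.
move=> cu [_ iv] uv; split => //; apply: integ_dom iv _; first exact: measurable_cabs2.
by move=> x; rewrite normrX ger0_norm ?cabs_ge0// lerXn2r ?nnegrE ?cabs_ge0.
Qed.

Lemma L2fD u v : L2f u -> L2f v -> L2f (fun x => u x + v x).
Proof.
move=> [cu iu] [cv iv]; split; first exact: cmeasD.
apply: (integ_dom _ (integZ 2 (integD iu iv))); first by apply: measurable_cabs2; exact: cmeasD.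
move=> x; rewrite ger0_norm ?sqr_ge0//.
have h : cabs (u x + v x) ^+ 2 <= (cabs (u x) + cabs (v x)) ^+ 2.
  by rewrite lerXn2r ?nnegrE ?addr_ge0 ?cabs_ge0// cabsD.
apply: (le_trans h); rewrite -subr_ge0.
rewrite (_ : _ - _ = (cabs (u x) - cabs (v x)) ^+ 2) ?sqr_ge0//; ring.
Qed.

Lemma L2fN u : L2f u -> L2f (fun x => - u x).
Proof.
move=> [cu iu]; split; first exact: cmeasN.
by apply: eq_integ iu => x; rewrite cabsN.
Qed.

Lemma L2fB u v : L2f u -> L2f v -> L2f (fun x => u x - v x).
Proof. by move=> iu iv; apply: L2fD => //; exact: L2fN. Qed.

Lemma L2f0 : L2f (fun=> 0).
Proof.
split; first exact: cmeas_cst.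
by apply: eq_integ (@integ0 R) => x; rewrite cabs0 expr0n.
Qed.

Lemma L2fMb u v (M : R) : L2f u -> cmeas v -> (forall x, cabs (v x) <= M) ->
  L2f (fun x => u x * v x).
Proof.
move=> [cu iu] cv vM; split; first exact: cmeasM.
apply: (integ_dom _ (integZ (M ^+ 2) iu)); first by apply: measurable_cabs2; exact: cmeasM.
move=> x; rewrite ger0_norm ?sqr_ge0// cabsM exprMn mulrC ler_wpM2r ?sqr_ge0//.
by rewrite lerXn2r ?nnegrE ?cabs_ge0// (le_trans (cabs_ge0 _) (vM x)).
Qed.

Lemma L2fZ u (c : R[i]) : L2f u -> L2f (fun x => c * u x).
Proof.
move=> iu; rewrite (_ : (fun x => _) = (fun x => u x * c)).
  exact: (@L2fMb u (cst c) (cabs c) iu (cmeas_cst c) (fun=> lexx _)).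
by apply/funext => x; rewrite mulrC.
Qed.

Lemma nrm_ge0 u : 0 <= nrm u. Proof. exact: sqrtr_ge0. Qed.

Lemma nrm2 u : nrm u ^+ 2 = rint (fun x => cabs (u x) ^+ 2).
Proof. by rewrite /nrm sqr_sqrtr//; apply: rint_ge0 => x; exact: sqr_ge0. Qed.

Lemma eq_nrm u v : (forall x, u x = v x) -> nrm u = nrm v.
Proof. by move=> /funext ->. Qed.

Lemma nrm_cst0 : nrm (fun=> 0) = 0.
Proof. by rewrite /nrm (@eq_rint R _ (fun=> 0)) ?rint0 ?sqrtr0// => x; rewrite cabs0 expr0n. Qed.

Lemma integ_cabsM u v : L2f u -> L2f v -> integ (fun x => cabs (u x) * cabs (v x)).
Proof.
move=> [cu iu] [cv iv]; apply: (integ_dom _ (integD iu iv)).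
  by apply: measurable_funM; exact: measurable_cabs.
move=> x; rewrite ger0_norm ?mulr_ge0 ?cabs_ge0//.
set a := cabs _; set b := cabs _.
have a0 : 0 <= a by exact: cabs_ge0. have b0 : 0 <= b by exact: cabs_ge0.
nra.
Qed.

Lemma integ_dot u v : L2f u -> L2f v -> integ (fun x => dot (u x) (v x)).
Proof.
move=> iu iv; apply: (integ_dom _ (integ_cabsM iu iv)).
  by apply: measurable_dot; [exact: iu.1|exact: iv.1].
by move=> x; exact: dot_le_cabs.
Qed.

(** Stated for the product of moduli rather than for [ip], since the pairing of amalgam spaces needs
    absolute integrals. The quadratic polynomial [q] in [s] is nonnegative. *)
Lemma cauchy_schwarz u v : L2f u -> L2f v ->
  rint (fun x => cabs (u x) * cabs (v x)) <= nrm u * nrm v.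
Proof.
move=> iu iv; set B := rint _.
have i1 := integ_cabsM iu iv.
have q s : 0 <= s ^+ 2 * nrm u ^+ 2 - 2 * s * B + nrm v ^+ 2.
  have -> : s ^+ 2 * nrm u ^+ 2 - 2 * s * B + nrm v ^+ 2 =
      rint (fun x => (s * cabs (u x) - cabs (v x)) ^+ 2).
    rewrite !nrm2 -rintZ; last exact: iu.2.
    rewrite -rintZ// -rintB; [|exact: integZ iu.2|exact: integZ].
    rewrite -rintD; [|by apply: integB; [exact: integZ iu.2|exact: integZ]|exact: iv.2].
    by apply: eq_rint => x; ring.
  by apply: rint_ge0 => x; exact: sqr_ge0.
have B0 : 0 <= B by apply: rint_ge0 => x; rewrite mulr_ge0 ?cabs_ge0.
have [u0|u0] := eqVneq (nrm u) 0.
  rewrite u0 mul0r leNgt; apply/negP => Bp.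
  (* With [nrm u = 0] the polynomial is affine, and at this point its value is -1. *)
  have := q ((nrm v ^+ 2 + 1) / (2 * B)); rewrite u0 expr0n/= mulr0 add0r.
  rewrite (_ : 2 * _ * B = nrm v ^+ 2 + 1); last by field; rewrite gt_eqF.
  lra.
have up : 0 < nrm u by rewrite lt_neqAle eq_sym u0 nrm_ge0.
(* The minimiser of the polynomial. *)
have := q (B / nrm u ^+ 2).
rewrite (_ : _ + _ = nrm v ^+ 2 - (B / nrm u) ^+ 2); last by field.
rewrite subr_ge0 ler_pXn2r ?nnegrE ?nrm_ge0 ?divr_ge0 ?nrm_ge0// ler_pdivrMr// mulrC; exact.
Qed.

Lemma normr_ip u v : L2f u -> L2f v -> `|ip u v| <= nrm u * nrm v.
Proof.
move=> iu iv; apply: le_trans (cauchy_schwarz iu iv).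
apply: normr_rint_le; [exact: integ_dot|exact: integ_cabsM|].
by move=> x; exact: dot_le_cabs.
Qed.

Lemma ipC u v : ip u v = ip v u.
Proof. by apply: eq_rint => x; exact: dotC. Qed.
Lemma ipDl u1 u2 v : L2f u1 -> L2f u2 -> L2f v ->
  ip (fun x => u1 x + u2 x) v = ip u1 v + ip u2 v.
Proof.
move=> i1 i2 iv; rewrite -rintD; [|exact: integ_dot|exact: integ_dot].
by apply: eq_rint => x; exact: dotDl.
Qed.
Lemma ipBl u1 u2 v : L2f u1 -> L2f u2 -> L2f v ->
  ip (fun x => u1 x - u2 x) v = ip u1 v - ip u2 v.
Proof.
move=> i1 i2 iv; rewrite -rintB; [|exact: integ_dot|exact: integ_dot].
by apply: eq_rint => x; exact: dotBl.
Qed.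
Lemma ipBr u1 u2 v : L2f u1 -> L2f u2 -> L2f v ->
  ip v (fun x => u1 x - u2 x) = ip v u1 - ip v u2.
Proof. by move=> i1 i2 iv; rewrite ipC ipBl// !(ipC v). Qed.

Lemma nrm2_ip u : nrm u ^+ 2 = ip u u.
Proof. by rewrite nrm2; apply: eq_rint => x; exact: cabs_sqr_dot. Qed.

Lemma nrm2B u v : L2f u -> L2f v ->
  nrm (fun x => u x - v x) ^+ 2 = nrm u ^+ 2 - 2 * ip u v + nrm v ^+ 2.
Proof.
move=> iu iv; rewrite !nrm2_ip ipBl//; last exact: L2fB.
by rewrite !ipBr// (ipC v u); ring.
Qed.

Lemma nrm_le u v : cmeas u -> L2f v -> (forall x, cabs (u x) <= cabs (v x)) -> nrm u <= nrm v.
Proof.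
move=> mu_ iv uv; have iu := L2f_dom mu_ iv uv.
apply: ler_wsqrtr; apply: le_rint; [exact: iu.2|exact: iv.2|].
by move=> x; rewrite lerXn2r ?nnegrE ?cabs_ge0.
Qed.

Lemma nrmD u v : L2f u -> L2f v -> nrm (fun x => u x + v x) <= nrm u + nrm v.
Proof.
move=> iu iv.
have key : nrm (fun x => u x + v x) ^+ 2 <= (nrm u + nrm v) ^+ 2.
  rewrite (_ : nrm (fun x => u x + v x) ^+ 2 = nrm u ^+ 2 + 2 * ip u v + nrm v ^+ 2).
    have := le_trans (ler_norm _) (normr_ip iu iv).
    by set a := nrm u; set b := nrm v => h; nra.
  rewrite !nrm2_ip ipDl//; last exact: L2fD.
  by rewrite !(ipC _ (fun x => u x + v x)) !ipDl// (ipC v u); ring.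
by move: key; rewrite ler_pXn2r ?nnegrE ?addr_ge0 ?nrm_ge0.
Qed.

Lemma nrmN u : nrm (fun x => - u x) = nrm u.
Proof. by rewrite /nrm; congr Num.sqrt; apply: eq_rint => x; rewrite cabsN. Qed.

Lemma nrmBC u v : nrm (fun x => u x - v x) = nrm (fun x => v x - u x).
Proof. by rewrite /nrm; congr Num.sqrt; apply: eq_rint => x; rewrite cabsB. Qed.

Lemma nrmB u v : L2f u -> L2f v -> nrm (fun x => u x - v x) <= nrm u + nrm v.
Proof. by move=> iu iv; rewrite -(nrmN v); apply: nrmD => //; exact: L2fN. Qed.

Lemma nrm_tri u v w : L2f u -> L2f v -> L2f w ->
  nrm (fun x => u x - w x) <= nrm (fun x => u x - v x) + nrm (fun x => v x - w x).
Proof.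
move=> iu iv iw; rewrite (@eq_nrm _ (fun x => (u x - v x) + (v x - w x))).
  by apply: nrmD; exact: L2fB.
by move=> x; rewrite addrA subrK.
Qed.

Lemma nrmZ u (c : R[i]) : L2f u -> nrm (fun x => c * u x) = cabs c * nrm u.
Proof.
move=> iu; rewrite /nrm (@eq_rint R _ (fun x => cabs c ^+ 2 * cabs (u x) ^+ 2)); last first.
  by move=> x; rewrite cabsM exprMn.
rewrite rintZ; last exact: iu.2.
by rewrite sqrtrM ?sqr_ge0// sqrtr_sqr ger0_norm ?cabs_ge0.
Qed.

Lemma ae_eq_rint (h k : R -> R) : measurable_fun setT h -> measurable_fun setT k ->
  {ae mu, forall x, h x = k x} -> rint h = rint k.
Proof.
move=> mh mk hk; rewrite /rint /Rintegral; congr fine.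
apply: ae_eq_integral => //; [exact: meas_EFin|exact: meas_EFin|].
by apply: ae_imp hk => x /= -> _.
Qed.

Lemma ae_eq_integ (h k : R -> R) : measurable_fun setT k ->
  {ae mu, forall x, h x = k x} -> integ h -> integ k.
Proof.
move=> mk hk ih; have mh := integ_meas ih.
apply/integrableP; split; first exact: meas_EFin.
have := integ_lty ih; rewrite (@ae_eq_integral _ _ _ mu setT (fun x => `|h x|%:E) (fun x => `|k x|%:E))//.
- by apply: meas_EFin; exact: measurableT_comp.
- by apply: meas_EFin; exact: measurableT_comp.
- by apply: ae_imp hk => x /= -> _.
Qed.

Lemma ae_eq_L2f u v : cmeas v -> {ae mu, forall x, u x = v x} -> L2f u -> L2f v.
Proof.
move=> cv uv [cu iu]; split => //; apply: ae_eq_integ iu; first exact: measurable_cabs2.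
by apply: ae_imp uv => x ->.
Qed.

Lemma ae_eq_nrm u v : cmeas u -> cmeas v -> {ae mu, forall x, u x = v x} -> nrm u = nrm v.
Proof.
move=> cu cv uv; rewrite /nrm; congr Num.sqrt; apply: ae_eq_rint.
- exact: measurable_cabs2.
- exact: measurable_cabs2.
- by apply: ae_imp uv => x ->.
Qed.

Lemma nrm0_ae u : L2f u -> nrm u = 0 -> {ae mu, forall x, u x = 0}.
Proof.
move=> [cu iu] u0.
have : (\int[mu]_x `|(cabs (u x) ^+ 2)%:E| = 0)%E.
  transitivity (\int[mu]_x (cabs (u x) ^+ 2)%:E)%E.
    by apply: eq_integral => x _; rewrite gee0_abs// lee_fin sqr_ge0.
  by rewrite -(rintE iu) -nrm2 u0 expr0n.
move/(ae_eq_integral_abs mu measurableT (meas_EFin (measurable_cabs2 cu))).1.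
apply: ae_imp => x /(_ I) /= [/eqP]; rewrite sqrf_eq0 => /eqP; exact: cabs0_eq0.
Qed.

Lemma L2_dct (U : nat -> R -> R[i]) u w : (forall n, cmeas (U n)) -> cmeas u -> L2f w ->
  (forall n x, cabs (U n x - u x) <= cabs (w x)) ->
  {ae mu, forall x, cabs (U n x - u x) @[n --> \oo] --> (0 : R)} ->
  nrm (fun x => U n x - u x) @[n --> \oo] --> (0 : R).
Proof.
move=> mU mu_ [cw iw] Uw U0.
have h : rint (fun x => cabs (U n x - u x) ^+ 2) @[n --> \oo] --> (0 : R).
  apply: (@rint_dct0 R _ (fun x => cabs (w x) ^+ 2)) => //.
  - by move=> n; apply: measurable_cabs2; exact: cmeasB.
  - by move=> n x; rewrite ger0_norm ?sqr_ge0// lerXn2r ?nnegrE ?cabs_ge0.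
  - apply: ae_imp U0 => x Ux; rewrite -(mulr0 0); under eq_fun do rewrite expr2.
    exact: cvgM.
have := cvg_comp _ _ h (@sqrt_continuous R 0).
by rewrite sqrtr0; apply.
Qed.

End L2.

(** * Monotone convergence and completeness of L^2 *)

Section Completeness.
Variable R : realType.
Local Notation mu := (@lebesgue_measure R).
Local Open Scope complex_scope.
Local Notation cmeas := (@cmeasurable R setT).

Lemma eq_cvgn_to (T : topologicalType) (f g : nat -> T) (l : T) :
  (forall n, f n = g n) -> f n @[n --> \oo] --> l -> g n @[n --> \oo] --> l.
Proof. by move=> /funext ->. Qed.

Lemma cvgn_dist0 (s : nat -> R) (l : R) : s n @[n --> \oo] --> l ->
  `|s n - l| @[n --> \oo] --> (0 : R).
Proof.
move=> sl; have : `|s n - l| @[n --> \oo] --> `|l - l|.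
  by apply: cvg_norm; apply: cvgB => //; exact: cvg_cst.
by rewrite subrr normr0.
Qed.

Lemma cvgn_cabs0 (s : nat -> R[i]) (l : R[i]) :
  complex.Re (s n) @[n --> \oo] --> complex.Re l ->
  complex.Im (s n) @[n --> \oo] --> complex.Im l ->
  cabs (s n - l) @[n --> \oo] --> (0 : R).
Proof.
move=> /cvgn_dist0 a /cvgn_dist0 b.
have ab : `|complex.Re (s n) - complex.Re l| + `|complex.Im (s n) - complex.Im l|
    @[n --> \oo] --> (0 + 0 : R) by exact: (cvgD a b).
rewrite addr0 in ab.
apply: squeeze_cvgr (cvg_cst (0 : R)) ab.
apply: nearW => n; rewrite cabs_ge0/= (le_trans (cabs_le_ReIm _))// !cE.
exact: lexx.
Qed.

(** Beppo Levi: bounded integrals force the extended-real limit to be finite almost everywhere. Its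
    [fine] part is the real limit function, so the convergence holds only almost everywhere. *)
Lemma rint_mct (H : nat -> R -> R) (B : R) :
  (forall n, integ (H n)) -> (forall n x, 0 <= H n x) ->
  (forall n x, H n x <= H n.+1 x) -> (forall n, rint (H n) <= B) ->
  exists h, [/\ integ h, forall x, 0 <= h x, rint h <= B &
    {ae mu, forall x, H n x @[n --> \oo] --> h x}].
Proof.
move=> iH H0 Hnd HB.
pose e x := limn (fun n => (H n x)%:E).
have nd x : nondecreasing_seq (fun n => (H n x)%:E).
  by apply/nondecreasing_seqP => n; rewrite lee_fin.
have cv x : cvgn (fun n => (H n x)%:E) by exact: ereal_nondecreasing_is_cvgn.
have e0 x : (0 <= e x)%E.
  by apply: lime_ge => //; apply: nearW => n; rewrite lee_fin.
have mH n : measurable_fun setT (EFin \o H n) := meas_EFin (integ_meas (iH n)).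
have me : @measurable_fun _ _ (measurableTypeR R) (\bar R) setT e.
  by apply: (@emeasurable_fun_cvg _ _ _ _ (fun n => EFin \o H n)) => // x _; exact: cv.
have g0 n x : setT x -> (0 <= (EFin \o H n) x)%E by rewrite /= lee_fin.
have eB : (\int[mu]_x e x <= B%:E)%E.
  have -> := @monotone_convergence _ _ _ mu setT measurableT (fun n => EFin \o H n)
    mH g0 (fun x _ => nd x).
  apply: lime_le; last by apply: nearW => n; rewrite -rintE// lee_fin.
  apply: ereal_nondecreasing_is_cvgn; apply/nondecreasing_seqP => n.
  apply: ge0_le_integral; [by []| |exact: mH|exact: mH|].
  - by move=> x _; rewrite lee_fin.
  - by move=> x _; rewrite lee_fin.
have ie : mu.-integrable setT e.
  apply/integrableP; split => //.
  rewrite (_ : (\int[mu]_x _)%E = (\int[mu]_x e x)%E); last first.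
    by apply: eq_integral => x _; rewrite gee0_abs.
  by rewrite (le_lt_trans eB)// ltry.
have [ih rh] := fine_integ ie.
exists (fun x => fine (e x)); split => //.
- by move=> x; exact: fine_ge0.
- rewrite rh -lee_fin fineK//; exact: integrable_fin_num.
- have aefin := integrable_ae measurableT ie; apply: ae_imp aefin => x fe.
  have cx' : (H n x)%:E @[n --> \oo] --> (fine (e x))%:E.
    by rewrite fineK; [exact: cv|exact: fe].
  exact: (fine_cvg cx').
Qed.

Lemma rint_mct_eq (H : nat -> R -> R) (h : R -> R) (L : R) :
  (forall n, integ (H n)) -> (forall n x, 0 <= H n x) -> measurable_fun setT h ->
  (forall n x, H n x <= H n.+1 x) -> rint (H n) @[n --> \oo] --> L ->
  (forall x, H n x @[n --> \oo] --> h x) -> integ h /\ rint h = L.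
Proof.
move=> iH H0 mh Hnd HL Hh.
have ndr : nondecreasing_seq (fun n => rint (H n)).
  by apply/nondecreasing_seqP => n; exact: le_rint.
have HB n : rint (H n) <= L.
  rewrite -(cvg_lim _ HL)//; apply: nondecreasing_cvgn_le => //; exact: cvgP HL.
have [h' [ih' h'0 h'L h'ae]] := rint_mct iH H0 Hnd HB.
have ae : {ae mu, forall x, h' x = h x}.
  apply: ae_imp h'ae => x hx; exact: (cvg_unique _ hx (Hh x)).
have ih : integ h by exact: ae_eq_integ ih'.
split => //.
have bnd n x : `|H n x| <= h x.
  rewrite ger0_norm// -(cvg_lim _ (Hh x))//; apply: nondecreasing_cvgn_le; last exact: cvgP (Hh x).
  by apply/nondecreasing_seqP => k.
(* The limit now dominates the sequence, so dominated convergence identifies its integral. *)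
have [_ cv] := @rint_dct R H h h (fun n => integ_meas (iH n)) mh ih bnd (ae_all Hh).
exact: (cvg_unique _ cv HL).
Qed.

(** Minkowski's inequality by induction; the right-hand side is the closed form of the geometric
    sum. *)
Lemma nrm_sum_geo (d : nat -> R -> R[i]) : (forall k, L2f (d k)) ->
  (forall k, nrm (d k) <= 2^-1 ^+ k) ->
  forall n, L2f (fun x => (\sum_(k < n) cabs (d k x))%:C) /\
    nrm (fun x => (\sum_(k < n) cabs (d k x))%:C) <= 2 - 2 * 2^-1 ^+ n.
Proof.
move=> id dk; elim=> [|n [IH1 IH2]].
  have -> : (fun x => (\sum_(k < 0) cabs (d k x))%:C) = (fun=> 0).
    by apply/funext => x; rewrite big_ord0.
  split; first exact: L2f0.
  by rewrite expr0 mulr1 subrr nrm_cst0.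
have idn : L2f (fun x => (cabs (d n x))%:C).
  apply: L2f_dom (id n) _; first by apply: cmeas_real; apply: measurable_cabs; exact: (id n).1.
  by move=> x; rewrite cabsC ger0_norm ?cabs_ge0.
have -> : (fun x => (\sum_(k < n.+1) cabs (d k x))%:C) =
    (fun x => (\sum_(k < n) cabs (d k x))%:C + (cabs (d n x))%:C).
  by apply/funext => x; rewrite big_ord_recr/= rmorphD.
split; first exact: L2fD.
apply: (le_trans (nrmD IH1 idn)).
have : nrm (fun x => (cabs (d n x))%:C) <= 2^-1 ^+ n.
  apply: le_trans (dk n); rewrite /nrm; apply: ler_wsqrtr.
  by rewrite (@eq_rint R _ (fun x => cabs (d n x) ^+ 2))// => x; rewrite cabsC ger0_norm ?cabs_ge0.
move: IH2; rewrite exprSr; set a := nrm _; set b := nrm _; set c := 2^-1 ^+ n.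
lra.
Qed.

(** The increments of [v] are dominated by those of a convergent sequence, so each coordinate is an
    absolutely convergent telescoping series. *)
Lemma cvg_Re_Im (v : nat -> R[i]) (S : nat -> R) (s : R) :
  (forall n, cabs (v n.+1 - v n) <= S n.+1 - S n) -> S n @[n --> \oo] --> s ->
  cvgn (fun n => complex.Re (v n)) /\ cvgn (fun n => complex.Im (v n)).
Proof.
move=> vS Ss.
have cS : cvgn (series (telescope S)).
  by rewrite telescopeK; apply: cvgP; apply: cvgB; [exact: Ss|exact: cvg_cst].
have key (P : R[i] -> R) : (forall z w, P (z - w) = P z - P w) ->
    (forall z, `|P z| <= cabs z) -> cvgn (fun n => P (v n)).
  move=> PB Pc.
  have : cvgn (series (telescope (P \o v))).
    apply: normed_cvg.
    have h1 n : 0 <= `|telescope (P \o v) n| by [].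
    have h2 n : 0 <= telescope S n by apply: (le_trans _ (vS n)); exact: cabs_ge0.
    have h3 n : `|telescope (P \o v) n| <= telescope S n.
      by rewrite /telescope/= -PB; exact: (le_trans (Pc _) (vS n)).
    exact: (series_le_cvg h1 h2 h3 cS).
  rewrite telescopeK => /cvg_ex[l cl]; apply/cvg_ex; exists (l + P (v 0%N)).
  apply: eq_cvgn_to (cvgD cl (cvg_cst (P (v 0%N)))) => n /=.
  by rewrite subrK.
split; apply: key.
- by move=> z w; rewrite !cE.
- exact: Re_le_cabs.
- by move=> z w; rewrite !cE.
- exact: Im_le_cabs.
Qed.

Theorem riesz_fischer (U : nat -> R -> R[i]) : (forall n, L2f (U n)) ->
  (forall e, 0 < e -> exists N, forall m n, (N <= m)%N -> (N <= n)%N ->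
     nrm (fun x => U m x - U n x) <= e) ->
  exists u, L2f u /\ nrm (fun x => U n x - u x) @[n --> \oo] --> (0 : R).
Proof.
move=> iU cauchy.
have /choice[N NP] (k : nat) : exists N, forall m n, (N <= m)%N -> (N <= n)%N ->
     nrm (fun x => U m x - U n x) <= 2^-1 ^+ k.
  by apply: cauchy; rewrite exprn_gt0// invr_gt0.
(* Partial sums of the [(N j).+1] exceed every [N k], are nondecreasing and tend to infinity: a
   subsequence of indices without recursive choices. *)
pose ph k := (\sum_(j < k.+1) (N j).+1)%N.
have phN k : (N k <= ph k)%N by rewrite /ph big_ord_recr/= addnS ltnW// ltnS leq_addl.
have phS k : (ph k <= ph k.+1)%N by rewrite [X in (_ <= X)%N]/ph big_ord_recr/= leq_addr.
pose d k x := U (ph k.+1) x - U (ph k) x.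
have id k : L2f (d k) by exact: L2fB.
have dk k : nrm (d k) <= 2^-1 ^+ k.
  by apply: NP => //; exact: leq_trans (phS k).
have iS := nrm_sum_geo id dk.
pose S n x : R := \sum_(k < n) cabs (d k x).
have S0 n x : 0 <= S n x by rewrite sumr_ge0// => k _; exact: cabs_ge0.
have iH n : integ (fun x => S n x ^+ 2).
  by apply: eq_integ (iS n).1.2 => x; rewrite cabsC ger0_norm ?S0.
have HB n : rint (fun x => S n x ^+ 2) <= 4.
  have -> : rint (fun x => S n x ^+ 2) = nrm (fun x => (S n x)%:C) ^+ 2.
    by rewrite nrm2; apply: eq_rint => x; rewrite cabsC ger0_norm ?S0.
  rewrite (_ : 4 = 2 ^+ 2); last by rewrite -natrX.
  rewrite lerXn2r ?nnegrE ?nrm_ge0//; apply: (le_trans (iS n).2).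
  by rewrite gerBl mulr_ge0// exprn_ge0// invr_ge0.
have Snd n x : S n x <= S n.+1 x.
  by rewrite /S big_ord_recr/= lerDl cabs_ge0.
have Hnd n x : S n x ^+ 2 <= S n.+1 x ^+ 2 by rewrite lerXn2r ?nnegrE.
have [h [ih h0 _ hae]] := rint_mct iH (fun n x => sqr_ge0 _) Hnd HB.
have [Z [mZ Z0 subZ]] := hae.
have good x : ~ Z x -> (fun n => S n x ^+ 2) @ \oo --> h x.
  by move=> nZ; apply: contrapT => nc; apply: nZ; exact: subZ.
(* Setting the subsequence to 0 on the exceptional null set makes it converge everywhere, so that
   its limit is measurable. *)
pose v n x : R[i] := U (ph n) x * (\1_(~` Z) x)%:C.
have mi : measurable_fun setT (\1_(~` Z) : R -> R).
  by apply: measurable_indicR; exact: measurableC.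
have mv n : cmeas (v n) by apply: cmeasM; [exact: (iU _).1|exact: cmeas_real].
have iE x : Z x -> \1_(~` Z) x = 0 :> R.
  by move=> Zx; rewrite indicE memNset//= => /(_ Zx).
have iE' x : ~ Z x -> \1_(~` Z) x = 1 :> R by move=> Zx; rewrite indicE mem_set.
have vcv x : cvgn (fun n => complex.Re (v n x)) /\ cvgn (fun n => complex.Im (v n x)).
  have [Zx|Zx] := pselect (Z x).
    have v0 n : v n x = 0 by rewrite /v iE// mulr0.
    by split; apply/cvg_ex; exists 0; under eq_fun do rewrite v0; exact: cvg_cst.
  have Sc : S n x @[n --> \oo] --> Num.sqrt (h x).
    apply: eq_cvgn_to (cvg_comp _ _ (good x Zx) (@sqrt_continuous R (h x))) => n /=.
    by rewrite sqrtr_sqr ger0_norm.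
  apply: cvg_Re_Im Sc => n.
  by rewrite /S big_ord_recr/= addrAC subrr add0r /v iE'// !mulr1.
pose u x : R[i] := limn (fun n => complex.Re (v n x)) +i* limn (fun n => complex.Im (v n x)).
have uRe x : complex.Re (v n x) @[n --> \oo] --> complex.Re (u x) by exact: (vcv x).1.
have uIm x : complex.Im (v n x) @[n --> \oo] --> complex.Im (u x) by exact: (vcv x).2.
have mu_ : cmeas u.
  split.
    exact: (@measurable_fun_cvg _ _ _ _ (fun n x => complex.Re (v n x)) _ (fun n => (mv n).1)).
  exact: (@measurable_fun_cvg _ _ _ _ (fun n x => complex.Im (v n x)) _ (fun n => (mv n).2)).
have vu x : cabs (v n x - u x) @[n --> \oo] --> (0 : R) by exact: cvgn_cabs0.
(* The majorant of |v_n - u|, as |v_n - v_0| and |v_0 - u| are both at most the square root of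
   [h]. *)
pose w x : R[i] := (2 * Num.sqrt (h x))%:C.
have mw : cmeas w.
  apply: cmeas_real; apply: measurable_funM => //.
  apply: (measurableT_comp _ (integ_meas ih)).
  by apply: continuous_measurable_fun; exact: sqrt_continuous.
have w2 x : cabs (w x) = 2 * Num.sqrt (h x).
  by rewrite cabsC ger0_norm// mulr_ge0// sqrtr_ge0.
have iw : L2f w.
  split => //; apply: eq_integ (integZ 4 ih) => x.
  by rewrite w2 exprMn sqr_sqrtr// -natrX.
have Sh n x : ~ Z x -> S n x <= Num.sqrt (h x).
  move=> Zx; rewrite -[leLHS](ger0_norm (S0 _ _)) -sqrtr_sqr ler_wsqrtr//.
  have gx := good x Zx; rewrite -(cvg_lim _ gx)//.
  apply: (@nondecreasing_cvgn_le _ (fun n => S n x ^+ 2)); last exact: cvgP gx.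
  by apply/nondecreasing_seqP => k.
have v0 n x : cabs (v n x - v 0%N x) <= Num.sqrt (h x).
  have [Zx|Zx] := pselect (Z x).
    by rewrite /v iE// !mulr0 subrr cabs0 sqrtr_ge0.
  apply: le_trans (Sh n x Zx); rewrite /v iE'// !mulr1.
  elim: n => [|n IH]; first by rewrite subrr cabs0 S0.
  rewrite /S big_ord_recr/= -/(S n x).
  have -> : U (ph n.+1) x - U (ph 0%N) x = (U (ph n) x - U (ph 0%N) x) + d n x.
    by rewrite /d; ring.
  by apply: (le_trans (cabsD _ _)); exact: lerD.
have u0 x : cabs (u x - v 0%N x) <= Num.sqrt (h x).
  rewrite -[leRHS]addr0; have : Num.sqrt (h x) + cabs (v n x - u x) @[n --> \oo] --> Num.sqrt (h x) + 0.
    by apply: cvgD; [exact: cvg_cst|exact: vu].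
  move=> cv; rewrite -(cvg_lim _ cv)//; apply: limr_ge; first exact: cvgP cv.
  apply: nearW => n.
  have -> : u x - v 0%N x = (v n x - v 0%N x) + (u x - v n x).
    by ring.
  by apply: (le_trans (cabsD _ _)); apply: lerD => //; rewrite cabsB.
have iv n : L2f (v n).
  apply: L2f_dom (iU (ph n)) _ => // x; rewrite /v cabsM cabsC indicE.
  by case: (_ \in _); rewrite ?normr1 ?normr0 ?mulr1 ?mulr0 ?cabs_ge0.
have iu : L2f u.
  have : L2f (fun x => (u x - v 0%N x) + v 0%N x).
    apply: L2fD => //; apply: L2f_dom iw _; first exact: cmeasB.
    by move=> x; rewrite w2 (le_trans (u0 x))// ler_peMl ?sqrtr_ge0// ler1n.
  by congr L2f; apply/funext => x; rewrite subrK.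
exists u; split => //.
have cvu : nrm (fun x => v n x - u x) @[n --> \oo] --> (0 : R).
  apply: (L2_dct (w := w)) => //; last by apply: ae_all => x; exact: vu.
  move=> n x; have -> : v n x - u x = (v n x - v 0%N x) + (v 0%N x - u x).
    by ring.
  rewrite w2 mulr_natl mulr2n.
  by apply: (le_trans (cabsD _ _)); apply: lerD => //; rewrite cabsB.
have vU n : nrm (fun x => v n x - u x) = nrm (fun x => U (ph n) x - u x).
  apply: ae_eq_nrm; [exact: cmeasB|apply: cmeasB => //; exact: (iU _).1|].
  have : {ae mu, forall x, ~ Z x} by exists Z; split => // x /= /contrapT.
  by apply: ae_imp => x Zx; rewrite /v iE'// mulr1.
(* A Cauchy sequence with a convergent subsequence converges. *)
apply/cvgr0Pnorm_le => e e0.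
have [M MP] := cauchy _ (divr_gt0 e0 (ltr0n R 2)).
have : \forall k \near \oo, `|nrm (fun x => v k x - u x)| <= e / 2.
  by move/cvgr0Pnorm_le : cvu; apply; rewrite divr_gt0.
have : \forall k \near \oo, (M <= ph k)%N.
  exists M => // k /= Mk; apply: (leq_trans Mk).
  have : (\sum_(j < k.+1) 1 <= ph k)%N by apply: leq_sum.
  by rewrite sum1_card card_ord; exact: ltnW.
move=> h1 h2; have [k [k1 k2]] := filter_ex (filterI h1 h2).
near=> n; rewrite ger0_norm ?nrm_ge0//.
apply: (le_trans (nrm_tri (iU n) (iU (ph k)) iu)).
rewrite [leRHS]splitr lerD//.
  by apply: MP => //; near: n; exists M.
by rewrite -vU (le_trans (ler_norm _)).
Unshelve. all: by end_near. Qed.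

End Completeness.

(** * The Fourier transform of integrable functions *)

Section Fourier.
Variable R : realType.
Local Notation mu := (@lebesgue_measure R).
Local Open Scope complex_scope.
Local Notation cmeas := (@cmeasurable R setT).
Implicit Types (u v w : R -> R[i]).

Definition L1f u : Prop := cmeas u /\ integ (fun x => cabs (u x)).

Lemma L1P u : L1 setT u <-> L1f u.
Proof.
split=> [[iR iI]|[cu iu]].
  have cu : cmeas u by split; [exact: integ_meas iR|exact: integ_meas iI].
  split => //.
  apply: (integ_dom _ (integD (integ_norm iR) (integ_norm iI))); first exact: measurable_cabs.
  by move=> x; rewrite ger0_norm ?cabs_ge0// cabs_le_ReIm.
split; apply: integ_dom iu _; [exact: cu.1| |exact: cu.2|].
- by move=> x; exact: Re_le_cabs.
- by move=> x; exact: Im_le_cabs.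
Qed.

Lemma L1f_Re u : L1f u -> integ (fun x => complex.Re (u x)).
Proof. by move=> /L1P[]. Qed.
Lemma L1f_Im u : L1f u -> integ (fun x => complex.Im (u x)).
Proof. by move=> /L1P[]. Qed.

Lemma L1fMb u v (M : R) : L1f u -> cmeas v -> (forall x, cabs (v x) <= M) ->
  L1f (fun x => u x * v x).
Proof.
move=> [cu iu] cv vM; split; first exact: cmeasM.
apply: (integ_dom _ (integZ M iu)); first by apply: measurable_cabs; exact: cmeasM.
by move=> x; rewrite ger0_norm ?cabs_ge0// cabsM mulrC ler_wpM2r ?cabs_ge0.
Qed.

Lemma L1fD u v : L1f u -> L1f v -> L1f (fun x => u x + v x).
Proof.
move=> [cu iu] [cv iv]; split; first exact: cmeasD.
apply: (integ_dom _ (integD iu iv)); first by apply: measurable_cabs; exact: cmeasD.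
by move=> x; rewrite ger0_norm ?cabs_ge0// cabsD.
Qed.

Lemma L1fN u : L1f u -> L1f (fun x => - u x).
Proof.
by move=> [cu iu]; split; [exact: cmeasN|apply: eq_integ iu => x; rewrite cabsN].
Qed.

Lemma L1fB u v : L1f u -> L1f v -> L1f (fun x => u x - v x).
Proof. by move=> iu iv; apply: L1fD => //; exact: L1fN. Qed.

Lemma L1fZ u (c : R[i]) : L1f u -> L1f (fun x => c * u x).
Proof.
move=> iu; rewrite (_ : (fun x => _) = (fun x => u x * c)).
  exact: (@L1fMb u (cst c) (cabs c) iu (cmeas_cst c) (fun=> lexx _)).
by apply/funext => x; rewrite mulrC.
Qed.

Lemma L1f_dot u w (M : R) : L1f u -> cmeas w -> (forall x, cabs (w x) <= M) ->
  integ (fun x => dot (u x) (w x)).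
Proof.
move=> [cu iu] cw wM; apply: (integ_dom _ (integZ M iu)); first exact: measurable_dot.
by move=> x; rewrite (le_trans (dot_le_cabs _ _))// mulrC ler_wpM2r ?cabs_ge0.
Qed.

Definition cc : R := (Num.sqrt (2 * pi))^-1.

Lemma cc_gt0 : 0 < cc.
Proof. by rewrite invr_gt0 sqrtr_gt0 mulr_gt0// pi_gt0. Qed.
Lemma cc_sqr : cc ^+ 2 = (2 * pi)^-1.
Proof. by rewrite exprVn sqr_sqrtr// mulr_ge0// pi_ge0. Qed.
Lemma measurable_expiM xi : cmeas (fun x => expi (x * xi)).
Proof. by apply: measurable_expi; exact: measurable_funM. Qed.
Lemma measurable_expiNM xi : cmeas (fun x => expi (- (x * xi))).
Proof. by apply: measurable_expi; apply: measurable_oppR2; exact: measurable_funM. Qed.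

(** Transposing the exponential turns a coordinate of the complex integral into one real integral.
    The properties of the transform are read off from this form by varying the test vector [z]. *)
Lemma dot_fourier u xi (z : R[i]) : L1f u ->
  dot (fourier u xi) z = cc * rint (fun x => dot (u x) (z * expi (x * xi))).
Proof.
move=> iu.
have ie : L1f (fun x => u x * expi (- (x * xi))).
  by apply: (L1fMb (M := 1)) => //; [exact: measurable_expiNM|move=> x; rewrite cabs_expi].
have -> : rint (fun x => dot (u x) (z * expi (x * xi))) =
  rint (fun x => complex.Re z * complex.Re (u x * expi (- (x * xi))) +
     complex.Im z * complex.Im (u x * expi (- (x * xi)))).
  by apply: eq_rint => x; rewrite /dot !cE /= cosN sinN; ring.
rewrite rintD; [|by apply: integZ; exact: L1f_Re|by apply: integZ; exact: L1f_Im].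
rewrite !rintZ; [|exact: L1f_Im|exact: L1f_Re].
set I1 := rint (fun x => complex.Re _); set I2 := rint (fun x => complex.Im _).
rewrite (_ : fourier u xi = cc%:C * (I1 +i* I2))//.
by move: I1 I2 => a b; rewrite /dot !cE /=; ring.
Qed.

(** The value of the transform is tested against itself, which replaces choosing a phase. *)
Lemma fourier_bound u xi : L1f u -> cabs (fourier u xi) <= cc * rint (fun x => cabs (u x)).
Proof.
move=> iu; set z := fourier u xi.
have [z0|z0] := eqVneq (cabs z) 0.
  by rewrite z0 mulr_ge0 ?(ltW cc_gt0)// rint_ge0// => x; exact: cabs_ge0.
have zp : 0 < cabs z by rewrite lt_neqAle eq_sym z0 cabs_ge0.
rewrite -(ler_pM2r zp) -expr2 cabs_sqr_dot dot_fourier// -mulrA ler_pM2l ?cc_gt0//.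
rewrite mulrC -rintZ; last exact: iu.2.
apply: le_trans (ler_norm _) _; apply: normr_rint_le.
- apply: (L1f_dot (M := cabs z)) => //.
    by apply: cmeasM; [exact: cmeas_cst|exact: measurable_expiM].
  by move=> x; rewrite cabsM cabs_expi mulr1.
- by apply: integZ; exact: iu.2.
- by move=> x; rewrite (le_trans (dot_le_cabs _ _))// cabsM cabs_expi mulr1 mulrC.
Qed.

Lemma fourierD u v xi : L1f u -> L1f v ->
  fourier (fun x => u x + v x) xi = fourier u xi + fourier v xi.
Proof.
move=> iu iv; have iuv := L1fD iu iv.
have key z : dot (fourier (fun x => u x + v x) xi) z = dot (fourier u xi + fourier v xi) z.
  rewrite dotDl !dot_fourier// -mulrDr -rintD.
  - by congr (_ * _); apply: eq_rint => x; rewrite dotDl.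
  - apply: (L1f_dot (M := cabs z)) => //.
      by apply: cmeasM; [exact: cmeas_cst|exact: measurable_expiM].
    by move=> x; rewrite cabsM cabs_expi mulr1.
  - apply: (L1f_dot (M := cabs z)) => //.
      by apply: cmeasM; [exact: cmeas_cst|exact: measurable_expiM].
    by move=> x; rewrite cabsM cabs_expi mulr1.
exact: dot_ext.
Qed.

Lemma fourierZ u xi (c : R[i]) : L1f u -> fourier (fun x => c * u x) xi = c * fourier u xi.
Proof.
move=> iu; have icu := L1fZ c iu; apply: dot_ext => z.
rewrite dot_mull !dot_fourier//; congr (_ * _); apply: eq_rint => x.
by rewrite dot_mull mulrA.
Qed.

Lemma fourierN u xi : L1f u -> fourier (fun x => - u x) xi = - fourier u xi.
Proof.
move=> iu; have -> : (fun x => - u x) = (fun x => (-1) * u x).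
  by apply/funext => x; rewrite mulN1r.
by rewrite fourierZ// mulN1r.
Qed.

Lemma fourierB u v xi : L1f u -> L1f v ->
  fourier (fun x => u x - v x) xi = fourier u xi - fourier v xi.
Proof.
by move=> iu iv; rewrite fourierD//; [rewrite fourierN|exact: L1fN].
Qed.

(** Dominated convergence is available along sequences, and sequential continuity suffices on the
    line. *)
Lemma rint_continuous (K : R -> R -> R) (k : R -> R) :
  (forall xi, measurable_fun setT (fun x => K x xi)) -> integ k ->
  (forall x xi, `|K x xi| <= k x) -> (forall x, continuous (K x)) ->
  continuous (fun xi => rint (fun x => K x xi)).
Proof.
move=> mK ik Kk cK xi; apply/(@cvg_nbhsP _ R^o) => s sxi.
apply: (proj2 (@rint_dct R (fun n x => K x (s n)) (fun x => K x xi) k _ _ _ _ _)) => //.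
apply: ae_all => x.
exact: (cvg_comp _ _ sxi (cK x xi)).
Qed.

Lemma continuous_mulcos (a b x : R) : continuous (fun xi => a * cos (x * xi) + b * sin (x * xi)).
Proof.
move=> xi.
have cx : x * y @[y --> xi] --> x * xi by apply: cvgM; [exact: cvg_cst|exact: cvg_id].
apply: cvgD; apply: cvgM; try exact: cvg_cst.
  exact: (cvg_comp _ _ cx (@continuous_cos R _)).
exact: (cvg_comp _ _ cx (@continuous_sin R _)).
Qed.

Lemma continuous_dot_fourier u (z : R[i]) : L1f u -> continuous (fun xi => dot (fourier u xi) z).
Proof.
move=> iu.
rewrite (_ : (fun xi => _) = (fun xi => cc * rint (fun x => dot (u x) (z * expi (x * xi))))); last first.
  by apply/funext => xi; exact: dot_fourier.
move=> xi; apply: cvgM; first exact: cvg_cst.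
apply: (@rint_continuous (fun x xi => dot (u x) (z * expi (x * xi))) (fun x => cabs z * cabs (u x))).
- move=> y; apply: measurable_dot; first exact: iu.1.
  by apply: cmeasM; [exact: cmeas_cst|exact: measurable_expiM].
- by apply: integZ; exact: iu.2.
- by move=> x y; rewrite (le_trans (dot_le_cabs _ _))// cabsM cabs_expi mulr1 mulrC.
- move=> x; rewrite (_ : (fun y => _) = (fun y => dot (u x) z * cos (x * y) +
     (complex.Im (u x) * complex.Re z - complex.Re (u x) * complex.Im z) * sin (x * y))).
    exact: continuous_mulcos.
  by apply/funext => y; rewrite /dot !cE/=; ring.
Qed.

Lemma continuous_Re_fourier u : L1f u -> continuous (fun xi => complex.Re (fourier u xi)).
Proof.
move=> iu; rewrite (_ : (fun xi => _) = (fun xi => dot (fourier u xi) 1)).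
  exact: continuous_dot_fourier.
by apply/funext => xi; rewrite /dot/= mulr1 mulr0 addr0.
Qed.

Lemma continuous_Im_fourier u : L1f u -> continuous (fun xi => complex.Im (fourier u xi)).
Proof.
move=> iu; rewrite (_ : (fun xi => _) = (fun xi => dot (fourier u xi) 'i)).
  exact: continuous_dot_fourier.
by apply/funext => xi; rewrite /dot/= mulr1 mulr0 add0r.
Qed.

Lemma cmeas_fourier u : L1f u -> cmeas (fourier u).
Proof.
by move=> iu; split; apply: continuous_measurable_fun;
  [exact: continuous_Re_fourier|exact: continuous_Im_fourier].
Qed.

Lemma ccontinuous (f : R -> R[i]) : continuous (fun x => complex.Re (f x)) ->
  continuous (fun x => complex.Im (f x)) -> continuous (f : R -> R[i]^o).
Proof.
move=> cR cI x; apply/cvgrPdist_lt => e e0.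
(* The radius [e] ranges over [R[i]], where being positive includes being real. *)
have e0R : 0 < complex.Re e /\ e = (complex.Re e)%:C.
  by move: e0; rewrite ltcE => /andP[/eqP/= e1 e2]; split => //; apply: complex_ext.
have e2 : 0 < complex.Re e / 2 by rewrite divr_gt0// e0R.1.
have /cvgrPdist_lt/(_ _ e2) := cR x; have /cvgrPdist_lt/(_ _ e2) := cI x.
apply: filterS2 => y yI yR.
rewrite e0R.2 normr_cabs ltcR (le_lt_trans (cabs_le_ReIm _))// !cE.
by rewrite [ltRHS]splitr ltrD.
Qed.

Lemma continuous_fourier u : L1f u -> continuous (fourier u : R -> R[i]^o).
Proof.
by move=> iu; apply: ccontinuous; [exact: continuous_Re_fourier|exact: continuous_Im_fourier].
Qed.

Lemma ccontinuous_Re (f : R -> R[i]) : continuous (f : R -> R[i]^o) ->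
  continuous (fun x => complex.Re (f x)) /\ continuous (fun x => complex.Im (f x)).
Proof.
move=> cf; split => x; apply/cvgrPdist_lt => e e0;
  have /cvgrPdist_lt/(_ e%:C) := cf x; rewrite ltcR => /(_ e0);
  apply: filterS => y; rewrite normr_cabs ltcR; apply: le_lt_trans.
- by rewrite -[X in X <= _]/(`|_|) (le_trans _ (Re_le_cabs _))// !cE.
- by rewrite (le_trans _ (Im_le_cabs _))// !cE.
Qed.

(** The reflected transform is the adjoint of the transform, by Fubini on a kernel dominated by
    |u(x)| |w(xi)|. *)
Lemma fourier_parseval u w : L1f u -> L1f w ->
  rint (fun xi => dot (fourier u xi) (w xi)) = rint (fun x => dot (u x) (fourier w (- x))).
Proof.
move=> iu iw.
pose K x xi := dot (u x) (w xi * expi (x * xi)).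
have iK : integ2 K.
  apply: (@integ2_dom R K (fun x xi => cabs (u x) * cabs (w xi))).
  - have m1 : meas2 (fun x _ : R => complex.Re (u x)) by apply: meas2_fst; exact: iu.1.1.
    have m2 : meas2 (fun x _ : R => complex.Im (u x)) by apply: meas2_fst; exact: iu.1.2.
    have m3 : meas2 (fun _ x : R => complex.Re (w x)) by apply: meas2_snd; exact: iw.1.1.
    have m4 : meas2 (fun _ x : R => complex.Im (w x)) by apply: meas2_snd; exact: iw.1.2.
    have mxy : meas2 (fun x y : R => x * y).
      by apply: meas2M; [apply: (@meas2_fst R idfun)|apply: (@meas2_snd R idfun)]; exact: measurable_id.
    have mc : meas2 (fun x y : R => cos (x * y)).
      by apply: (meas2_comp (@measurable_cosR R)).
    have ms : meas2 (fun x y : R => sin (x * y)).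
      by apply: (meas2_comp (@measurable_sinR R)).
    (* Expanding the kernel into products of functions of one variable with cos(x y) and sin(x y)
       gives joint measurability. *)
    rewrite (_ : K = fun x y =>
      complex.Re (u x) * (complex.Re (w y) * cos (x * y) + (-1) * (complex.Im (w y) * sin (x * y)))
      + complex.Im (u x) * (complex.Re (w y) * sin (x * y) + complex.Im (w y) * cos (x * y))).
      apply: meas2D; apply: meas2M => //; apply: meas2D; try exact: meas2M.
      apply: meas2M; last exact: meas2M.
      by apply: meas2_fst; exact: measurable_cst.
    by apply/funext => x; apply/funext => y; rewrite /K /dot !cE/=; ring.
  - by apply: integ2_prod; [exact: iu.2|exact: iw.2].
  - by move=> x y; rewrite (le_trans (dot_le_cabs _ _))// cabsM cabs_expi mulr1.
transitivity (rint (fun xi => cc * rint (fun x => K x xi))).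
  by apply: eq_rint => xi; rewrite dot_fourier.
rewrite rintZ; last exact: (integ_fubiniF (integ_swap iK)).
rewrite -rint_fubini// -rintZ; last exact: integ_fubiniF.
apply: eq_rint => x; rewrite dotC dot_fourier//; congr (_ * _); apply: eq_rint => y.
by rewrite /K dotC dot_expi mulrN (mulrC x).
Qed.

End Fourier.

(** * The Plancherel identity on the intersection of L^1 and L^2 *)

Section Plancherel.
Variable R : realType.
Local Notation mu := (@lebesgue_measure R).
Local Open Scope complex_scope.
Local Notation cmeas := (@cmeasurable R setT).
Implicit Types (a b v : R -> R).

Let rl2 (a : R -> R) := L2f (fun x => (a x)%:C).
Let rn (a : R -> R) := nrm (fun x => (a x)%:C).

Let rl2P a : measurable_fun setT a -> integ (fun x => a x ^+ 2) -> rl2 a.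
Proof.
move=> ma ia; split; first exact: cmeas_real.
by apply: eq_integ ia => x; rewrite cabsC -normrX ger0_norm// sqr_ge0.
Qed.

Let clip (k y : R) := Num.max (- k) (Num.min k y).

Let clip_id k y : `|y| <= k -> clip k y = y.
Proof.
rewrite ler_norml => /andP[ky yk]; rewrite /clip min_r// max_r//.
Qed.

Let clip_bnd k y : 0 <= k -> `|clip k y| <= k.
Proof.
move=> k0; rewrite ler_norml /clip le_max lexx/= ge_max ge_min lexx/= andbT.
by rewrite (le_trans _ k0)// oppr_le0.
Qed.

Let clip_lip k y z : `|clip k y - clip k z| <= `|y - z|.
Proof.
rewrite /clip /Num.max /Num.min.
by case: ifPn; case: ifPn; case: ifPn; case: ifPn; rewrite -?leNgt => h1 h2 h3 h4;
  rewrite ler_norml; case: (ger0P (y - z)) => ? ; apply/andP; split; lra.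
Qed.

Let clip_continuous k (g : R -> R) : continuous g -> continuous (fun x => clip k (g x)).
Proof.
move=> cg x; apply/cvgrPdist_lt => e e0; have /cvgrPdist_lt/(_ _ e0) := cg x.
by apply: filterS => y; exact/le_lt_trans/clip_lip.
Qed.

(** A trapezoidal cutoff: [(s + |s|) / 2] is the positive part of s = k + 1 - |x|, truncated at
    1. *)
Let chi (k x : R) := clip 1 ((k + 1 - `|x| + `|k + 1 - `|x| |) / 2).

Let chi_continuous k : continuous (chi k).
Proof.
apply: clip_continuous => x.
have c : k + 1 - `|y| @[y --> x] --> k + 1 - `|x|.
  by apply: cvgB; [exact: cvg_cst|exact: norm_continuous].
by apply: cvgM; [apply: cvgD => //; exact: cvg_norm|exact: cvg_cst].
Qed.

Let chi1 k x : `|x| <= k -> chi k x = 1.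
Proof.
move=> xk; have h : 1 <= k + 1 - `|x| by lra.
rewrite /chi (@ger0_norm _ (k + 1 - `|x|)); last by rewrite (le_trans ler01 h).
by rewrite /clip min_l; [rewrite max_r//; lra|lra].
Qed.

Let chi0 k x : k + 1 < `|x| -> chi k x = 0.
Proof.
move=> xk; rewrite /chi (@ltr0_norm _ (k + 1 - `|x|)); last by lra.
by rewrite subrr mul0r; apply: clip_id; rewrite normr0.
Qed.

Let chi_bnd k x : `|chi k x| <= 1. Proof. exact: clip_bnd. Qed.

(** Continuous functions are dense for the L^1 norm on a bounded interval. Truncating the
    approximant at the height [k] of [b] upgrades this to L^2, since |b - v|^2 <= 2 k |b - g|; this
    is the origin of the accuracy e / (2 k). *)
Let dense_bounded (b : R -> R) (k e : R) : 0 < k -> 0 < e -> measurable_fun setT b ->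
  (forall x, `|b x| <= k) -> (forall x, k < `|x| -> b x = 0) ->
  exists v (M : R), [/\ continuous v, forall x, `|v x| <= M, rl2 v &
    rint (fun x => (b x - v x) ^+ 2) <= e].
Proof.
move=> k0 e0 mb bk b0.
pose E : set R := `[- (k + 1), k + 1]%classic.
have mE : measurable E by exact: measurable_itv.
have EP x : E x <-> `|x| <= k + 1 by rewrite /E/= in_itv/= ler_norml.
have iE : integ (\1_E : R -> R).
  by apply: integrable_indic_itv.
have Efin : (mu E < +oo)%E by rewrite /E lebesgue_measure_itv/=; case: ifP; rewrite -?EFinB ltry.
have ib : integ b.
  apply: integ_dom (integZ k iE) _ => // x; rewrite indicE; case: (boolP (x \in E)) => xE.
    by rewrite mulr1.
  rewrite mulr0 b0 ?normr0//; move: xE; rewrite notin_setE => /EP/negP; rewrite -ltNge => xk.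
  by rewrite (lt_trans _ xk)// ltrDl.
have ibE : mu.-integrable E (EFin \o b) by apply: integrableS ib.
have [gs [cgs igs gcv]] := approximation_continuous_integrable mE Efin ibE.
have e2k : 0 < e / (2 * k) by rewrite divr_gt0// mulr_gt0.
have [n gn] : exists n, (\int[mu]_(z in E) `|(b z - gs n z)%:E| <= (e / (2 * k))%:E)%E.
  have [gfin /cvgr0Pnorm_le/(_ _ e2k) gle] := (fine_cvgP _ _).1 gcv.
  have [n [n1 n2]] := filter_ex (filterI gfin gle).
  exists n; rewrite -(fineK n1) lee_fin; exact: le_trans (ler_norm _) n2.
pose g := gs n; pose v x := chi k x * clip k (g x).
have cv : continuous v.
  by move=> x; apply: cvgM; [exact: chi_continuous|apply: clip_continuous; exact: cgs].
have mv := continuous_measurable_fun cv.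
have vb x : `|v x| <= k.
  by rewrite normrM -[leRHS]mul1r ler_pM// ?chi_bnd// clip_bnd// ltW.
have v0 x : ~ E x -> v x = 0.
  by move=> /EP/negP; rewrite -ltNge => xk; rewrite /v chi0// mul0r.
exists v, k; split => //.
  apply: rl2P => //; apply: (integ_dom _ (integZ (k ^+ 2) iE)); first exact: measurable_funX.
  move=> x; rewrite indicE; case: (boolP (x \in E)) => xE.
    by rewrite mulr1 normrX lerXn2r ?nnegrE// ltW.
  by rewrite v0 ?expr0n ?normr0 ?mulr0//; move: xE; rewrite notin_setE.
have mg : measurable_fun setT g by apply: continuous_measurable_fun; exact: cgs.
pose d x := 2 * k * (`|b x - g x| * \1_E x).
have bd x : (b x - v x) ^+ 2 <= d x.
  have [xE|xE] := pselect (E x); last first.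
    rewrite /d v0// b0 ?subrr ?expr0n/= ?mulr_ge0 ?(ltW k0)//.
    move/EP/negP : xE; rewrite -ltNge => /(lt_trans _); apply; by rewrite ltrDl.
  rewrite /d indicE mem_set// mulr1.
  have -> : b x - v x = chi k x * (b x - clip k (g x)).
    rewrite mulrBr; congr (_ - _); have [xk|xk] := leP `|x| k.
      by rewrite chi1// mul1r.
    by rewrite b0// mulr0.
  have h1 : `|b x - clip k (g x)| <= `|b x - g x|.
    by rewrite -{1}(@clip_id k (b x))// clip_lip.
  have h2 : `|b x - clip k (g x)| <= 2 * k.
    rewrite (le_trans (ler_normB _ _))// mulr_natl mulr2n lerD//.
    by rewrite clip_bnd// ltW.
  rewrite -[leLHS]ger0_norm ?sqr_ge0// normrX normrM.
  apply: (@le_trans _ _ (`|b x - clip k (g x)| ^+ 2)).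
    by rewrite lerXn2r ?nnegrE ?mulr_ge0// -[leRHS]mul1r ler_wpM2r// chi_bnd.
  by rewrite expr2 ler_pM.
have id : integ d.
  apply: integZ; apply/integrableP; split.
    apply: meas_EFin; apply: measurable_funM; last exact: measurable_indicR.
    by apply: measurableT_comp => //; exact: measurable_funB.
  apply: le_lt_trans (ltry (e / (2 * k))); apply: le_trans gn.
  rewrite [leRHS]integral_mkcond; apply: ge0_le_integral => //.
  - apply: meas_EFin; apply: measurableT_comp => //; apply: measurable_funM; last exact: measurable_indicR.
    by apply: measurableT_comp => //; exact: measurable_funB.
  - apply: (measurable_restrictT _ _).1 => //; apply: measurable_funTS.
    by apply: meas_EFin; apply: measurableT_comp => //; exact: measurable_funB.
  - move=> x _; rewrite /= /patch indicE.
    by case: ifP; rewrite ?mulr1 ?mulr0 ?normr0 ?lexx// normr_id.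
have ibv : integ (fun x => (b x - v x) ^+ 2).
  apply: integ_dom id _; first by apply: measurable_funX; exact: measurable_funB.
  by move=> x; rewrite ger0_norm ?sqr_ge0.
apply: le_trans (le_rint ibv id bd) _.
have idE : integ (fun x => `|b x - g x| * \1_E x).
  by apply: eq_integ (integZ (2 * k)^-1 id) => x; rewrite /d mulKf// gt_eqF// mulr_gt0.
rewrite /d rintZ// mulrC -ler_pdivlMr ?mulr_gt0// -lee_fin rintE//.
apply: le_trans gn; rewrite [leRHS]integral_mkcond.
rewrite (_ : (fun x => `|(b x - g x)%:E|)%E \_ E = fun x => (`|b x - g x| * \1_E x)%:E)//.
by apply/funext => x; rewrite /patch indicE; case: ifP; rewrite ?mulr1 ?mulr0.
Qed.

Let rlB a b : rl2 a -> rl2 b -> L2f (fun x => (a x - b x)%:C).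
Proof.
move=> ia ib; rewrite (_ : (fun x => _) = (fun x => (a x)%:C - (b x)%:C)); first exact: L2fB.
by apply/funext => x; rewrite rmorphB.
Qed.

Let rn2 a : rn a ^+ 2 = rint (fun x => a x ^+ 2).
Proof.
by rewrite /rn nrm2; apply: eq_rint => x; rewrite cabsC -normrX ger0_norm// sqr_ge0.
Qed.

(** Truncation in both domain and height reduces to [dense_bounded]. *)
Let dense_L2 a e : 0 < e -> measurable_fun setT a -> rl2 a ->
  exists v (M : R), [/\ continuous v, forall x, `|v x| <= M, rl2 v &
    rn (fun x => a x - v x) <= e].
Proof.
move=> e0 ma ia.
pose S n : set R := `[- n.+1%:R, n.+1%:R]%classic `&` a @^-1` `[- n.+1%:R, n.+1%:R]%classic.
have mS n : measurable (S n).
  apply: measurableI; first exact: measurable_itv.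
  by rewrite -[X in measurable X]setTI; exact: ma.
pose b n x := a x * \1_(S n) x.
have mb n : measurable_fun setT (b n) by apply: measurable_funM => //; exact: measurable_indicR.
have SP n x : x \in S n = (`|x| <= n.+1%:R) && (`|a x| <= n.+1%:R).
  rewrite !ler_norml; apply/idP/idP; rewrite inE /S/= !in_itv/=; first by case=> -> ->.
  by move/andP.
have bn n x : `|b n x| <= n.+1%:R.
  rewrite /b indicE SP; case: (leP `|a x|) => h; last by rewrite andbF mulr0 normr0.
  by case: (leP `|x|) => _; rewrite ?mulr1 ?mulr0 ?normr0.
have b0 n x : n.+1%:R < `|x| -> b n x = 0.
  by rewrite /b indicE SP => xn; rewrite leNgt xn/= mulr0.
have ba n x : `|b n x| <= `|a x|.
  by rewrite /b indicE; case: (_ \in _); rewrite ?mulr1// mulr0 normr0.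
have bl n : rl2 (b n).
  by apply: L2f_dom ia _; [exact: cmeas_real|move=> x; rewrite !cabsC].
have cv : nrm (fun x => (b n x)%:C - (a x)%:C) @[n --> \oo] --> (0 : R).
  apply: (L2_dct (w := fun x => (a x)%:C)) => //.
  - by move=> n; exact: cmeas_real.
  - move=> n x; rewrite -rmorphB !cabsC /b indicE.
    by case: (_ \in _); rewrite ?mulr1 ?mulr0 ?subrr ?normr0// sub0r normrN.
  - apply: ae_all => x; apply: cvg_near_cst.
    near=> n; rewrite /b indicE SP.
    suff : (`|x| <= n.+1%:R) && (`|a x| <= n.+1%:R) by move=> ->; rewrite mulr1 subrr cabs0.
    have : Num.max `|x| `|a x| <= n.+1%:R.
      near: n; have := nbhs_infty_ger (Num.max `|x| `|a x|).
      by apply: filterS => k /le_trans; apply; rewrite ler_nat.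
    by rewrite ge_max.
have [n nP] : exists n, nrm (fun x => (b n x)%:C - (a x)%:C) <= e / 2.
  have e2 : 0 < e / 2 by rewrite divr_gt0.
  move/cvgr0Pnorm_le : cv => /(_ _ e2) /filter_ex[n nP].
  by exists n; exact: le_trans (ler_norm _) nP.
have e2 : 0 < (e / 2) ^+ 2 by rewrite exprn_gt0// divr_gt0.
have [v [M [cv' vM lv bv]]] := dense_bounded (ltr0Sn R n) e2 (mb n) (bn n) (b0 n).
exists v, M; split => //.
have E : rn (fun x => a x - v x) = nrm (fun x => (a x)%:C - (v x)%:C).
  by apply: eq_nrm => x; rewrite rmorphB.
rewrite E; apply: (le_trans (nrm_tri ia (bl n) lv)).
rewrite [leRHS]splitr; apply: lerD; first by rewrite nrmBC.
have : rn (fun x => b n x - v x) <= e / 2.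
  by rewrite -(@ler_pXn2r _ 2) ?nnegrE ?nrm_ge0 ?divr_ge0 ?(ltW e0)// rn2.
by apply: le_trans; rewrite /rn le_eqVlt; apply/orP; left; apply/eqP; apply: eq_nrm => x; rewrite rmorphB.
Unshelve. all: by end_near. Qed.

Let shiftR a t := fun y => a (t + y).

Let rn_shift a t : rl2 a -> rl2 (shiftR a t) /\ rn (shiftR a t) = rn a.
Proof.
move=> ia; have e : shiftR a t = (fun y => a (y + t)).
  by apply/funext => y; rewrite /shiftR addrC.
rewrite e; split.
  split; first exact: (cmeas_comp ia.1 (measurable_shift t)).
  exact: (integ_shift t ia.2).
by rewrite /rn /nrm -(rint_shift t ia.2).
Qed.

Let rip a b := rint (fun y => a y * b y).

Let rip_le a b : rl2 a -> rl2 b -> integ (fun y => a y * b y) /\ `|rip a b| <= rn a * rn b.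
Proof.
move=> ia ib.
have e y : dot (a y)%:C (b y)%:C = a y * b y by rewrite /dot/= mulr0 addr0.
split; first by apply: eq_integ (integ_dot ia ib).
by have := normr_ip ia ib; congr (`|_| <= _); apply: eq_rint.
Qed.

Let corr_bounded_continuous a v (M : R) : integ a -> continuous v -> (forall x, `|v x| <= M) ->
  continuous (fun t => rip a (shiftR v t)).
Proof.
move=> ia cv vM.
apply: (@rint_continuous R (fun y t => a y * v (t + y)) (fun y => M * `|a y|)).
- move=> t; apply: measurable_funM; first exact: integ_meas.
  apply: (measurableT_comp (continuous_measurable_fun cv)).
  by apply: measurable_funD; [exact: measurable_cst|exact: measurable_id].
- by apply: integZ; exact: integ_norm.
- by move=> y t; rewrite normrM mulrC ler_wpM2r.
- move=> y t; apply: cvgM; first exact: cvg_cst.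
  have c : s + y @[s --> t] --> t + y by apply: cvgD; [exact: cvg_id|exact: cvg_cst].
  exact: (cvg_comp _ _ c (cv _)).
Qed.

(** The shifted factor is replaced by a continuous bounded [v]. As translations are isometric, the
    autocorrelation changes by little uniformly in the shift, and a uniform limit of continuous
    functions is continuous. *)
Let corr_continuous a : integ a -> rl2 a -> continuous (fun t => rip a (shiftR a t)).
Proof.
move=> ia la t; apply/cvgrPdist_le => e e0.
have ra : 0 < rn a + 1 by rewrite ltr_wpDl// nrm_ge0.
have e3 : 0 < e / 3 / (rn a + 1) by rewrite !divr_gt0.
have [v [M [cv vM lv av]]] := dense_L2 e3 (integ_meas ia) la.
have close s : `|rip a (shiftR a s) - rip a (shiftR v s)| <= e / 3.
  have [l1 _] := rn_shift s la; have [l2 _] := rn_shift s lv.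
  have [i1 _] := rip_le la l1; have [i2 _] := rip_le la l2.
  have [l3 n3] := rn_shift s (rlB la lv).
  rewrite /rip -rintB//; have [_] := rip_le la l3.
  rewrite n3 => h; apply: le_trans (le_trans _ h) _; last first.
    apply: (@le_trans _ _ ((rn a + 1) * (e / 3 / (rn a + 1)))).
      by apply: ler_pM; rewrite ?nrm_ge0// lerDl.
    by rewrite mulrC divfK// gt_eqF.
  by rewrite /rip le_eqVlt; apply/orP; left; apply/eqP; congr `|_|; apply: eq_rint => y; rewrite /shiftR mulrBr.
have e30 : 0 < e / 3 by rewrite divr_gt0.
have cbt := corr_bounded_continuous ia cv vM (x := t).
move/cvgrPdist_le : cbt => /(_ _ e30).
apply: filterS => s hs.
have c1 := close t; have c2 := close s.
rewrite (_ : rip a (shiftR a t) - rip a (shiftR a s) =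
  (rip a (shiftR a t) - rip a (shiftR v t)) + (rip a (shiftR v t) - rip a (shiftR v s))
  + (rip a (shiftR v s) - rip a (shiftR a s))); last by ring.
apply: (le_trans (ler_normD _ _)); rewrite (_ : e = e / 3 + e / 3 + e / 3); last by field.
apply: lerD; last by rewrite distrC.
by apply: (le_trans (ler_normD _ _)); exact: lerD.
Qed.

(** Unnormalised cosine and sine transforms: for real [a], one parity each. *)
Definition ctr a xi := rint (fun x => a x * cos (x * xi)).
Definition str a xi := rint (fun x => a x * sin (x * xi)).

Lemma measurable_sinMr t : measurable_fun setT (fun x : R => sin (x * t)).
Proof. by apply: (measurableT_comp (@measurable_sinR R)); exact: measurable_funM. Qed.

Lemma integ_mulcos a xi : integ a -> integ (fun x => a x * cos (x * xi)).
Proof.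
move=> ia; apply: (integMb (M := 1)) => //; first exact: measurable_cosMr.
by move=> x; exact: normr_cos_le1.
Qed.
Lemma integ_mulsin a xi : integ a -> integ (fun x => a x * sin (x * xi)).
Proof.
move=> ia; apply: (integMb (M := 1)) => //; first exact: measurable_sinMr.
by move=> x; exact: normr_sin_le1.
Qed.

Lemma ctr_opp a xi : ctr a (- xi) = ctr a xi.
Proof. by apply: eq_rint => x; rewrite mulrN cosN. Qed.
Lemma str_opp a xi : integ a -> str a (- xi) = - str a xi.
Proof.
move=> ia; rewrite /str -rintN; last exact: integ_mulsin.
by apply: eq_rint => x; rewrite mulrN sinN mulrN.
Qed.

Lemma ctr_continuous a : integ a -> continuous (ctr a).
Proof.
move=> ia; apply: (@rint_continuous R (fun x xi => a x * cos (x * xi)) (fun x => `|a x|)).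
- by move=> xi; apply: measurable_funM; [exact: integ_meas|exact: measurable_cosMr].
- exact: integ_norm.
- by move=> x xi; rewrite normrM ler_piMr// normr_cos_le1.
- move=> x; have := @continuous_mulcos R (a x) 0 x.
  by under eq_fun do rewrite mul0r addr0.
Qed.

Lemma str_continuous a : integ a -> continuous (str a).
Proof.
move=> ia; apply: (@rint_continuous R (fun x xi => a x * sin (x * xi)) (fun x => `|a x|)).
- by move=> xi; apply: measurable_funM; [exact: integ_meas|exact: measurable_sinMr].
- exact: integ_norm.
- by move=> x xi; rewrite normrM ler_piMr// normr_sin_le1.
- move=> x; have := @continuous_mulcos R 0 (a x) x.
  by under eq_fun do rewrite mul0r add0r.
Qed.

(** With s = t + y the cosine becomes cos((s - y) xi), and the addition formula separates the double
    integral into two products. *)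
Let corr_transform a xi : integ a -> rl2 a ->
  rint (fun t => rip a (shiftR a t) * cos (t * xi)) = ctr a xi ^+ 2 + str a xi ^+ 2.
Proof.
move=> ia la.
pose K t y := a y * a (t + y) * cos (t * xi).
have ma := integ_meas ia.
have mty : meas2 (fun t y : R => t + y).
  by apply: meas2D; [apply: (@meas2_fst R idfun)|apply: (@meas2_snd R idfun)]; exact: measurable_id.
have iK : integ2 K.
  apply: integ2_dom (integ2_conv (integ_norm ia) (integ_norm ia)) _.
    apply: meas2M; last by apply: meas2_fst; exact: measurable_cosMr.
    by apply: meas2M; [exact: meas2_snd|exact: meas2_comp].
  by move=> t y; rewrite /K !normrM ler_piMr ?mulr_ge0// normr_cos_le1.
have inner y : rint (fun t => K t y) =
    a y * (ctr a xi * cos (y * xi) + str a xi * sin (y * xi)).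
  pose h s := a s * cos ((s - y) * xi).
  have ih : integ h.
    apply: (integMb (M := 1)) => //; last by move=> x; exact: normr_cos_le1.
    apply: (measurableT_comp (@measurable_cosR R)).
    by apply: measurable_funM => //; exact: measurable_funD.
  transitivity (a y * rint h).
    rewrite -(rint_shift y ih) -rintZ; last exact: integ_shift.
    by apply: eq_rint => t; rewrite /K /h addrK mulrA.
  congr (_ * _); rewrite /ctr /str mulrC -rintZ; last exact: integ_mulcos.
  rewrite [X in _ + X]mulrC -rintZ; last exact: integ_mulsin.
  rewrite -rintD; [|by apply: integZ; exact: integ_mulcos|by apply: integZ; exact: integ_mulsin].
  by apply: eq_rint => s; rewrite /h mulrBl cosB; ring.
transitivity (rint (fun t => rint (K t))).
  apply: eq_rint => t; rewrite mulrC /rip.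
  have [i _] := rip_le la (rn_shift t la).1.
  by rewrite -rintZ//; apply: eq_rint => y; rewrite /K mulrC.
rewrite rint_fubini//; under eq_fun do rewrite inner.
have iC : integ (fun y => ctr a xi * (a y * cos (y * xi))) by apply: integZ; exact: integ_mulcos.
have iS : integ (fun y => str a xi * (a y * sin (y * xi))) by apply: integZ; exact: integ_mulsin.
transitivity (rint (fun y => ctr a xi * (a y * cos (y * xi)) + str a xi * (a y * sin (y * xi)))).
  by apply: eq_rint => y; ring.
rewrite rintD// !rintZ; [|exact: integ_mulsin|exact: integ_mulcos].
by rewrite !expr2.
Qed.

Let abelw_le n x : abelw (n.+1%:R^-1 : R) x <= abelw n.+2%:R^-1 x.
Proof.
rewrite /abelw ler_expR !mulNr lerN2; apply: ler_wpM2r => //.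
by rewrite lef_pV2 ?posrE// ler_nat.
Qed.

Lemma abelw_cvg x : abelw (n.+1%:R^-1 : R) x @[n --> \oo] --> (1 : R).
Proof.
have c : - (n.+1%:R^-1 : R) * `|x| @[n --> \oo] --> - (0 : R) * `|x|.
  by apply: cvgM; [apply: cvgN; exact: cvg_harmonic|exact: cvg_cst].
rewrite oppr0 mul0r in c.
by have := cvg_comp _ _ c (@continuous_expR R 0); rewrite expR0.
Qed.

Let ctr_bnd a xi : integ a -> `|ctr a xi| <= rint (fun x => `|a x|).
Proof.
move=> ia; apply: normr_rint_le; [exact: integ_mulcos|exact: integ_norm|].
by move=> x; rewrite normrM ler_piMr// normr_cos_le1.
Qed.
Let str_bnd a xi : integ a -> `|str a xi| <= rint (fun x => `|a x|).
Proof.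
move=> ia; apply: normr_rint_le; [exact: integ_mulsin|exact: integ_norm|].
by move=> x; rewrite normrM ler_piMr// normr_sin_le1.
Qed.

Let measurable_ctr a : integ a -> measurable_fun setT (ctr a).
Proof. by move=> ia; apply: continuous_measurable_fun; exact: ctr_continuous. Qed.
Let measurable_str a : integ a -> measurable_fun setT (str a).
Proof. by move=> ia; apply: continuous_measurable_fun; exact: str_continuous. Qed.

(* The squared modulus of the transform is the cosine transform of the
   autocorrelation, which is continuous at 0: Abel summation evaluates its
   integral and monotone convergence removes the weights. *)
Let real_plancherel a : integ a -> rl2 a ->
  integ (fun xi => ctr a xi ^+ 2 + str a xi ^+ 2) /\
  rint (fun xi => ctr a xi ^+ 2 + str a xi ^+ 2) = 2 * pi * rint (fun x => a x ^+ 2).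
Proof.
move=> ia la.
have ir : integ (fun t => rip a (shiftR a t)) by exact: integ_fubiniF (integ2_conv ia ia).
pose q xi := ctr a xi ^+ 2 + str a xi ^+ 2.
have q0 xi : 0 <= q xi by rewrite addr_ge0// sqr_ge0.
have mq : measurable_fun setT q.
  by apply: measurable_funD; apply: measurable_funX; [exact: measurable_ctr|exact: measurable_str].
have ab := abel_summation ir (@corr_continuous a ia la 0).
have r0 : rip a (shiftR a 0) = rint (fun x => a x ^+ 2).
  by apply: eq_rint => y; rewrite /shiftR add0r.
rewrite r0 in ab.
apply: (@rint_mct_eq R (fun n xi => abelw n.+1%:R^-1 xi * q xi) q) => //.
- move=> n; apply: (integMb (M := rint (fun x => `|a x|) ^+ 2 + rint (fun x => `|a x|) ^+ 2)) => //.
    by apply: integ_abelw; rewrite invr_gt0.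
  move=> xi; rewrite ger0_norm ?q0// /q.
  have b0 : 0 <= rint (fun x => `|a x|) by apply: rint_ge0.
  by apply: lerD; rewrite -[leLHS]ger0_norm ?sqr_ge0// normrX lerXn2r ?nnegrE// ?ctr_bnd ?str_bnd.
- by move=> n x; rewrite mulr_ge0 ?abelw_ge0.
- by move=> n x; rewrite ler_wpM2r ?abelw_le.
- by apply: eq_cvgn_to ab => n; apply: eq_rint => xi; rewrite corr_transform.
- move=> x; rewrite -[X in _ --> X]mul1r; apply: cvgM; [exact: abelw_cvg|exact: cvg_cst].
Qed.

Let cross_bound (x y z w : R) : `|x * y - z * w| <= (x ^+ 2 + w ^+ 2) + (z ^+ 2 + y ^+ 2).
Proof.
have h1 := sqr_ge0 (x - y); have h2 := sqr_ge0 (x + y).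
have h3 := sqr_ge0 (z - w); have h4 := sqr_ge0 (z + w).
by rewrite ler_norml; apply/andP; split; nra.
Qed.

(** Splitting [u] into real and imaginary parts leaves a cross term [p]. Cosine transforms are even
    and sine transforms odd, so [p] is odd and integrates to 0. *)
Theorem plancherel (u : R -> R[i]) : L1f u -> L2f u ->
  L2f (fourier u) /\ nrm (fourier u) = nrm u.
Proof.
move=> iu lu.
pose a x := complex.Re (u x); pose b x := complex.Im (u x).
have ia : integ a := L1f_Re iu; have ib : integ b := L1f_Im iu.
have la : rl2 a.
  apply: L2f_dom lu _; first by apply: cmeas_real; exact: integ_meas.
  by move=> x; rewrite cabsC Re_le_cabs.
have lb : rl2 b.
  apply: L2f_dom lu _; first by apply: cmeas_real; exact: integ_meas.
  by move=> x; rewrite cabsC Im_le_cabs.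
have ReE xi : complex.Re (fourier u xi) = cc R * (ctr a xi + str b xi).
  have := dot_fourier xi 1 iu; rewrite [LHS]/dot/= mulr1 mulr0 addr0 => ->; congr (_ * _).
  rewrite -rintD; [|exact: integ_mulcos|exact: integ_mulsin].
  by apply: eq_rint => x; rewrite mul1r /dot/=.
have ImE xi : complex.Im (fourier u xi) = cc R * (ctr b xi - str a xi).
  have := dot_fourier xi (Complex 0 1) iu; rewrite [LHS]/dot/= mulr1 mulr0 add0r => ->; congr (_ * _).
  rewrite -rintB; [|exact: integ_mulcos|exact: integ_mulsin].
  apply: eq_rint => x; rewrite /dot !cE.
  rewrite -[complex.Im (Complex 0 1)]/(1 : R) !mul0r !mul1r sub0r add0r.
  by rewrite mulrN addrC.
have [i1 r1] := real_plancherel ia la.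
have [i2 r2] := real_plancherel ib lb.
pose q xi := (ctr a xi ^+ 2 + str a xi ^+ 2) + (ctr b xi ^+ 2 + str b xi ^+ 2).
have iq : integ q by exact: integD.
pose p xi := ctr a xi * str b xi - ctr b xi * str a xi.
have ip_ : integ p.
  apply: integ_dom iq _.
    by apply: measurable_funB; apply: measurable_funM;
      [exact: measurable_ctr|exact: measurable_str|exact: measurable_ctr|exact: measurable_str].
  by move=> x; exact: cross_bound.
have p0 : rint p = 0.
  by apply: rint_odd => // x; rewrite /p !ctr_opp !str_opp//; ring.
have sqE xi : cabs (fourier u xi) ^+ 2 = cc R ^+ 2 * (q xi + 2 * p xi).
  by rewrite cabs_sqr ReE ImE /q /p; ring.
have iqp : integ (fun xi => q xi + 2 * p xi) by apply: integD => //; exact: integZ.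
split.
  split; first exact: cmeas_fourier.
  by apply: eq_integ (integZ (cc R ^+ 2) iqp) => xi; rewrite sqE.
rewrite /nrm; congr Num.sqrt.
transitivity (rint (fun xi => cc R ^+ 2 * (q xi + 2 * p xi))); first by apply: eq_rint.
rewrite rintZ// rintD//; last exact: integZ.
rewrite rintZ// p0 mulr0 addr0 /q rintD// r1 r2 -mulrDr cc_sqr mulKf; last first.
  by rewrite gt_eqF// mulr_gt0// pi_gt0.
rewrite -rintD.
- by apply: eq_rint => x; rewrite cabs_sqr.
- by apply: eq_integ la.2 => x; rewrite cabsC -normrX ger0_norm// sqr_ge0.
- by apply: eq_integ lb.2 => x; rewrite cabsC -normrX ger0_norm// sqr_ge0.
Qed.

End Plancherel.

(** * The transform on L^2 and its inversion *)

Section Fourier2.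
Variable R : realType.
Local Notation mu := (@lebesgue_measure R).
Local Open Scope complex_scope.
Local Notation cmeas := (@cmeasurable R setT).
Implicit Types (u v w g h G H : R -> R[i]).

Definition cut (D : set R) u : R -> R[i] := fun x => u x * (\1_D x)%:C.

Lemma cabs_cut D u x : cabs (cut D u x) = \1_D x * cabs (u x).
Proof. by rewrite /cut cabsM cabsC mulrC indicE ger0_norm. Qed.

Lemma cut_in D u x : D x -> cut D u x = u x.
Proof. by move=> Dx; rewrite /cut indicE mem_set// mulr1. Qed.
Lemma cut_out D u x : ~ D x -> cut D u x = 0.
Proof. by move=> Dx; rewrite /cut indicE memNset// mulr0. Qed.

Lemma cmeas_cut D u : measurable D -> cmeas u -> cmeas (cut D u).
Proof.
by move=> mD mu_; apply: cmeasM => //; apply: cmeas_real; exact: measurable_indicR.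
Qed.

Lemma cabs_cut_le D u x : cabs (cut D u x) <= cabs (u x).
Proof.
by rewrite cabs_cut indicE; case: (_ \in _); rewrite ?mul1r ?mul0r ?cabs_ge0.
Qed.

Lemma L2f_cut D u : measurable D -> L2f u -> L2f (cut D u).
Proof.
by move=> mD lu; apply: (L2f_dom _ lu (cabs_cut_le D u)); apply: cmeas_cut => //; exact: lu.1.
Qed.

Lemma L1f_cut D u : measurable D -> L1f u -> L1f (cut D u).
Proof.
move=> mD [cu iu]; split; first exact: cmeas_cut.
apply: integ_dom iu _; first by apply: measurable_cabs; exact: cmeas_cut.
by move=> x; rewrite ger0_norm ?cabs_ge0 ?cabs_cut_le.
Qed.

Lemma L2norm_cut D u : L2norm D u = L2norm setT (cut D u).
Proof.
by rewrite /L2norm; apply: eq_Lnorm => x; rewrite cabs_cut [\1_setT]indicT mul1r.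
Qed.

Lemma L2normTE u : L2norm setT u = poweR (\int[mu]_x (cabs (u x) ^+ 2)%:E)%E 2^-1.
Proof.
rewrite /L2norm unlock; congr poweR; apply: eq_integral => x _.
rewrite [\1_setT]indicT mul1r /= ger0_norm ?cabs_ge0//.
by rewrite powR_mulrn ?cabs_ge0.
Qed.

Lemma L2norm_nrm u : L2f u -> L2norm setT u = (nrm u)%:E.
Proof.
move=> [cu iu]; rewrite L2normTE -(rintE iu) poweR_EFin powR12_sqrt//.
by apply: rint_ge0 => x; exact: sqr_ge0.
Qed.

Lemma L2norm_lty u : cmeas u -> (L2norm setT u < +oo)%E -> L2f u.
Proof.
move=> cu; rewrite L2normTE => h; split => //.
apply: integ_ge0P; [exact: measurable_cabs2|by move=> x; exact: sqr_ge0|].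
rewrite ltey; apply/negP => /eqP e; move: h.
by rewrite e poweRyr ?ltxx// invr_neq0.
Qed.

Lemma L2P u : L2 setT u <-> L2f u.
Proof.
split=> [[cu]|lu]; first exact: L2norm_lty.
by split; [exact: lu.1|rewrite L2norm_nrm// ltry].
Qed.

Lemma L2norm_base D u : measurable D -> L2f u -> L2norm D u = (nrm (cut D u))%:E.
Proof. by move=> mD lu; rewrite L2norm_cut L2norm_nrm//; exact: L2f_cut. Qed.

Lemma L2norm_ge0 D u : (0 <= L2norm D u)%E.
Proof. exact: Lnorm_ge0. Qed.

Lemma ae_eq_L2norm u v : cmeas u -> cmeas v -> {ae mu, forall x, u x = v x} ->
  L2norm setT u = L2norm setT v.
Proof.
move=> cu cv uv; rewrite !L2normTE; congr poweR; apply: ae_eq_integral => //.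
- by apply: meas_EFin; exact: measurable_cabs2.
- by apply: meas_EFin; exact: measurable_cabs2.
- by apply: ae_imp uv => x -> _.
Qed.

Lemma cvg_nrmP (U : nat -> R -> R[i]) u : (forall n, L2f (U n)) -> L2f u ->
  (L2norm setT (fun x => U n x - u x) @[n --> \oo] --> 0%E) <->
  (nrm (fun x => U n x - u x) @[n --> \oo] --> (0 : R)).
Proof.
move=> lU lu.
rewrite (_ : (fun n => L2norm setT _) = (fun n => (nrm (fun x => U n x - u x))%:E)).
  split; first by move/fine_cvg.
  by move=> h; apply: cvg_EFin => //; exact: nearW.
by apply/funext => n; rewrite L2norm_nrm//; exact: L2fB.
Qed.

Lemma nrm_dist u v : L2f u -> L2f v -> `|nrm u - nrm v| <= nrm (fun x => u x - v x).
Proof.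
move=> lu lv; have h1 := nrmD (L2fB lu lv) lv; have h2 := nrmD (L2fB lv lu) lu.
rewrite (@eq_nrm R _ u) in h1; last by move=> x; rewrite subrK.
rewrite (@eq_nrm R _ v) in h2; last by move=> x; rewrite subrK.
rewrite (nrmBC v) in h2; rewrite ler_norml; apply/andP; split; lra.
Qed.

Lemma nrm_cvg (U : nat -> R -> R[i]) u : (forall n, L2f (U n)) -> L2f u ->
  nrm (fun x => U n x - u x) @[n --> \oo] --> (0 : R) ->
  nrm (U n) @[n --> \oo] --> nrm u.
Proof.
move=> lU lu /cvgr0Pnorm_le h; apply/cvgrPdist_le => e e0.
have := h e e0; apply: filterS => n; rewrite distrC ger0_norm ?nrm_ge0//.
by apply: le_trans; exact: nrm_dist.
Qed.

Definition itvn n : set R := `[- n%:R, n%:R]%classic.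

Lemma itvnP n x : itvn n x <-> `|x| <= n%:R.
Proof. by rewrite /itvn/= in_itv/= ler_norml. Qed.

Lemma measurable_itvn n : measurable (itvn n). Proof. exact: measurable_itv. Qed.

Lemma integ_itv (a b : R) : integ (\1_(`[a, b]%classic : set R)).
Proof. exact: integrable_indic_itv. Qed.

(** On a bounded interval the majorant 1 + c^2 of the modulus c is integrable. *)
Lemma L1f_bounded_cut u (a b : R) : L2f u -> L1f (cut `[a, b]%classic u).
Proof.
move=> lu; have mD : measurable (`[a, b]%classic : set R) by exact: measurable_itv.
have cu := cmeas_cut mD lu.1; split => //.
apply: (integ_dom _ (integD (integ_itv a b) lu.2)); first exact: measurable_cabs.
move=> x; rewrite ger0_norm ?cabs_ge0// cabs_cut indicE; case: (_ \in _).
  rewrite mul1r; set c := cabs _; rewrite -[true%:R]/(1 : R); have := sqr_ge0 (c - 1); nra.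
by rewrite mul0r addr_ge0// sqr_ge0.
Qed.

Lemma cut_cvg u : L2f u -> nrm (fun x => cut (itvn n) u x - u x) @[n --> \oo] --> (0 : R).
Proof.
move=> lu; apply: (L2_dct (w := u)) => //.
- by move=> n; apply: cmeas_cut; [exact: measurable_itvn|exact: lu.1].
- exact: lu.1.
- move=> n x; have [xn|xn] := pselect (itvn n x).
    by rewrite cut_in// subrr cabs0 cabs_ge0.
  by rewrite cut_out// sub0r cabsN.
- apply: ae_all => x; apply: cvg_near_cst.
  have := nbhs_infty_ger `|x|; apply: filterS => n xn.
  by rewrite cut_in ?subrr ?cabs0//; exact/itvnP.
Qed.

Lemma is_fourier2P g G : L2f g -> L2f G ->
  (exists u : nat -> R -> R[i],
    [/\ forall k, L1f (u k) /\ L2f (u k),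
        nrm (fun x => u k x - g x) @[k --> \oo] --> (0 : R) &
        nrm (fun xi => fourier (u k) xi - G xi) @[k --> \oo] --> (0 : R)]) <->
  is_fourier2 g G.
Proof.
move=> lg lG; split=> [[u [lu ug uG]]|[_ [_ [u [lu ug uG]]]]].
  split; first exact/L2P; split; first exact/L2P.
  exists u; split.
  - by move=> k; split; [apply/L1P; exact: (lu k).1|apply/L2P; exact: (lu k).2].
  - by apply/cvg_nrmP => // k; exact: (lu k).2.
  - by apply/cvg_nrmP => // k; apply: (plancherel (lu k).1 (lu k).2).1.
have lu1 k : L1f (u k) by apply/L1P; exact: (lu k).1.
have lu2 k : L2f (u k) by apply/L2P; exact: (lu k).2.
exists u; split => //.
- exact/cvg_nrmP.
- by apply/cvg_nrmP => // k; apply: (plancherel (lu1 k) (lu2 k)).1.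
Qed.

(** The truncations of [g] to [-n, n] are integrable; the isometry makes their transforms a Cauchy
    sequence. *)
Lemma is_fourier2_exists g : L2f g -> exists G, is_fourier2 g G.
Proof.
move=> lg; pose u n := cut (itvn n) g.
have l1 n : L1f (u n) by exact: L1f_bounded_cut.
have l2 n : L2f (u n) by apply: L2f_cut => //; exact: measurable_itvn.
have lF n := (plancherel (l1 n) (l2 n)).1.
have ug := cut_cvg lg.
have [|G [lG GF]] := riesz_fischer lF.
  move=> e e0; have e2 : 0 < e / 2 by rewrite divr_gt0.
  move/cvgr0Pnorm_le : (ug) => /(_ _ e2)[N _ NP].
  exists N => m n Nm Nn.
  rewrite (@eq_nrm R _ (fourier (fun x => u m x - u n x))); last first.
    by move=> x; rewrite fourierB.
  rewrite (plancherel _ _).2; [|exact: L1fB|exact: L2fB].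
  apply: (le_trans (nrm_tri (l2 m) lg (l2 n))).
  rewrite [leRHS]splitr; apply: lerD.
    by apply: le_trans (NP m Nm); exact: ler_norm.
  by rewrite nrmBC; apply: le_trans (NP n Nn); exact: ler_norm.
by exists G; apply/is_fourier2P => //; exists u; split.
Qed.

Lemma fourier2P g : L2f g -> is_fourier2 g (fourier2 g).
Proof. by move=> lg; apply: (xgetPex _ (is_fourier2_exists lg)). Qed.

Lemma fourier2_L2f g : L2f g -> L2f (fourier2 g).
Proof. by move=> lg; have [_ [/L2P]] := fourier2P lg. Qed.

(** For [g = h] this is independence of the approximating sequence, hence uniqueness up to null
    sets. It also gives injectivity, the source of the inversion formulas below. *)
Lemma fourier2_isometry g G h H : is_fourier2 g G -> is_fourier2 h H ->
  nrm (fun x => G x - H x) = nrm (fun x => g x - h x).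
Proof.
move=> fg fh.
have lg : L2f g by apply/L2P; exact: fg.1.
have lh : L2f h by apply/L2P; exact: fh.1.
have lG : L2f G by apply/L2P; exact: fg.2.1.
have lH : L2f H by apply/L2P; exact: fh.2.1.
have [u [lu ug uG]] := (is_fourier2P lg lG).2 fg.
have [v [lv vh vH]] := (is_fourier2P lh lH).2 fh.
have lFu k := (plancherel (lu k).1 (lu k).2).1.
have lFv k := (plancherel (lv k).1 (lv k).2).1.
have diff (U V : nat -> R -> R[i]) (a b : R -> R[i]) : (forall n, L2f (U n)) ->
    (forall n, L2f (V n)) -> L2f a -> L2f b ->
    nrm (fun x => U n x - a x) @[n --> \oo] --> (0 : R) ->
    nrm (fun x => V n x - b x) @[n --> \oo] --> (0 : R) ->
    nrm (fun x => U n x - V n x) @[n --> \oo] --> nrm (fun x => a x - b x).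
  move=> lU lV la lb Ua Vb.
  apply: (@nrm_cvg (fun n x => U n x - V n x)) => [n||]; [exact: L2fB|exact: L2fB|].
  have ab : nrm (fun x => U n x - a x) + nrm (fun x => V n x - b x) @[n --> \oo] --> (0 + 0 : R).
    exact: (cvgD Ua Vb).
  rewrite addr0 in ab; apply: squeeze_cvgr (cvg_cst (0 : R)) ab.
  apply: nearW => n; rewrite nrm_ge0/=.
  rewrite (@eq_nrm R _ (fun x => (U n x - a x) - (V n x - b x))).
    by apply: nrmB; exact: L2fB.
  by move=> x; ring.
have c1 := diff _ _ _ _ (fun n => (lu n).2) (fun n => (lv n).2) lg lh ug vh.
have c2 := diff _ _ _ _ lFu lFv lG lH uG vH.
have e n : nrm (fun x => u n x - v n x) = nrm (fun x => fourier (u n) x - fourier (v n) x).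
  rewrite -(plancherel _ _).2; [|apply: L1fB; [exact: (lu n).1|exact: (lv n).1]
    |apply: L2fB; [exact: (lu n).2|exact: (lv n).2]].
  by apply: eq_nrm => x; rewrite fourierB//; [exact: (lu n).1|exact: (lv n).1].
exact: (cvg_unique _ c2 (eq_cvgn_to e c1)).
Qed.

Definition ifourier G : R -> R[i] := fun x => fourier G (- x).

Lemma cmeas_ifourier G : L1f G -> cmeas (ifourier G).
Proof. by move=> iG; apply: (cmeas_comp (cmeas_fourier iG)); exact: measurable_oppR. Qed.

Lemma L2f_ifourier G : L1f G -> L2f G -> L2f (ifourier G) /\ nrm (ifourier G) = nrm G.
Proof.
move=> iG lG; have [lF nF] := plancherel iG lG; split.
  by split; [exact: cmeas_ifourier|exact: (integ_opp lF.2)].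
by rewrite -nF /nrm -(rint_opp lF.2).
Qed.

(** Expanding the square of the distance from the transform of a truncation to [G], the adjoint
    relation and two isometries turn it into the distance from the truncation to [ifourier G], which
    tends to 0. *)
Lemma is_fourier2_ifourier G : L1f G -> L2f G -> is_fourier2 (ifourier G) G.
Proof.
move=> iG lG; have [lk nk] := L2f_ifourier iG lG.
set k := ifourier G in lk nk *.
pose u n := cut (itvn n) k.
have l1 n : L1f (u n) by exact: L1f_bounded_cut.
have l2 n : L2f (u n) by apply: L2f_cut => //; exact: measurable_itvn.
have uk := cut_cvg lk.
apply/is_fourier2P => //; exists u; split => //.
have e n : nrm (fun xi => fourier (u n) xi - G xi) = nrm (fun x => u n x - k x).
  have [lF nF] := plancherel (l1 n) (l2 n).
  apply/eqP; rewrite -(@eqrXn2 _ 2) ?nrm_ge0//; apply/eqP.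
  have ipE : ip (fourier (u n)) G = ip (u n) k by exact: fourier_parseval.
  by rewrite (nrm2B lF lG) (nrm2B (l2 n) lk) nF nk ipE.
exact: eq_cvgn_to (fun n => esym (e n)) uk.
Qed.

Lemma fourier_inversion g G : is_fourier2 g G -> L1f G ->
  {ae mu, forall x, g x = ifourier G x}.
Proof.
move=> gG iG.
have lg : L2f g by apply/L2P; exact: gG.1.
have lG : L2f G by apply/L2P; exact: gG.2.1.
have kG := is_fourier2_ifourier iG lG.
have lk := (L2f_ifourier iG lG).1.
have e := fourier2_isometry gG kG.
have : nrm (fun x => g x - ifourier G x) = 0.
  rewrite -e /nrm (@eq_rint R _ (fun=> 0)) ?rint0 ?sqrtr0// => x.
  by rewrite subrr cabs0 expr0n.
move/(nrm0_ae (L2fB lg lk)); apply: ae_imp => x /eqP; by rewrite subr_eq0 => /eqP.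
Qed.

Lemma fourier2_ifourier g G : L1f G -> L2f G -> cmeas g ->
  {ae mu, forall x, g x = ifourier G x} ->
  L2f g /\ {ae mu, forall xi, fourier2 g xi = G xi}.
Proof.
move=> iG lG cg gk; have lk := (L2f_ifourier iG lG).1.
have lg : L2f g.
  by apply: ae_eq_L2f lk => //; apply: ae_imp gk => x ->.
split => //.
have e := fourier2_isometry (fourier2P lg) (is_fourier2_ifourier iG lG).
have lg2 := fourier2_L2f lg.
have z : nrm (fun x => g x - ifourier G x) = 0.
  rewrite (@ae_eq_nrm R _ (fun=> 0)).
  - by rewrite nrm_cst0.
  - by apply: cmeasB => //; exact: lk.1.
  - exact: cmeas_cst.
  - by apply: ae_imp gk => x ->; rewrite subrr.
rewrite z in e; have := nrm0_ae (L2fB lg2 lG) e.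
by apply: ae_imp => x /eqP; rewrite subr_eq0 => /eqP.
Qed.

End Fourier2.

(** * Interpolators and their transforms *)

Section Interpolator.
Variable R : realType.
Local Notation mu := (@lebesgue_measure R).
Local Open Scope complex_scope.
Local Notation cmeas := (@cmeasurable R setT).
Variable phi : R -> R.
Hypothesis hphi : interpolator phi.

Definition symb (xi : R) : R := complex.Re (fourier (cplx phi) xi).

Let dot_real_iexpi (s y : R) : dot s%:C (Complex 0 1 * expi y) = - (s * sin y).
Proof. by rewrite -[s%:C]mulr1 dotZl dotC dotr1 cReM /= mul0r mul1r add0r mulrN. Qed.

Lemma integ_phi : integ phi. Proof. exact: interp_L1 hphi. Qed.

Lemma L1f_phi : L1f (cplx phi).
Proof.
split; first by apply: cmeas_real; exact: integ_meas integ_phi.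
by apply: eq_integ (integ_norm integ_phi) => x; rewrite /cplx cabsC.
Qed.

Lemma fourier_phiE xi : fourier (cplx phi) xi = (symb xi)%:C.
Proof.
have := interp_ge0 hphi xi; rewrite lecE => /andP[/eqP h _].
by apply: complex_ext.
Qed.

Lemma symb_ge0 xi : 0 <= symb xi.
Proof. by have := interp_ge0 hphi xi; rewrite lecE => /andP[_]. Qed.

Lemma integ_symb : integ symb.
Proof. exact: (interp_fourier_L1 hphi).1. Qed.

Lemma symb_bound xi : symb xi <= cc R * rint (fun x => `|phi x|).
Proof.
apply: le_trans (ler_norm _) _; apply: le_trans (Re_le_cabs _) _.
apply: le_trans (fourier_bound xi L1f_phi) _.
rewrite (@eq_rint R _ (fun x => `|phi x|)) ?lexx// => x; exact: cabsC.
Qed.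

Let ctr_phi xi : symb xi = cc R * ctr phi xi.
Proof.
have := dot_fourier xi 1 L1f_phi; rewrite dotr1 /symb => ->.
by congr (_ * _); apply: eq_rint => x; rewrite mul1r /dot/= mul0r addr0.
Qed.

(** The transform of an interpolator is real, and the sine transform is its imaginary part up to a
    factor. *)
Let str_phi xi : str phi xi = 0.
Proof.
have := dot_fourier xi (Complex 0 1) L1f_phi.
rewrite fourier_phiE dotri [LHS]/=.
have -> : rint (fun x => dot (cplx phi x) (Complex 0 1 * expi (x * xi))) = - str phi xi.
  rewrite /str -rintN; last exact: integ_mulsin integ_phi.
  by apply: eq_rint => x; rewrite /dot/= !mul0r !mul1r addr0 sub0r mulrN.
move/esym/eqP; rewrite mulf_eq0 oppr_eq0 gt_eqF ?cc_gt0//=; exact: eqP.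
Qed.

(** Inversion at every point, as interpolants are evaluated at the nodes. Abel summation is applied
    to the translate of [phi] by [t], continuous at 0; the weights are removed by dominated
    convergence, the transform being integrable. *)
Lemma phi_inversion t : (phi t)%:C = ifourier (fourier (cplx phi)) t.
Proof.
have iF : L1f (fourier (cplx phi)) by apply/L1P; exact: interp_fourier_L1 hphi.
have twopi : 2 * pi != 0 :> R by rewrite gt_eqF// mulr_gt0// pi_gt0.
have c0 : cc R != 0 by rewrite gt_eqF// cc_gt0.
have key : cc R * rint (fun xi => symb xi * cos (xi * t)) = phi t.
  pose r x := phi (x + t).
  have ir : integ r := integ_shift t integ_phi.
  have cr : {for 0, continuous r}.
    have c : x + t @[x --> (0 : R)] --> 0 + t by apply: cvgD; [exact: cvg_id|exact: cvg_cst].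
    have := cvg_comp _ _ c (@interp_continuous _ _ hphi (0 + t)); exact.
  have ab := abel_summation ir cr.
  have rE xi : rint (fun x => r x * cos (x * xi)) = cos (xi * t) * ((cc R)^-1 * symb xi).
    pose h s := phi s * cos ((s - t) * xi).
    have ih : integ h.
      apply: (integMb (M := 1)); [exact: integ_phi| |by move=> x; exact: normr_cos_le1].
      apply: (measurableT_comp (@measurable_cosR R)).
      by apply: measurable_funM => //; exact: measurable_funD.
    transitivity (rint h).
      rewrite -(rint_shift t ih).
      by apply: eq_rint => x; rewrite /h /r addrK.
    (* The vanishing sine transform is inserted as the second term of the addition formula for
       cos((s - t) xi). *)
    rewrite ctr_phi mulKf// -[RHS]addr0 -(mulr0 (sin (xi * t))) -(str_phi xi).
    rewrite /ctr /str -!rintZ; [|exact: integ_mulsin integ_phi|exact: integ_mulcos integ_phi].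
    rewrite -rintD; [|by apply: integZ; exact: integ_mulcos integ_phi
      |by apply: integZ; exact: integ_mulsin integ_phi].
    by apply: eq_rint => s; rewrite /h mulrBl cosB (mulrC t); ring.
  have i2 : integ (fun xi => cos (xi * t) * ((cc R)^-1 * symb xi)).
    have := integMb (M := 1) (integZ (cc R)^-1 integ_symb) (@measurable_cosMr R t) (fun x => normr_cos_le1 _).
    by apply: eq_integ => x; rewrite mulrC.
  have bnd n x : `|abelw n.+1%:R^-1 x * (cos (x * t) * ((cc R)^-1 * symb x))| <= (cc R)^-1 * symb x.
    have s0 : 0 <= (cc R)^-1 * symb x by rewrite mulr_ge0 ?symb_ge0// invr_ge0 ltW// cc_gt0.
    rewrite normrM (ger0_norm (abelw_ge0 _ _)) -[leRHS]mul1r.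
    apply: ler_pM => //; first exact: abelw_ge0.
      by rewrite /abelw -expR0 ler_expR mulNr oppr_le0 mulr_ge0// invr_ge0.
    by rewrite normrM (ger0_norm s0) -[leRHS]mul1r; apply: ler_wpM2r => //; exact: normr_cos_le1.
  have pw : {ae mu, forall x, abelw n.+1%:R^-1 x * (cos (x * t) * ((cc R)^-1 * symb x))
      @[n --> \oo] --> cos (x * t) * ((cc R)^-1 * symb x)}.
    apply: ae_all => x; rewrite -[X in _ --> X]mul1r; apply: cvgM; last exact: cvg_cst.
    exact: abelw_cvg.
  have cv2 : rint (fun xi => abelw n.+1%:R^-1 xi * (cos (xi * t) * ((cc R)^-1 * symb xi)))
     @[n --> \oo] --> rint (fun xi => cos (xi * t) * ((cc R)^-1 * symb xi)).
    apply: (proj2 (@rint_dct R (fun n xi => abelw n.+1%:R^-1 xi * (cos (xi * t) * ((cc R)^-1 * symb xi)))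
      (fun xi => cos (xi * t) * ((cc R)^-1 * symb xi)) (fun xi => (cc R)^-1 * symb xi) _
      (integ_meas i2) (integZ _ integ_symb) bnd pw)).
    by move=> n; apply: measurable_funM; [exact: measurable_abelw|exact: integ_meas i2].
  have cv3 : rint (fun xi => abelw n.+1%:R^-1 xi * (cos (xi * t) * ((cc R)^-1 * symb xi)))
     @[n --> \oo] --> 2 * pi * r 0.
    by apply: eq_cvgn_to ab => n; apply: eq_rint => xi; rewrite rE.
  have := cvg_unique (@Rhausdorff R) cv2 cv3; rewrite /r add0r => e.
  have e2 : (cc R)^-1 * rint (fun xi => symb xi * cos (xi * t)) = 2 * pi * phi t.
    rewrite -e; apply: (etrans (esym (rintZ (cc R)^-1 (integ_mulcos t integ_symb)))).
    by apply: eq_rint => x; ring.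
  have -> : phi t = cc R ^+ 2 * (2 * pi * phi t) by rewrite cc_sqr mulrA mulVf// mul1r.
  by rewrite -e2 expr2 -mulrA mulVKf.
(* The symbol is even, being a multiple of a cosine transform. *)
have odd : rint (fun xi => symb xi * sin (xi * t)) = 0.
  apply: rint_odd; first exact: integ_mulsin integ_symb.
  by move=> x; rewrite !ctr_phi ctr_opp mulNr sinN mulrN.
have dF z := dot_fourier (- t) z iF.
apply: complex_ext.
  have := dF 1; rewrite dotr1 /ifourier => ->.
  rewrite -[LHS]key; congr (_ * _); apply: eq_rint => x.
  by rewrite fourier_phiE mul1r; move: (symb x) => s; rewrite /dot/= mul0r addr0 mulrN cosN.
have := dF (Complex 0 1); rewrite dotri /ifourier => ->.
have e0 : 0 = cc R * rint (fun xi => symb xi * sin (xi * t)) by rewrite odd mulr0.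
apply: (etrans e0); congr (_ * _); apply: eq_rint => x.
by rewrite fourier_phiE dot_real_iexpi mulrN sinN mulrN opprK.
Qed.

End Interpolator.

(** * The amalgam norm on the Fourier side *)

Section ZSums.
Variable R : realType.
Implicit Types (u : int -> R).

Definition zseq (N : nat) : seq int := [seq k%:Z - N%:Z | k <- iota 0 N.*2.+1].

Lemma zpsumE (V : nmodType) (u : int -> V) N : zpsum u N = \sum_(n <- zseq N) u n.
Proof.
rewrite /zpsum big_map -(big_mkord xpredT (fun k : nat => u (k%:Z - N%:Z))).
by rewrite /index_iota subn0.
Qed.

Lemma zseq_uniq N : uniq (zseq N).
Proof. by rewrite map_inj_uniq ?iota_uniq// => i j /addIr[]. Qed.

Lemma mem_zseq N n : (n \in zseq N) = (`|n|%N <= N)%N.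
Proof.
apply/mapP/idP => [[k + ->]|nN].
  by rewrite mem_iota add0n ltnS => kN; lia.
exists `|(n + N%:Z)%R|%N; last by lia.
by rewrite mem_iota add0n; lia.
Qed.

Lemma zpsum_trunc (V : nmodType) (u : int -> V) N M : (N <= M)%N ->
  zpsum (fun n => if (`|n|%N <= N)%N then u n else 0) M = zpsum u N.
Proof.
move=> NM; rewrite !zpsumE -big_mkcond -big_filter; apply: perm_big.
apply: uniq_perm; rewrite ?filter_uniq ?zseq_uniq// => n.
by rewrite mem_filter !mem_zseq; case: leqP => //= h; rewrite (leq_trans h NM).
Qed.

Lemma zpsumD (V : nmodType) (u v : int -> V) N :
  zpsum (fun n => u n + v n) N = zpsum u N + zpsum v N.
Proof. exact: big_split. Qed.

Lemma zpsumB (V : zmodType) (u v : int -> V) N :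
  zpsum (fun n => u n - v n) N = zpsum u N - zpsum v N.
Proof. exact: sumrB. Qed.

Lemma zpsumZ (K : pzRingType) (c : K) (u : int -> K) N : zpsum (fun n => c * u n) N = c * zpsum u N.
Proof. by rewrite /zpsum mulr_sumr. Qed.

Lemma zpsum_tail (V : zmodType) (u : int -> V) N M : (N <= M)%N ->
  zpsum u M - zpsum u N = zpsum (fun n => if (`|n|%N <= N)%N then 0 else u n) M.
Proof.
move=> NM; rewrite -(zpsum_trunc u NM) -zpsumB; apply: eq_bigr => k _.
by case: ifP; rewrite ?subrr ?subr0.
Qed.

Lemma eq_zpsum (V : nmodType) (u v : int -> V) N : (forall n, u n = v n) -> zpsum u N = zpsum v N.
Proof. by move=> /funext ->. Qed.

Lemma le_zpsum u v N : (forall n, u n <= v n) -> zpsum u N <= zpsum v N.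
Proof. by move=> uv; apply: ler_sum. Qed.

Lemma zpsum_ge0 u N : (forall n, 0 <= u n) -> 0 <= zpsum u N.
Proof. by move=> u0; apply: sumr_ge0. Qed.

Lemma zpsum_nd u N M : (forall n, 0 <= u n) -> (N <= M)%N -> zpsum u N <= zpsum u M.
Proof.
move=> u0 NM; rewrite -subr_ge0 zpsum_tail//; apply: zpsum_ge0 => n.
by case: ifP.
Qed.

Lemma zpsum_EFin u N : zpsum (fun n => (u n)%:E) N = (zpsum u N)%:E.
Proof. by rewrite /zpsum sumEFin. Qed.

(** Every finite set of integers lies in a symmetric block, so for nonnegative terms the unordered
    sum is the supremum of the symmetric partial sums. *)
Lemma esum_leP (a : int -> \bar R) (B : \bar R) : (forall n, 0 <= a n)%E ->
  (\esum_(n in [set: int]) a n <= B)%E <-> (forall N, (zpsum a N <= B)%E).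
Proof.
move=> a0; split=> [h N|h].
  apply: le_trans h; rewrite zpsumE fsbig_seq ?zseq_uniq//.
  apply: esum_ge; exists [set` zseq N] => //.
  by split => //; exact: finite_seq.
apply: ge_ereal_sup => _ [/= X [fX _]] <-.
have [N NP] : exists N : nat, forall n, X n -> (`|n|%N <= N)%N.
  case/finite_seqP : fX => s ->; elim: s => [|n s [N NP]]; first by exists 0%N.
  exists (maxn `|n|%N N) => m /=; rewrite inE => /orP[/eqP ->|ms].
    by rewrite leq_maxl.
  by rewrite leq_max NP// orbT.
apply: le_trans (h N); rewrite zpsumE [leRHS]fsbig_seq ?zseq_uniq//.
have fs : finite_set [set` zseq N] by exact: finite_seq.
apply: (lee_fsum_nneg_subset fX fs) => [|n _]; last exact: a0.
by move=> n; rewrite inE => /NP nN; rewrite inE/= mem_zseq.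
Qed.

Lemma esum_le_zpsum u (B : R) : (forall n, 0 <= u n) ->
  (\esum_(n in [set: int]) (u n)%:E <= B%:E)%E <-> (forall N, zpsum u N <= B).
Proof.
move=> u0; rewrite esum_leP//; split=> h N; have := h N;
  by rewrite zpsum_EFin lee_fin.
Qed.

Lemma zpsum_le_esum (a : int -> \bar R) N : (forall n, 0 <= a n)%E ->
  (zpsum a N <= \esum_(n in [set: int]) a n)%E.
Proof. by move=> a0; apply: (esum_leP _ a0).1. Qed.

Lemma esum_le1 (a : int -> \bar R) n : (forall n, 0 <= a n)%E ->
  (a n <= \esum_(n in [set: int]) a n)%E.
Proof.
move=> a0; apply: le_trans (zpsum_le_esum `|n|%N a0).
have nz : n \in zseq `|n|%N by rewrite mem_zseq.
by rewrite zpsumE (big_rem _ nz)/= leeDl// sume_ge0.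
Qed.

Lemma zpsum_cvg u : (forall n, 0 <= u n) -> (\esum_(n in [set: int]) (u n)%:E < +oo)%E ->
  zpsum u N @[N --> \oo] --> fine (\esum_(n in [set: int]) (u n)%:E).
Proof.
move=> u0 uoo.
have fe : \esum_(n in [set: int]) (u n)%:E \is a fin_num.
  by rewrite ge0_fin_numE// esum_ge0// => n _; rewrite lee_fin.
set B := fine _; have eB : (\esum_(n in [set: int]) (u n)%:E = B%:E)%E by rewrite /B fineK.
have nd : nondecreasing_seq (zpsum u) by move=> m n; exact: zpsum_nd.
have ub N : zpsum u N <= B by apply: (esum_le_zpsum B u0).1; rewrite eB.
have ub' : has_ubound (range (zpsum u)) by exists B => _ [N _ <-].
have cv := nondecreasing_cvgn nd ub'.
suff -> : B = sup (range (zpsum u)) by [].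
apply/eqP; rewrite eq_le; apply/andP; split.
  rewrite -lee_fin -eB; apply/(esum_le_zpsum _ u0) => N.
  by apply: (ub_le_sup ub'); exists N.
by apply: ge_sup => [|_ [N _ <-]//]; exists (zpsum u 0%N), 0%N.
Qed.

Lemma zpsum_tail_small u : (forall n, 0 <= u n) -> (\esum_(n in [set: int]) (u n)%:E < +oo)%E ->
  forall e, 0 < e -> exists N, forall M, (N <= M)%N -> zpsum u M - zpsum u N <= e.
Proof.
move=> u0 uoo e e0; have cv := zpsum_cvg u0 uoo; set B := fine _ in cv.
move/cvgrPdist_le : (cv) => /(_ _ e0)[N _ NP]; exists N => M NM.
have uB K : zpsum u K <= B.
  rewrite -(cvg_lim _ cv)//; apply: nondecreasing_cvgn_le; last exact: cvgP cv.
  by move=> m n; exact: zpsum_nd.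
have := NP N (leqnn N); rewrite ger0_norm ?subr_ge0//.
by apply: le_trans; rewrite lerD2r.
Qed.

End ZSums.

(** * Frequency blocks and the amalgam norm *)

Section Amalgam.
Variable R : realType.
Local Notation mu := (@lebesgue_measure R).
Local Open Scope complex_scope.
Local Notation cmeas := (@cmeasurable R setT).
Implicit Types (u v G H : R -> R[i]) (m k : int).

Lemma L2norm_top D u : measurable D -> cmeas u -> (L2norm D u < +oo)%E -> L2f (cut D u).
Proof.
by move=> mD cu; rewrite L2norm_cut => h; apply: L2norm_lty h; exact: cmeas_cut.
Qed.

Lemma L2norm_fine D u : measurable D -> cmeas u -> (L2norm D u < +oo)%E ->
  L2norm D u = (nrm (cut D u))%:E.
Proof. by move=> mD cu h; rewrite L2norm_cut L2norm_nrm//; exact: L2norm_top. Qed.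

Lemma L2normD D u v : measurable D -> cmeas u -> cmeas v ->
  (L2norm D (fun x => u x + v x)%R <= L2norm D u + L2norm D v)%E.
Proof.
move=> mD cu cv.
have [->|uoo] := eqVneq (L2norm D u) +oo%E.
  by rewrite addye ?leey// gt_eqF// (lt_le_trans _ (L2norm_ge0 _ _))// ltNy0.
have [->|voo] := eqVneq (L2norm D v) +oo%E.
  by rewrite addey ?leey// gt_eqF// (lt_le_trans _ (L2norm_ge0 _ _))// ltNy0.
rewrite -ltey in uoo; rewrite -ltey in voo.
have lu := L2norm_top mD cu uoo; have lv := L2norm_top mD cv voo.
rewrite (L2norm_fine mD cu uoo) (L2norm_fine mD cv voo) L2norm_cut.
rewrite (_ : cut D _ = (fun x => cut D u x + cut D v x)); last first.
  by apply/funext => x; rewrite /cut mulrDl.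
rewrite L2norm_nrm; last exact: L2fD.
by rewrite -EFinD lee_fin; exact: nrmD.
Qed.

Lemma L2normN D u : L2norm D (fun x => - u x) = L2norm D u.
Proof. by rewrite /L2norm; apply: eq_Lnorm => x; rewrite cabsN. Qed.

Lemma L2normBC D u v : L2norm D (fun x => u x - v x) = L2norm D (fun x => v x - u x).
Proof. by rewrite /L2norm; apply: eq_Lnorm => x; rewrite cabsB. Qed.

Lemma L2normZ D u (c : R[i]) : measurable D -> cmeas u ->
  (L2norm D (fun x => c * u x)%R <= (cabs c)%:E * L2norm D u)%E.
Proof.
move=> mD cu; have [c0|c0] := eqVneq (cabs c) 0.
  rewrite c0 mul0e (cabs0_eq0 c0) L2norm_cut (_ : cut D _ = (fun=> 0)); last first.
    by apply/funext => x; rewrite /cut !mul0r.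
  rewrite L2norm_nrm; last exact: L2f0.
  by rewrite nrm_cst0.
have cp : 0 < cabs c by rewrite lt_neqAle eq_sym c0 cabs_ge0.
have [->|uoo] := eqVneq (L2norm D u) +oo%E; first by rewrite gt0_muley ?leey ?lte_fin.
rewrite -ltey in uoo; have lu := L2norm_top mD cu uoo.
rewrite (L2norm_fine mD cu uoo) L2norm_cut (_ : cut D _ = (fun x => c * cut D u x)); last first.
  by apply/funext => x; rewrite /cut mulrA.
by rewrite L2norm_nrm ?nrmZ//; exact: L2fZ.
Qed.

Lemma le_L2norm D u v : measurable D -> cmeas u -> cmeas v ->
  (forall x, D x -> cabs (u x) <= cabs (v x)) -> (L2norm D u <= L2norm D v)%E.
Proof.
move=> mD cu cv uv; have [->|voo] := eqVneq (L2norm D v) +oo%E; first exact: leey.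
rewrite -ltey in voo; have lv := L2norm_top mD cv voo.
have le x : cabs (cut D u x) <= cabs (cut D v x).
  rewrite !cabs_cut indicE; case: (boolP (x \in D)) => xD; last by rewrite !mul0r.
  by rewrite !mul1r uv//; exact: set_mem.
have lu : L2f (cut D u) by apply: L2f_dom lv le; exact: cmeas_cut.
rewrite (L2norm_fine mD cv voo) L2norm_cut L2norm_nrm// lee_fin.
by apply: nrm_le => //; exact: cmeas_cut.
Qed.

Lemma L2norm_le_setT D u : measurable D -> cmeas u -> (L2norm D u <= L2norm setT u)%E.
Proof.
move=> mD cu; have [->|voo] := eqVneq (L2norm setT u) +oo%E; first exact: leey.
rewrite -ltey in voo; have lv := L2norm_lty cu voo.
rewrite L2norm_cut L2norm_nrm ?L2norm_nrm//; last exact: L2f_cut.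
by rewrite lee_fin; apply: nrm_le => //; [exact: cmeas_cut|exact: cabs_cut_le].
Qed.

Definition tpi m : R := 2 * pi * m%:~R.
(** Closed blocks: neighbours share an endpoint, so disjointness holds only almost everywhere. *)
Definition blk m : set R := [set x | @base R (x - tpi m)].
Definition sh m G : R -> R[i] := fun x => G (x + tpi m).
Definition Bn m G : \bar R := L2norm (blk m) G.
(** The amalgam norm moved to the Fourier side, where it makes sense for every function, so that
    limits and series are formed before any inverse transform is taken. *)
Definition AM G : \bar R := (\esum_(m in [set: int]) Bn m G)%E.

Lemma tpiD m k : tpi (m + k) = tpi m + tpi k.
Proof. by rewrite /tpi intrD mulrDr. Qed.
Lemma tpiN m : tpi (- m) = - tpi m.
Proof. by rewrite /tpi mulrNz mulrN. Qed.
Lemma tpi0 : tpi 0 = 0. Proof. by rewrite /tpi mulr0. Qed.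

Lemma blkP m x : blk m x <-> `|x - tpi m| <= pi.
Proof. by rewrite /blk/base/= in_itv/= ler_norml. Qed.

Lemma measurable_blk m : measurable (blk m).
Proof.
rewrite (_ : blk m = `[tpi m - pi, tpi m + pi]%classic); first exact: measurable_itv.
apply/seteqP; split => x /=; rewrite /blk/base/= !in_itv/= => /andP[? ?];
  apply/andP; split; lra.
Qed.

Lemma measurable_base : measurable (@base R).
Proof. exact: measurable_itv. Qed.

Lemma blk0 : blk 0 = @base R.
Proof. by apply/seteqP; split => x; rewrite /blk/= tpi0 subr0. Qed.

Lemma cmeas_sh m G : cmeas G -> cmeas (sh m G).
Proof. by move=> cG; exact: (cmeas_comp cG (measurable_shift _)). Qed.

Lemma L2norm_base_sh m G : cmeas G -> L2norm (@base R) (sh m G) = Bn m G.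
Proof.
move=> cG; rewrite /Bn (L2norm_cut (@base R)) (L2norm_cut (blk m)) !L2normTE; congr poweR.
have cc := cmeas_cut (@measurable_blk m) cG.
rewrite -(ge0_integral_shift (tpi m) (h := fun x => (cabs (cut (blk m) G x) ^+ 2)%:E)).
- apply: eq_integral => x _; congr (_%:E); congr (_ ^+ 2).
  rewrite !cabs_cut /sh; congr (_ * _); rewrite !indicE; congr ((_ : bool)%:R).
  by apply/idP/idP; rewrite !inE /blk/= addrK.
- by apply: meas_EFin; exact: measurable_cabs2.
- by move=> x; rewrite lee_fin sqr_ge0.
Qed.

Lemma Bn_ge0 m G : (0 <= Bn m G)%E. Proof. exact: L2norm_ge0. Qed.

Lemma Bn_sh m k G : cmeas G -> Bn m (sh k G) = Bn (m + k) G.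
Proof.
move=> cG; rewrite -!L2norm_base_sh//; last exact: cmeas_sh.
by congr L2norm; apply/funext => x; rewrite /sh -addrA -tpiD.
Qed.

(** A shift by 2 pi k permutes the blocks. Hence the modulations in [J_alpha f] leave the size of
    each error unchanged. *)
Lemma AM_sh k G : cmeas G -> AM (sh k G) = AM G.
Proof.
move=> cG; rewrite /AM [RHS](@reindex_esum _ _ _ [set: int] [set: int] (fun m => m + k)).
  by apply: eq_esum => m _; exact: Bn_sh.
split => //; first by move=> m n _ _ /addIr.
by move=> m _; exists (m - k) => //; rewrite subrK.
Qed.

Lemma AM_ge0 G : (0 <= AM G)%E.
Proof. by apply: esum_ge0 => m _; exact: Bn_ge0. Qed.

Lemma le_Bn_AM m G : (Bn m G <= AM G)%E.
Proof. by apply: (esum_le1 m (a := fun m => Bn m G)) => n; exact: Bn_ge0. Qed.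

Lemma AM_D G H : cmeas G -> cmeas H -> (AM (fun x => G x + H x)%R <= AM G + AM H)%E.
Proof.
move=> cG cH; rewrite /AM -esumD; [|by move=> *; exact: Bn_ge0|by move=> *; exact: Bn_ge0].
by apply: le_esum => m _; apply: L2normD => //; exact: measurable_blk.
Qed.

Lemma AM_N G : AM (fun x => - G x) = AM G.
Proof. by apply: eq_esum => m _; exact: L2normN. Qed.

Lemma AM_B G H : cmeas G -> cmeas H -> (AM (fun x => G x - H x)%R <= AM G + AM H)%E.
Proof. by move=> cG cH; rewrite -(AM_N H); apply: AM_D => //; exact: cmeasN. Qed.

Lemma AM_BC G H : AM (fun x => G x - H x)%R = AM (fun x => H x - G x).
Proof. by apply: eq_esum => m _; exact: L2normBC. Qed.

Lemma ae_eq_L2norm_in D u v : measurable D -> cmeas u -> cmeas v ->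
  {ae mu, forall x, D x -> u x = v x} -> L2norm D u = L2norm D v.
Proof.
move=> mD cu cv uv; rewrite (L2norm_cut D u) (L2norm_cut D v); apply: ae_eq_L2norm.
- exact: cmeas_cut.
- exact: cmeas_cut.
- apply: ae_imp uv => x h; have [Dx|Dx] := pselect (D x).
    by rewrite !cut_in// h.
  by rewrite !cut_out.
Qed.

Lemma ae_eq_AM G H : cmeas G -> cmeas H -> {ae mu, forall x, G x = H x} -> AM G = AM H.
Proof.
move=> cG cH GH; apply: eq_esum => m _; apply: ae_eq_L2norm_in => //.
  exact: measurable_blk.
by apply: ae_imp GH => x ->.
Qed.

Definition win N : set R := `[- ((2 * N%:R + 1) * pi), (2 * N%:R + 1) * pi]%classic.

Lemma winP N x : win N x <-> `|x| <= (2 * N%:R + 1) * pi.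
Proof. by rewrite /win/= in_itv/= ler_norml. Qed.

Lemma measurable_win N : measurable (win N). Proof. exact: measurable_itv. Qed.

Lemma win_cover N x : win N x -> exists2 m, (`|m|%N <= N)%N & blk m x.
Proof.
elim: N => [|N IH] /winP xN.
  by exists 0 => //; apply/blkP; rewrite tpi0 subr0; rewrite mulr0 add0r mul1r in xN.
have [xs|xs] := leP `|x| ((2 * N%:R + 1) * pi).
  by have [m mN bm] := IH ((winP N x).2 xs); exists m => //; exact: leqW.
rewrite -natr1 in xN; have p0 := pi_gt0 R.
have [x0|x0] := ger0P x.
  exists N.+1%:Z; rewrite ?absz_nat//; apply/blkP; rewrite /tpi -pmulrn -natr1.
  rewrite ger0_norm// in xN xs; rewrite ler_norml; apply/andP; split; lra.
exists (- N.+1%:Z); first by rewrite abszN absz_nat.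
apply/blkP; rewrite tpiN /tpi -pmulrn -natr1.
rewrite ltr0_norm// in xN xs; rewrite ler_norml; apply/andP; split; lra.
Qed.

Lemma nd_win N x : win N x -> win N.+1 x.
Proof.
move=> /winP xN; apply/winP; apply: (le_trans xN).
by apply: ler_wpM2r; [exact: pi_ge0|rewrite lerD2r ler_wpM2l// ler_nat].
Qed.

Lemma near_win x : \forall N \near \oo, win N x.
Proof.
have p0 := pi_gt0 R.
have := nbhs_infty_ger (`|x| / pi); apply: filterS => N; rewrite ler_pdivrMr// => h.
apply/winP; apply: (le_trans h); apply: ler_wpM2r; first exact: ltW.
have : 0 <= N%:R :> R by []. lra.
Qed.

(* The amalgam (L^2, l^1) is paired with (L^2, l^oo). *)
Lemma amalgam_pairing H v (c A : R) : cmeas H -> cmeas v ->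
  (forall m, (Bn m v <= c%:E)%E) -> (AM H <= A%:E)%E ->
  integ (fun x => cabs (H x) * cabs (v x)) /\
  rint (fun x => cabs (H x) * cabs (v x)) <= c * A.
Proof.
move=> cH cv vc HA.
have c0 : 0 <= c by rewrite -lee_fin; exact: le_trans (Bn_ge0 0 v) (vc 0).
have Hm m : (Bn m H < +oo)%E by rewrite (le_lt_trans (le_Bn_AM m H))// (le_lt_trans HA)// ltry.
have vm m : (Bn m v < +oo)%E by rewrite (le_lt_trans (vc m))// ltry.
have mb := measurable_blk.
have lH m := L2norm_top (mb m) cH (Hm m).
have lv m := L2norm_top (mb m) cv (vm m).
have HE m := L2norm_fine (mb m) cH (Hm m).
have vE m := L2norm_fine (mb m) cv (vm m).
pose q m x := cabs (cut (blk m) H x) * cabs (cut (blk m) v x).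
have iq m : integ (q m) by exact: integ_cabsM.
have rq m : rint (q m) <= c * nrm (cut (blk m) H).
  apply: (le_trans (cauchy_schwarz (lH m) (lv m))); rewrite mulrC.
  apply: ler_wpM2r; first exact: nrm_ge0.
  by rewrite -lee_fin -vE; exact: vc.
pose P x := cabs (H x) * cabs (v x).
have mP : measurable_fun setT P by apply: measurable_funM; exact: measurable_cabs.
have P0 x : 0 <= P x by rewrite mulr_ge0 ?cabs_ge0.
pose PN N x := P x * \1_(win N) x.
have PN0 N x : 0 <= PN N x by rewrite mulr_ge0// indicE.
(* Only an inequality, because a common endpoint of two blocks is counted twice on the right. *)
have PNle N x : PN N x <= zpsum (fun m => q m x) N.
  have q0 m y : 0 <= q m y by rewrite mulr_ge0 ?cabs_ge0.
  rewrite /PN indicE; case: (boolP (x \in win N)) => xN; last first.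
    by rewrite mulr0; apply: zpsum_ge0.
  have [m mN bm] := win_cover (set_mem xN).
  rewrite mulr1 zpsumE (big_rem m); last by rewrite mem_zseq.
  have -> : P x = q m x by rewrite /q !cut_in.
  by rewrite lerDl; apply: sumr_ge0.
have iz N : integ (fun x => zpsum (fun m => q m x) N).
  by apply: eq_integ (integ_sum (zseq N) iq) => x; rewrite zpsumE.
have iPN N : integ (PN N).
  apply: integ_dom (iz N) _.
    by apply: measurable_funM => //; apply: measurable_indicR; exact: measurable_win.
  by move=> x; rewrite ger0_norm.
have rPN N : rint (PN N) <= c * A.
  apply: (le_trans (le_rint (iPN N) (iz N) (PNle N))).
  rewrite (_ : rint _ = zpsum (fun m => rint (q m)) N); last first.
    rewrite zpsumE -(rint_sum (zseq N) iq); apply: eq_rint => x; exact: zpsumE.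
  apply: (@le_trans _ _ (zpsum (fun m => c * nrm (cut (blk m) H)) N)); first exact: le_zpsum.
  rewrite zpsumZ; apply: ler_wpM2l => //.
  rewrite -lee_fin; apply: le_trans HA; rewrite -zpsum_EFin.
  rewrite (@eq_zpsum _ _ (fun m => Bn m H)); first by apply: zpsum_le_esum => m; exact: Bn_ge0.
  by move=> m; rewrite /Bn HE.
have [|h [ih h0 hB hae]] := rint_mct iPN PN0 _ rPN.
  move=> N x; apply: ler_wpM2l => //; rewrite !indicE.
  case: (boolP (x \in win N)) => [xN|_]; last by rewrite ler0n.
  by rewrite mem_set//; apply: nd_win; exact: set_mem.
have hP : {ae mu, forall x, h x = P x}.
  apply: ae_imp hae => x hx.
  have : PN N x @[N --> \oo] --> P x.
    apply: cvg_near_cst; have := near_win x; apply: filterS => N wN.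
    by rewrite /PN indicE mem_set// mulr1.
  exact: (cvg_unique (@Rhausdorff R) hx).
split; first exact: ae_eq_integ ih.
by rewrite -(ae_eq_rint (integ_meas ih) mP hP).
Qed.

Lemma Bn_cst1 m : Bn m (fun=> 1) = ((cc R)^-1)%:E.
Proof.
have mb := measurable_blk m.
have bE : blk m = `[tpi m - pi, tpi m + pi]%classic.
  apply/seteqP; split => x /=; rewrite /blk/base/= !in_itv/= => /andP[? ?];
    apply/andP; split; lra.
rewrite /Bn L2norm_cut L2normTE.
rewrite (_ : (\int[mu]_x _)%E = (2 * pi)%:E); last first.
  transitivity (\int[mu]_x (\1_(blk m) x)%:E)%E.
    apply: eq_integral => x _; rewrite cabs_cut cabsE /= expr0n/= addr0 expr1n sqrtr1 mulr1.
    by rewrite indicE; case: (_ \in _); rewrite ?expr1n ?expr0n.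
  rewrite integral_indic// setIT.
  transitivity (mu (`[tpi m - pi, tpi m + pi]%classic : set R)); first by rewrite bE.
  rewrite lebesgue_measure_itv/= lte_fin.
  rewrite ifT; last by have := pi_gt0 R; lra.
  by rewrite -EFinB; congr EFin; lra.
rewrite poweR_EFin powR12_sqrt ?mulr_ge0 ?pi_ge0//.
by rewrite /cc invrK.
Qed.

(** Pairing with the constant 1, whose norm on each block is sqrt(2 pi). This cancels the
    normalisation [cc], so the amalgam norm bounds the inverse transform uniformly with constant
    1. *)
Lemma AM_L1 H (A : R) : cmeas H -> (AM H <= A%:E)%E ->
  L1f H /\ cc R * rint (fun x => cabs (H x)) <= A.
Proof.
move=> cH HA; have [|i r] := @amalgam_pairing H (fun=> 1) (cc R)^-1 A cH (cmeas_cst _) _ HA.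
  by move=> m; rewrite Bn_cst1.
have c1 : cabs 1 = 1 :> R by rewrite cabsE /= expr0n addr0 expr1n sqrtr1.
split.
  by split => //; apply: eq_integ i => x; rewrite c1 mulr1.
rewrite (@eq_rint R _ (fun x => cabs (H x) * cabs 1)); last by move=> x; rewrite c1 mulr1.
by rewrite -ler_pdivlMl ?cc_gt0.
Qed.

(** Pairing of [H] with itself: the largest block norm is at most their sum. *)
Lemma AM_L2 H (A : R) : cmeas H -> (AM H <= A%:E)%E -> L2f H /\ nrm H <= A.
Proof.
move=> cH HA; have [|i r] := @amalgam_pairing H H A A cH cH _ HA.
  by move=> m; apply: le_trans (le_Bn_AM m H) HA.
have lH : L2f H by split => //; apply: eq_integ i => x; rewrite expr2.
split => //; have A0 : 0 <= A by rewrite -lee_fin (le_trans _ HA)// AM_ge0.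
rewrite -(@ler_pXn2r _ 2) ?nnegrE ?nrm_ge0// nrm2 expr2.
by rewrite (@eq_rint R _ (fun x => cabs (H x) * cabs (H x))).
Qed.

(** The amalgam norm dominates the L^2 norm, so an L^2 limit exists. Convergence in the stronger
    norm is checked on finitely many blocks at a time, against a late term [F M] whose index may
    depend on these blocks. *)
Lemma AM_complete (F : nat -> R -> R[i]) : (forall n, cmeas (F n)) ->
  (forall n, (AM (F n) < +oo)%E) ->
  (forall e, 0 < e -> exists N, forall i j, (N <= i)%N -> (N <= j)%N ->
     (AM (fun x => F i x - F j x)%R <= e%:E)%E) ->
  exists G, cmeas G /\
   (forall e, 0 < e -> exists N, forall n, (N <= n)%N -> (AM (fun x => F n x - G x)%R <= e%:E)%E).
Proof.
move=> cF Foo cauchy.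
have lF n : L2f (F n).
  have fn : AM (F n) = (fine (AM (F n)))%:E.
    by rewrite fineK// ge0_fin_numE ?AM_ge0.
  by apply: (@AM_L2 _ (fine (AM (F n))) (cF n) _).1; rewrite -fn.
have [|G [lG GF]] := riesz_fischer lF.
  move=> e e0; have [N NP] := cauchy e e0; exists N => i j Ni Nj.
  by apply: (@AM_L2 _ e _ (NP i j Ni Nj)).2; exact: cmeasB.
exists G; split; first exact: lG.1.
move=> e e0; have e2 : 0 < e / 2 by rewrite divr_gt0.
have [N NP] := cauchy _ e2; exists N => n Nn.
apply/esum_leP => [m|K]; first exact: Bn_ge0.
(* More than the number of blocks in the partial sum; an L^2 distance e / 2 / c then costs at most e
   / 2 in total. *)
pose c : R := (size (zseq K))%:R + 1.
have c0 : 0 < c by rewrite ltr_wpDl.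
have ec : 0 < e / 2 / c by rewrite !divr_gt0.
move/cvgr0Pnorm_le : (GF) => /(_ _ ec)[N' _ N'P].
pose M := maxn N N'.
have NM : (N <= M)%N by rewrite leq_maxl.
have N'M : (N' <= M)%N by rewrite leq_maxr.
have step m : (Bn m (fun x => F n x - G x)%R <= Bn m (fun x => F n x - F M x)%R + (e / 2 / c)%:E)%E.
  have -> : (fun x => F n x - G x)%R = (fun x => (F n x - F M x) + (F M x - G x)).
    by apply/funext => x; rewrite addrA subrK.
  apply: (le_trans (L2normD (@measurable_blk m) (cmeasB (cF n) (cF M)) (cmeasB (cF M) lG.1))).
  apply: leeD2l; apply: (le_trans (L2norm_le_setT (@measurable_blk m) (cmeasB (cF M) lG.1))).
  rewrite L2norm_nrm ?lee_fin; last exact: L2fB.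
  exact: le_trans (ler_norm _) (N'P M N'M).
apply: (@le_trans _ _ (zpsum (fun m => Bn m (fun x => F n x - F M x)%R + (e / 2 / c)%:E)%E K)).
  by rewrite !zpsumE; apply: lee_sum.
rewrite zpsumD; apply: (@le_trans _ _ ((e / 2)%:E + (e / 2)%:E)%E); last first.
  by rewrite -EFinD -splitr.
apply: leeD.
  by apply: le_trans (NP n M Nn NM); apply: zpsum_le_esum => m; exact: Bn_ge0.
rewrite zpsum_EFin lee_fin zpsumE big_const_seq count_predT iter_addr_0 -[_ *+ _]mulr_natr.
rewrite -[leRHS](divfK (_ : c != 0)) ?gt_eqF//; apply: ler_wpM2l; first exact: ltW.
by rewrite lerDl.
Qed.

End Amalgam.

(** * Combinations of exponentials and the error of interpolation *)

Section Combos.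
Variable R : realType.
Local Notation mu := (@lebesgue_measure R).
Local Open Scope complex_scope.
Local Notation cmeas := (@cmeasurable R setT).
Implicit Types (u v G H : R -> R[i]) (j k : int) (c : int -> R[i]).

Lemma limn_complex (s : nat -> R[i]) (l : R[i]) :
  (forall e, 0 < e -> exists N, forall n, (N <= n)%N -> cabs (s n - l) <= e) ->
  limn (s : nat -> R[i]^o) = l.
Proof.
move=> h; apply: cvg_lim; first exact: norm_hausdorff.
apply/cvgrPdist_le => e e0.
have e0R : 0 < complex.Re e /\ e = (complex.Re e)%:C.
  by move: e0; rewrite ltcE => /andP[/eqP/= e1 e2]; split => //; apply: complex_ext.
have [N NP] := h _ e0R.1; exists N => // n /= Nn.
by rewrite e0R.2 normr_cabs lecR cabsB; exact: NP.
Qed.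

Lemma fourier_cst0 (xi : R) : fourier (fun=> 0) xi = 0 :> R[i].
Proof.
have L0 : L1f (fun=> 0 : R[i]).
  split; first exact: cmeas_cst.
  by apply: eq_integ (@integ0 R) => y; rewrite cabs0.
have e : (fun=> 0) = (fun _ : R => 0 * 0 : R[i]) by apply/funext => y; rewrite mul0r.
rewrite {1}e; exact: (etrans (@fourierZ R (fun=> 0) xi 0 L0) (mul0r _)).
Qed.

Lemma fourier_sum (I : Type) (s : seq I) (F : I -> R -> R[i]) (xi : R) :
  (forall i, L1f (F i)) ->
  L1f (fun y => \sum_(i <- s) F i y) /\
  fourier (fun y => \sum_(i <- s) F i y) xi = \sum_(i <- s) fourier (F i) xi.
Proof.
move=> iF; elim: s => [|i s [L E]].
  have e : (fun y => \sum_(i <- [::]) F i y) = (fun=> 0) by apply/funext => y; rewrite big_nil.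
  rewrite e fourier_cst0 big_nil; split => //.
  split; first exact: cmeas_cst.
  by apply: eq_integ (@integ0 R) => y; rewrite cabs0.
have e : (fun y => \sum_(i <- i :: s) F i y) = (fun y => F i y + \sum_(i <- s) F i y).
  by apply/funext => y; rewrite big_cons.
by rewrite e big_cons fourierD// E; split => //; exact: L1fD.
Qed.

Lemma fourier_mod u (s xi : R) : fourier (fun y => u y * expi (- (s * y))) xi = fourier u (xi + s).
Proof.
congr (_ * _); congr cintegral; apply/funext => y.
by rewrite -mulrA -expiD; congr (_ * expi _); ring.
Qed.

(** Where the functions differ, the squared distance stays positive on an open interval, which is
    not negligible. *)
Lemma continuous_ae_eq u v : continuous (u : R -> R[i]^o) -> continuous (v : R -> R[i]^o) ->
  {ae mu, forall y, u y = v y} -> forall y, u y = v y.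
Proof.
move=> cu cv ae y; apply/eqP; apply: contrapT => /negP neq.
have cd : continuous (fun z => complex.Re (u z - v z) ^+ 2 + complex.Im (u z - v z) ^+ 2).
  have [cuR cuI] := ccontinuous_Re cu; have [cvR cvI] := ccontinuous_Re cv.
  move=> z; apply: cvgD; rewrite !expr2.
    under eq_cvg => w do rewrite expr2 !cE.
    rewrite !cE; apply: cvgM; apply: cvgB; solve [exact: cuR|exact: cvR].
  under eq_cvg => w do rewrite expr2 !cE.
  rewrite !cE; apply: cvgM; apply: cvgB; solve [exact: cuI|exact: cvI].
have dy : 0 < complex.Re (u y - v y) ^+ 2 + complex.Im (u y - v y) ^+ 2.
  rewrite -cabs_sqr exprn_gt0// lt_neqAle cabs_ge0 andbT eq_sym.
  by apply/eqP => /cabs0_eq0/eqP; rewrite subr_eq0 (negbTE neq).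
have := @cvgr_gt _ _ _ _ _ _ (cd y) _ dy.
case=> e /= e0 He.
case: ae => N [mN N0 sub].
have : (mu (`](y - e)%R, (y + e)%R[%classic : set R) <= mu N)%E.
  apply: le_measure; rewrite ?inE//.
  move=> z; rewrite /= in_itv/= => /andP[z1 z2]; apply: sub => /= uv.
  have : ball_ [eta @Num.norm R R] y e z by rewrite /ball_/= ltr_norml; apply/andP; split; lra.
  by move/He => /=; rewrite uv subrr /= expr0n/= addr0 ltxx.
rewrite N0 lebesgue_measure_itv/= lte_fin ifT; last by lra.
by rewrite -EFinB lee_fin; lra.
Qed.

Lemma ae_neq (a : R) : {ae mu, forall y, y <> a}.
Proof.
exists [set a]; split; [exact: measurable_set1|exact: lebesgue_measure_set1|].
by move=> y /= /contrapT.
Qed.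

(** The centres are at least 2 pi apart and the half-lengths are pi, so only the midpoint can be
    common. *)
Lemma blk_meet j k (y : R) : blk j y -> blk k y -> j != k -> y = (tpi R j + tpi R k) / 2.
Proof.
move=> /blkP yj /blkP yk jk; have p0 := pi_gt0 R.
have h : 2 * pi <= `|tpi R j - tpi R k|.
  rewrite /tpi -mulrBr normrM (ger0_norm (_ : 0 <= 2 * pi)); last by rewrite mulr_ge0// pi_ge0.
  rewrite -[leLHS]mulr1 ler_pM2l ?mulr_gt0// -rmorphB/= -intr_norm -[1]/(1%:~R) ler_int.
  by rewrite -gtz0_ge1 normr_gt0 subr_eq0.
move: yj yk h; rewrite !ler_norml => /andP[a1 a2] /andP[b1 b2].
by rewrite ler_normr => /orP[]; lra.
Qed.

Lemma Bn_cut_out j k u : cmeas u -> j != k -> Bn j (cut (blk k) u) = 0%E.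
Proof.
move=> cu jk.
have mb i : measurable (@blk R i) by exact: measurable_blk.
have -> : (0 = L2norm (@blk R j) (fun=> 0%R))%E.
  rewrite L2norm_cut (_ : cut _ _ = (fun=> 0)); last by apply/funext => y; rewrite /cut mul0r.
  rewrite L2norm_nrm; last exact: L2f0.
  by rewrite nrm_cst0.
apply: (ae_eq_L2norm_in (mb j)); [exact: cmeas_cut|exact: (cmeas_cst 0)|].
apply: ae_imp (ae_neq ((tpi R j + tpi R k) / 2)) => y ny yj.
by rewrite cut_out// => yk; apply: ny; exact: blk_meet yj yk jk.
Qed.

Lemma Bn_cut_in j u : cmeas u -> Bn j (cut (blk j) u) = Bn j u.
Proof.
move=> cu; rewrite /Bn L2norm_cut [RHS]L2norm_cut; congr L2norm; apply/funext => y.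
by rewrite /cut -mulrA -rmorphM/= indicE; case: (y \in _); rewrite /= ?mulr1 ?mulr0.
Qed.

Lemma esum_point (a : int -> \bar R) k : (forall j, (0 <= a j)%E) -> (forall j, j != k -> a j = 0%E) ->
  (\esum_(j in [set: int]) a j = a k)%E.
Proof.
move=> a0 ak; rewrite -(@esum_set1 _ _ k a)//.
rewrite [RHS]esum_mkcond; apply: eq_esum => j _.
have [->|jk] := eqVneq j k; first by rewrite ifT// inE.
by rewrite ifF ?ak//; apply/negbTE; rewrite notin_setE /=; exact/eqP.
Qed.

Lemma AM_cut k u : cmeas u -> AM (cut (blk k) u) = Bn k u.
Proof.
move=> cu; rewrite /AM (@esum_point _ k) ?Bn_cut_in// => j; first exact: Bn_ge0.
exact: Bn_cut_out.
Qed.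

Lemma L2f_cut_bounded u (B : R) : cmeas u -> (forall y, cabs (u y) <= B) -> L2f (cut (@base R) u).
Proof.
move=> cu uB; split; first by apply: cmeas_cut => //; exact: measurable_base.
apply: (@integ_dom R _ (fun y => B ^+ 2 * \1_(@base R) y)).
- by apply: measurable_cabs2; apply: cmeas_cut => //; exact: measurable_base.
- by apply: integZ; exact: integ_itv.
move=> y; rewrite ger0_norm ?sqr_ge0// cabs_cut exprMn.
rewrite indicE; case: (y \in _); rewrite /= ?expr0n/= ?mul0r ?mulr0// expr1n mul1r mulr1.
by rewrite ler_pXn2r ?nnegrE ?cabs_ge0// (le_trans _ (uB y)) ?cabs_ge0.
Qed.

Lemma L2norm_baseE u (B : R) : cmeas u -> (forall y, cabs (u y) <= B) ->
  L2norm (@base R) u = (nrm (cut (@base R) u))%:E.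
Proof. by move=> cu uB; rewrite L2norm_cut L2norm_nrm//; exact: L2f_cut_bounded uB. Qed.

Variable x : int -> R.

Definition combo c (N : nat) (y : R) : R[i] := zpsum (fun n => c n * expi (- (x n * y))) N.

Lemma cmeas_exp (s : R) : cmeas (fun y => expi (- (s * y))).
Proof.
apply: measurable_expi; apply: measurable_oppR2.
exact: measurable_scale.
Qed.

Lemma cmeas_combo c N : cmeas (combo c N).
Proof.
rewrite (_ : combo c N = (fun y => \sum_(n <- zseq N) c n * expi (- (x n * y)))).
  by apply: cmeas_sum => n; apply: cmeasM; [exact: cmeas_cst|exact: cmeas_exp].
by apply/funext => y; rewrite /combo zpsumE.
Qed.

Lemma cabs_sum (I : Type) (s : seq I) (F : I -> R[i]) :
  cabs (\sum_(i <- s) F i) <= \sum_(i <- s) cabs (F i).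
Proof.
elim/big_ind2 : _ => //; first by rewrite cabs0.
by move=> a a' b b' ab ab'; apply: le_trans (cabsD _ _) _; exact: lerD.
Qed.

Lemma combo_bound c N y : cabs (combo c N y) <= zpsum (fun n => cabs (c n)) N.
Proof.
rewrite /combo !zpsumE; apply: le_trans (cabs_sum _ _) _.
by apply: ler_sum => n _; rewrite cabsM cabs_expi mulr1.
Qed.

Definition base_nrm u : R := nrm (cut (@base R) u).

Lemma base_nrm_ge0 u : 0 <= base_nrm u. Proof. exact: nrm_ge0. Qed.

Lemma L2norm_combo c N : L2norm (@base R) (combo c N) = (base_nrm (combo c N))%:E.
Proof. by apply: L2norm_baseE (combo_bound c N); exact: cmeas_combo. Qed.

Lemma L2f_combo c N : L2f (cut (@base R) (combo c N)).
Proof. by apply: L2f_cut_bounded (combo_bound c N); exact: cmeas_combo. Qed.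

Variables (p q : R).
Hypothesis (p0 : 0 < p) (q0 : 0 < q).
Hypothesis hr : forall c N,
  p * zpsum (fun n => cabs (c n) ^+ 2) N <= base_nrm (combo c N) ^+ 2 <= q * zpsum (fun n => cabs (c n) ^+ 2) N.

(** The comparison constant for two combinations whose coefficients have the same moduli: upper
    Riesz bound for one, lower Riesz bound for the other. *)
Definition riesz_ratio : R := Num.sqrt (q / p).

Lemma riesz_ratio_ge0 : 0 <= riesz_ratio. Proof. exact: sqrtr_ge0. Qed.

(* Translating by [2 pi j] only multiplies the coefficients by unimodular factors. *)
Lemma Bn_combo j c N : (Bn j (combo c N) <= (riesz_ratio * base_nrm (combo c N))%:E)%E.
Proof.
rewrite -(L2norm_base_sh _ (cmeas_combo c N)).
pose c' n := c n * expi (- (x n * tpi R j)).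
have -> : sh j (combo c N) = combo c' N.
  apply/funext => y; apply: eq_zpsum => n.
  by rewrite /c' -mulrA -expiD; congr (_ * expi _); ring.
rewrite L2norm_combo lee_fin -(@ler_pXn2r _ 2) ?nnegrE ?base_nrm_ge0 ?mulr_ge0 ?riesz_ratio_ge0 ?base_nrm_ge0//.
rewrite exprMn [riesz_ratio ^+ 2]sqr_sqrtr; last by rewrite divr_ge0// ltW.
have /andP[_ h1] := hr c' N; have /andP[h2 _] := hr c N.
apply: le_trans h1 _.
rewrite (@eq_zpsum _ _ (fun n => cabs (c n) ^+ 2)); last by move=> n; rewrite cabsM cabs_expi mulr1.
rewrite -mulrA ler_pM2l// mulrC ler_pdivlMr// mulrC; exact: h2.
Qed.

End Combos.

Section Off.
Variable R : realType.
Local Notation mu := (@lebesgue_measure R).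
Local Open Scope complex_scope.
Local Notation cmeas := (@cmeasurable R setT).
Implicit Types (u v G H : R -> R[i]) (j k : int).

Lemma AM_le_zpsum G (b : int -> R) (S : R) : (forall j, (Bn j G <= (b j)%:E)%E) ->
  (forall N, zpsum b N <= S) -> (AM G <= S%:E)%E.
Proof.
move=> Gb bS; apply/esum_leP => [j|N]; first exact: Bn_ge0.
apply: (@le_trans _ _ (zpsum (fun j => (b j)%:E) N)); last by rewrite zpsum_EFin lee_fin.
by rewrite !zpsumE; apply: lee_sum.
Qed.

Definition off G : R -> R[i] := cut (~` @base R) G.

Lemma cmeas_off G : cmeas G -> cmeas (off G).
Proof. by move=> cG; apply: cmeas_cut => //; apply: measurableC; exact: measurable_base. Qed.

Lemma cut_off G y : G y = cut (@base R) G y + off G y.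
Proof.
have [yb|yb] := pselect (base y).
  by rewrite cut_in// /off cut_out ?addr0//; apply.
by rewrite cut_out// /off cut_in ?add0r.
Qed.

Lemma Bn_off j G : cmeas G -> (Bn j (off G) <= if (j == 0)%R then 0 else Bn j G)%E.
Proof.
move=> cG; case: eqP => [->|_].
  rewrite /Bn blk0 L2norm_cut (_ : cut _ _ = (fun=> 0)).
    rewrite L2norm_nrm; last exact: L2f0.
    by rewrite nrm_cst0.
  apply/funext => y; have [yb|yb] := pselect (base y).
    by rewrite cut_in// /off cut_out//; apply.
  by rewrite cut_out.
apply: le_L2norm => //; [exact: measurable_blk|exact: cmeas_off|].
by move=> y _; exact: cabs_cut_le.
Qed.

Lemma AM_off_le G : cmeas G -> (AM (off G) <= AM G)%E.
Proof.
move=> cG; apply: le_esum => j _; apply: le_trans (Bn_off j cG) _.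
by case: eqP => // _; exact: Bn_ge0.
Qed.

End Off.

(** * The transform of an interpolant *)

Section Core.
Variable R : realType.
Local Notation mu := (@lebesgue_measure R).
Local Open Scope complex_scope.
Local Notation cmeas := (@cmeasurable R setT).
Implicit Types (u v g h G H : R -> R[i]) (j k n : int) (a c : int -> R[i]).
Variable x : int -> R.
Variables (p q : R).
Hypothesis (p0 : 0 < p) (q0 : 0 < q).
Hypothesis hr : forall c N,
  p * zpsum (fun n => cabs (c n) ^+ 2) N <= base_nrm (combo x c N) ^+ 2 <= q * zpsum (fun n => cabs (c n) ^+ 2) N.
Local Notation K := (riesz_ratio p q).
Local Notation cmb := (combo x).

Variable phi : R -> R.
Hypothesis hphi : interpolator phi.

Lemma symb_le_Msup j y : blk j y -> symb phi y <= Msup phi j.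
Proof.
move=> yj; apply: ub_le_sup.
  by exists (cc R * rint (fun x => `|phi x|)) => _ [z _ <-]; exact: symb_bound.
by exists (y - tpi R j) => //; rewrite /symb /tpi subrK.
Qed.

Lemma Msup_ge0 j : 0 <= Msup phi j.
Proof.
apply: le_trans (symb_ge0 hphi (tpi R j)) (symb_le_Msup _).
by apply/blkP; rewrite subrr normr0 pi_ge0.
Qed.

Lemma minf_le y : base y -> minf phi <= symb phi y.
Proof.
move=> yb; apply: ge_inf; first by exists 0 => _ [z _ <-]; exact: symb_ge0.
by exists y.
Qed.

Lemma minf_gt0 : 0 < minf phi.
Proof.
have [d d0 hd] := interp_lower hphi; apply: lt_le_trans d0 _.
apply: lb_le_inf => [|_ [z zb <-]].
  by exists (symb phi 0); exists 0 => //; rewrite -blk0; apply/blkP; rewrite tpi0 subrr normr0 pi_ge0.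
by have := hd z zb; rewrite lecE => /andP[_].
Qed.

Lemma measurable_symb : measurable_fun setT (symb phi).
Proof. exact: integ_meas (integ_symb hphi). Qed.

Lemma Msup_sum : exists2 S : R, 0 <= S & forall N, zpsum (Msup phi) N <= S.
Proof.
have [S eS] : exists S, (\esum_(j in [set: int]) (`|Msup phi j|)%:E = S%:E)%E.
  exists (fine (\esum_(j in [set: int]) (`|Msup phi j|)%:E)%E); rewrite fineK// ge0_fin_numE.
    exact: interp_M_l1 hphi.
  by apply: esum_ge0 => j _; rewrite lee_fin.
have h N : zpsum (Msup phi) N <= S.
  rewrite (@eq_zpsum _ _ (fun j => `|Msup phi j|)); last by move=> j; rewrite ger0_norm// Msup_ge0.
  by apply: (esum_le_zpsum S (fun j => normr_ge0 _)).1; rewrite eS.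
by exists S => //; apply: le_trans (h 0%N); apply: zpsum_ge0 => j; exact: Msup_ge0.
Qed.

(* The transform of the partial sum of [sum_n a_n phi(t - x_n)] over [|n| <= N]. *)
Definition interp_symbol a N (y : R) : R[i] := (symb phi y)%:C * cmb a N y.

Lemma cmeas_interp_symbol a N : cmeas (interp_symbol a N).
Proof.
by apply: cmeasM; [apply: cmeas_real; exact: measurable_symb|exact: cmeas_combo].
Qed.

Lemma Bn_interp_symbol j a N : (Bn j (interp_symbol a N) <= (K * base_nrm (cmb a N) * Msup phi j)%:E)%E.
Proof.
have cm := cmeas_combo x a N.
apply: (@le_trans _ _ (Bn j (fun y => (Msup phi j)%:C * cmb a N y))).
  apply: le_L2norm; [exact: measurable_blk|exact: cmeas_interp_symbol|exact: cmeasM (cmeas_cst _) cm|].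
  move=> y yj; rewrite !cabsM !cabsC !ger0_norm ?Msup_ge0 ?symb_ge0//.
  by apply: ler_wpM2r; [exact: cabs_ge0|exact: symb_le_Msup].
apply: le_trans (L2normZ _ (@measurable_blk R j) cm) _.
rewrite cabsC ger0_norm ?Msup_ge0// mulrC EFinM; apply: lee_wpmul2l; first by rewrite lee_fin Msup_ge0.
exact: Bn_combo.
Qed.

Lemma AM_interp_symbol a N (S : R) : (forall M, zpsum (Msup phi) M <= S) ->
  (AM (interp_symbol a N) <= (K * base_nrm (cmb a N) * S)%:E)%E.
Proof.
move=> hS; apply: (AM_le_zpsum (fun j => Bn_interp_symbol j a N)) => M.
by rewrite zpsumZ; apply: ler_wpM2l; rewrite ?mulr_ge0 ?riesz_ratio_ge0 ?base_nrm_ge0.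
Qed.

Lemma interp_symbol_tail a N M y : (N <= M)%N ->
  interp_symbol a M y - interp_symbol a N y = interp_symbol (fun n => if (`|n|%N <= N)%N then 0 else a n) M y.
Proof.
move=> NM; rewrite /interp_symbol -mulrBr /combo zpsum_tail//; congr (_ * _); apply: eq_zpsum => n.
by case: ifP; rewrite ?mul0r.
Qed.

(** The factor e^{-i x_n y} is a shift of the argument by x_n, so [phi_inversion] recovers each
    translate of [phi]. *)
Lemma interp_symbol_ifourier a N t : L1f (interp_symbol a N) /\
  ifourier (interp_symbol a N) t = zpsum (fun n => a n * (phi (t - x n))%:C) N.
Proof.
have L : L1f (fourier (cplx phi)) by apply/L1P; exact: interp_fourier_L1 hphi.
pose G n y := a n * (fourier (cplx phi) y * expi (- (x n * y))).
have LG0 n : L1f (fun y => fourier (cplx phi) y * expi (- (x n * y))).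
  by apply: (L1fMb (M := 1) L) => [|y]; [exact: cmeas_exp|rewrite cabs_expi].
have LG n : L1f (G n) by exact: L1fZ.
have [L1 E1] := fourier_sum (zseq N) (- t) LG.
have e : interp_symbol a N = (fun y => \sum_(n <- zseq N) G n y).
  apply/funext => y; rewrite /interp_symbol /combo zpsumE mulr_sumr; apply: eq_bigr => n _.
  by rewrite /G fourier_phiE//; ring.
rewrite e; split=> //; rewrite /ifourier E1 zpsumE; apply: eq_bigr => n _.
rewrite [LHS](fourierZ _ _ (LG0 n)) fourier_mod; congr (_ * _).
by rewrite phi_inversion// /ifourier opprB addrC.
Qed.

(** The l^2 tail of [a] controls combinations through the upper Riesz bound, and (A3) sums over the
    blocks: the symbols form a Cauchy sequence in the amalgam norm. Their inverse transforms then
    converge uniformly, which identifies [zsum] at every point. *)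
Lemma interpolant_symbol a : l2 a -> exists F, [/\ cmeas F,
  forall e : R, 0 < e -> exists N, forall M, (N <= M)%N -> (AM (fun y => interp_symbol a M y - F y)%R <= e%:E)%E &
  forall t, zsum (fun n => a n * (phi (t - x n))%:C) = ifourier F t].
Proof.
move=> la; have [S S0 hS] := Msup_sum.
have AMoo N : (AM (interp_symbol a N) < +oo)%E by exact: le_lt_trans (AM_interp_symbol a N hS) (ltey _).
have a2 n : 0 <= cabs (a n) ^+ 2 by rewrite sqr_ge0.
have tail := zpsum_tail_small a2 la.
have cauchy0 (e : R) : 0 < e -> exists N, forall i j : nat, (N <= i)%N -> (i <= j)%N ->
    (AM (fun y => interp_symbol a j y - interp_symbol a i y)%R <= e%:E)%E.
  move=> e0; pose Z := K * S + 1.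
  have Z0 : 0 < Z by rewrite ltr_wpDl ?mulr_ge0 ?riesz_ratio_ge0.
  have eZ : 0 < e / Z by rewrite divr_gt0.
  (* The upper Riesz bound [q] turns an l^2 tail of this size into a combination of norm at most e /
     Z. *)
  have [|N NP] := tail ((e / Z) ^+ 2 / q); first by rewrite divr_gt0// exprn_gt0.
  exists N => i j Ni ij.
  pose b n := if (`|n|%N <= i)%N then 0 else a n.
  have -> : (fun y => interp_symbol a j y - interp_symbol a i y) = interp_symbol b j by apply/funext => y; rewrite interp_symbol_tail.
  apply: le_trans (AM_interp_symbol b j hS) _; rewrite lee_fin.
  have nbe : base_nrm (cmb b j) <= e / Z.
    rewrite -(@ler_pXn2r _ 2) ?nnegrE ?base_nrm_ge0//; last exact: ltW.
    have /andP[_ h] := hr b j; apply: le_trans h _.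
    rewrite -[leRHS](divfK (_ : q != 0)) ?gt_eqF// mulrC ler_pM2r//.
    apply: le_trans (NP j (leq_trans Ni ij)); rewrite zpsum_tail; last exact: leq_trans Ni ij.
    apply: le_zpsum => n; rewrite /b; case: (leqP _ i) => ni.
      by rewrite cabs0 expr0n/=; case: ifP.
    by rewrite ifF//; apply/negbTE; rewrite -ltnNge (leq_ltn_trans Ni ni).
  apply: le_trans (_ : e / Z * Z <= e); last by rewrite divfK// gt_eqF.
  rewrite mulrAC mulrC; apply: ler_pM; rewrite ?base_nrm_ge0 ?mulr_ge0 ?riesz_ratio_ge0//.
  by rewrite /Z lerDl.
have [||F [cF FF]] := @AM_complete R (interp_symbol a) (cmeas_interp_symbol a).

- exact: AMoo.
- move=> e /cauchy0[N NP]; exists N => i j Ni Nj; have [ij|ji] := leqP i j.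
    by rewrite AM_BC; exact: NP.
  by apply: NP => //; exact: ltnW.
exists F; split => // t.
have oneR : (0 : R) < 1 by [].
have LF : L1f F.
  have [N NP] := FF 1 oneR.
  have L := (AM_L1 (cmeasB (cmeas_interp_symbol a N) cF) (NP N (leqnn N))).1.
  have := L1fB (interp_symbol_ifourier a N 0).1 L.
  by rewrite (_ : (fun y => _) = F)//; apply/funext => y; rewrite opprB addrC subrK.
apply: limn_complex => e /FF[N NP]; exists N => M NM.
have [L1 <-] := interp_symbol_ifourier a M t.
rewrite /ifourier -fourierB//; apply: le_trans (fourier_bound _ (L1fB L1 LF)) _.
exact: (AM_L1 (cmeasB (cmeas_interp_symbol a M) cF) (NP M NM)).2.
Qed.

End Core.

(** * The error of a single interpolant *)

Section CoreBound.
Variable R : realType.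
Local Notation mu := (@lebesgue_measure R).
Local Open Scope complex_scope.
Local Notation cmeas := (@cmeasurable R setT).
Implicit Types (u v g h G H : R -> R[i]) (j k n : int) (a c : int -> R[i]).
Variable x : int -> R.
Variables (p q : R).
Hypothesis (p0 : 0 < p) (q0 : 0 < q).
Hypothesis hr : forall c N,
  p * zpsum (fun n => cabs (c n) ^+ 2) N <= base_nrm (combo x c N) ^+ 2 <= q * zpsum (fun n => cabs (c n) ^+ 2) N.
Hypothesis hcomp : forall h, L2 (@base R) h -> forall e : R, 0 < e ->
  exists c N, (L2norm (@base R) (fun y => (h y - combo x c N y)%R) < e%:E)%E.
Local Notation K := (riesz_ratio p q).
Local Notation cmb := (combo x).

Lemma orth_combo H : L1f H -> (forall n, ifourier H (x n) = 0) ->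
  forall c N, rint (fun y => dot (H y) (cmb c N y)) = 0.
Proof.
move=> LH H0 c N.
have i n : integ (fun y => dot (H y) (c n * expi (- (x n * y)))).
  apply: (L1f_dot (M := cabs (c n)) LH) => [|y].
    by apply: cmeasM; [exact: cmeas_cst|exact: cmeas_exp].
  by rewrite cabsM cabs_expi mulr1.
have e y : dot (H y) (cmb c N y) = \sum_(n <- zseq N) dot (H y) (c n * expi (- (x n * y))).
  rewrite /combo zpsumE; elim: (zseq N) => [|n s IH]; first by rewrite !big_nil dot0r.
  by rewrite !big_cons dotDr IH.
rewrite (eq_rint e) rint_sum// big1// => n _.
have := dot_fourier (- x n) (c n) LH; rewrite -/(ifourier H (x n)) H0 dot0l => /esym/eqP.
rewrite mulf_eq0 gt_eqF ?cc_gt0//= => /eqP h; rewrite -[RHS]h.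
by apply: eq_rint => y; rewrite mulrN (mulrC y).
Qed.

Lemma combo_dense H : cmeas H -> L2f H -> forall e : R, 0 < e ->
  exists c N, base_nrm (fun y => H y - cmb c N y) < e.
Proof.
move=> cH LH e e0.
have [|c [N h]] := hcomp (h := H) _ e0.
  split; first by split; apply: (@measurable_funS _ _ _ _ setT) => //; [exact: cH.1|exact: cH.2].
  rewrite L2norm_base ?ltey//; exact: measurable_base.
exists c, N; rewrite -lte_fin; apply: le_lt_trans h.
have cm := cmeas_combo x c N.
rewrite L2norm_cut L2norm_nrm//.
rewrite (_ : cut _ _ = (fun y => cut (@base R) H y - cut (@base R) (cmb c N) y)).
  by apply: L2fB; [apply: L2f_cut => //; exact: measurable_base|exact: L2f_combo].
by apply/funext => y; rewrite /cut mulrBl.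
Qed.

Lemma base_bound H (Y : R) : cmeas H -> L2f H -> L1f H ->
  (forall c N, rint (fun y => dot (H y) (cmb c N y)) = 0) ->
  (AM (off H) <= Y%:E)%E -> base_nrm H <= K * Y.
Proof.
move=> cH LH L1H orth HY; set d := base_nrm H.
have Y0 : 0 <= Y by rewrite -lee_fin (le_trans (AM_ge0 _) HY).
have mb := @measurable_base R.
have Lb : L2f (cut (@base R) H) by exact: L2f_cut.
have d0 : 0 <= d by exact: base_nrm_ge0.
have KY0 : 0 <= K * Y by rewrite mulr_ge0// riesz_ratio_ge0.
(* For a combination [v] within [e] of [H] on the band, orthogonality gives d^2 = <H, H - v> on the
   band minus <H, v> off it. The first term is at most d e; the second pairs the amalgam norm of
   [off H] with the block norms of [v]. *)
have main e : 0 < e -> d ^+ 2 <= d * e + K * (d + e) * Y.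
  move=> e0; have [c [N hv]] := combo_dense cH LH e0.
  set v := cmb c N in hv; have cv : cmeas v := cmeas_combo x c N.
  have Lv : L2f (cut (@base R) v) := L2f_combo x c N.
  have LHv : L2f (cut (@base R) (fun y => H y - v y)).
    rewrite (_ : cut _ _ = (fun y => cut (@base R) H y - cut (@base R) v y)); first exact: L2fB.
    by apply/funext => y; rewrite /cut mulrBl.
  have nv : base_nrm v <= d + e.
    have -> : base_nrm v = nrm (fun y => cut (@base R) H y - cut (@base R) (fun y => H y - v y) y).
      by apply: eq_nrm => y; rewrite /cut mulrBl opprB addrC subrK.
    by apply: le_trans (nrmB Lb LHv) _; apply: lerD => //; exact: ltW.
  have [io ro] := @amalgam_pairing R (off H) v (K * base_nrm v) Y (cmeas_off cH) cv
    (fun m => Bn_combo p0 q0 hr m c N) HY.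
  have iv : integ (fun y => dot (H y) (v y)).
    exact: (L1f_dot L1H cv (combo_bound x c N)).
  have ib := integ_dot Lb Lv.
  have io' : integ (fun y => dot (off H y) (v y)).
    apply: (@integ_dom R _ _ _ io) => [|y]; last exact: dot_le_cabs.
    by apply: measurable_dot => //; exact: cmeas_off.
  have split0 : rint (fun y => dot (cut (@base R) H y) (cut (@base R) v y)) =
      - rint (fun y => dot (off H y) (v y)).
    apply/eqP; rewrite -addr_eq0 -rintD//; apply/eqP; rewrite -[RHS](orth c N).
    apply: eq_rint => y; rewrite [H y in RHS]cut_off dotDl; congr (_ + _).
    have [yb|yb] := pselect (base y); first by rewrite !cut_in.
    by rewrite !cut_out// !dot0l.
  have dE : d ^+ 2 = ip (cut (@base R) H) (cut (@base R) (fun y => H y - v y))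
      - rint (fun y => dot (off H y) (v y)).
    have -> : cut (@base R) (fun y => H y - v y) = (fun y => cut (@base R) H y - cut (@base R) v y).
      by apply/funext => y; rewrite /cut mulrBl.
    by rewrite ipBr// -split0 /d /base_nrm nrm2_ip subrK.
  rewrite dE; apply: lerD.
    apply: le_trans (ler_norm _) _; apply: le_trans (normr_ip Lb LHv) _.
    by apply: ler_wpM2l => //; exact: ltW.
  apply: le_trans (_ : K * base_nrm v * Y <= _); last first.
    by rewrite ler_wpM2r// ler_wpM2l ?riesz_ratio_ge0.
  apply: le_trans ro; apply: le_trans (ler_norm _) _; rewrite normrN.
  by apply: (normr_rint_le io' io) => y; exact: dot_le_cabs.
have d2 : d ^+ 2 <= K * Y * d.
  apply/ler_addgt0Pr => e e0.
  (* In [main] the coefficient of [e] is d + K Y, which [Z] exceeds. *)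
  pose Z := d + K * Y + 1; have Z0 : 0 < Z by rewrite ltr_wpDl// addr_ge0.
  have := main (e / Z) (divr_gt0 e0 Z0).
  have eZ : e / Z * Z = e by rewrite divfK// gt_eqF.
  have h0 : 0 <= e / Z by rewrite divr_ge0// ltW.
  move=> h; apply: le_trans h _.
  have -> : K * Y * d + e = K * Y * d + e / Z * Z by rewrite eZ.
  by rewrite /Z; move: (e / _) h0 => w w0; nra.
have [->|dn] := eqVneq d 0; first by [].
have dp : 0 < d by rewrite lt_neqAle eq_sym dn.
by move: d2; rewrite expr2 ler_pM2r.
Qed.

Variable phi : R -> R.
Hypothesis hphi : interpolator phi.
Local Notation m := (minf phi).
Local Notation Fn := (interp_symbol x phi).
Variable C : R.
Hypothesis hC : forall N, zpsum (fun j => if j == 0 then 0 else Msup phi j) N <= C * m.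

Lemma tail_const_ge0 : 0 <= C.
Proof.
rewrite -(pmulr_lge0 _ (minf_gt0 hphi)); apply: le_trans (hC 0%N).
by apply: zpsum_ge0 => j; case: eqP => // _; exact: Msup_ge0.
Qed.

Lemma AM_off_interp_symbol a N : (AM (off (Fn a N)) <= (K * base_nrm (cmb a N) * (C * m))%:E)%E.
Proof.
apply: (@AM_le_zpsum R _ (fun j => K * base_nrm (cmb a N) * if j == 0 then 0 else Msup phi j)) => [j|M].
  apply: le_trans (Bn_off j (cmeas_interp_symbol x hphi a N)) _.
  by case: eqP => _; [rewrite mulr0|exact: Bn_interp_symbol].
by rewrite zpsumZ; apply: ler_wpM2l; rewrite ?mulr_ge0 ?riesz_ratio_ge0 ?base_nrm_ge0.
Qed.

Definition tau G : R := Num.sqrt (rint (fun y => cabs (G y) ^+ 2 * (m / symb phi y))).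

Variable gam : R -> R[i].
Hypothesis (L1g : L1f gam) (L2g : L2f gam) (g_out : forall y, ~ base y -> gam y = 0).

Lemma measurable_ratio : measurable_fun setT (fun y => m / symb phi y).
Proof.
rewrite (_ : (fun y => _) = (fun y => m * powR (symb phi y) (- 1))).
  apply: measurable_funM => //.
  exact: (measurableT_comp (measurable_powR _) (measurable_symb hphi)).
by apply/funext => y; rewrite powRN powRr1// symb_ge0.
Qed.

Lemma ratio_bound y : base y -> 0 <= m / symb phi y <= 1.
Proof.
move=> yb; have m0 := minf_gt0 hphi; have ms := minf_le hphi yb.
have s0 := lt_le_trans m0 ms.
apply/andP; split; first by apply: divr_ge0; exact: ltW.
by rewrite ler_pdivrMr// mul1r.
Qed.

Lemma weight_ge0 y : 0 <= cabs (gam y) ^+ 2 * (m / symb phi y).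
Proof.
have [yb|yb] := pselect (base y); last by rewrite g_out// cabs0 expr0n/= mul0r.
by rewrite mulr_ge0 ?sqr_ge0//; have /andP[] := ratio_bound yb.
Qed.

Lemma weight_le y : cabs (gam y) ^+ 2 * (m / symb phi y) <= cabs (gam y) ^+ 2.
Proof.
have [yb|yb] := pselect (base y); last by rewrite g_out// cabs0 expr0n/= mul0r.
by rewrite ler_piMr ?sqr_ge0//; have /andP[] := ratio_bound yb.
Qed.

Lemma measurable_weight : measurable_fun setT (fun y => cabs (gam y) ^+ 2 * (m / symb phi y)).
Proof.
by apply: measurable_funM; [exact: measurable_cabs2 L2g.1|exact: measurable_ratio].
Qed.

Lemma integ_weight : integ (fun y => cabs (gam y) ^+ 2 * (m / symb phi y)).
Proof.
apply: (integ_dom measurable_weight L2g.2) => y.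
by rewrite ger0_norm ?weight_ge0// weight_le.
Qed.

Lemma tau_le : tau gam <= nrm gam.
Proof.
by rewrite ler_sqrt ?rint_ge0// => [|y]; [apply: le_rint integ_weight L2g.2 _ => y; exact: weight_le|exact: sqr_ge0].
Qed.

Variable a : int -> R[i].
Hypothesis la : l2 a.
Variable F : R -> R[i].
Hypothesis cF : cmeas F.
Hypothesis cvF : forall e : R, 0 < e -> exists N, forall M, (N <= M)%N ->
  (AM (fun y => Fn a M y - F y)%R <= e%:E)%E.

Lemma base_nrm_combo_bounded : exists2 B : R, 0 <= B & forall N, base_nrm (cmb a N) <= B.
Proof.
have a2 n : 0 <= cabs (a n) ^+ 2 by rewrite sqr_ge0.
have [A eA] : exists A : R, (\esum_(n in [set: int]) (cabs (a n) ^+ 2)%:E = A%:E)%E.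
  exists (fine (\esum_(n in [set: int]) (cabs (a n) ^+ 2)%:E)%E); rewrite fineK// ge0_fin_numE//.
  by apply: esum_ge0 => n _; rewrite lee_fin.
exists (Num.sqrt (q * A)) => [|N]; first exact: sqrtr_ge0.
have h : zpsum (fun n => cabs (a n) ^+ 2) N <= A by apply: (esum_le_zpsum A a2).1; rewrite eA.
have A0 : 0 <= q * A by rewrite mulr_ge0 ?(ltW q0)// (le_trans _ h)// zpsum_ge0.
rewrite -(@ler_pXn2r _ 2) ?nnegrE ?base_nrm_ge0 ?sqrtr_ge0// [Num.sqrt _ ^+ 2 in leRHS]sqr_sqrtr//.
have /andP[_ h2] := hr a N; apply: (le_trans h2).
by rewrite ler_pM2l.
Qed.

Lemma L1f_limit : L1f F /\ L2f F.
Proof.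
have [N NP] := cvF ltr01.
have cB := cmeasB (cmeas_interp_symbol x hphi a N) cF.
have [S _ hS] := Msup_sum hphi.
have e : F = (fun y => Fn a N y - (Fn a N y - F y)) by apply/funext => y; rewrite opprB addrC subrK.
have cN := cmeas_interp_symbol x hphi a N.
have hN := AM_interp_symbol p0 q0 hr hphi a N hS.
rewrite e; split; [apply: L1fB|apply: L2fB].
- exact: (AM_L1 cN hN).1.
- exact: (AM_L1 cB (NP N (leqnn N))).1.
- exact: (AM_L2 cN hN).1.
- exact: (AM_L2 cB (NP N (leqnn N))).1.
Qed.

Hypothesis interp : forall n, ifourier F (x n) = ifourier gam (x n).

Lemma orth_diff c N : rint (fun y => dot (F y - gam y) (cmb c N y)) = 0.
Proof.
apply: orth_combo => [|n]; first exact: L1fB L1f_limit.1 L1g.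
by rewrite /ifourier fourierB//; [rewrite -!/(ifourier _ _) interp subrr|exact: L1f_limit.1].
Qed.

(** For a partial sum [P] the identity between the weighted energy [X] and <gamma, P> carries an
    error <Fn - F, P>; the block norms of [P] are bounded in [N], so the error vanishes in the
    limit. *)
Lemma weighted_bound (e : R) : 0 < e ->
  exists N0, forall N, (N0 <= N)%N -> m * base_nrm (cmb a N) <= tau gam + e.
Proof.
move=> e0; have [B B0 hB] := base_nrm_combo_bounded.
have m0 := minf_gt0 hphi; have K0 := riesz_ratio_ge0 p q.
(* The error is at most K B eta. After half of m X is absorbed it appears as 2 m K B eta, which this
   [Z] keeps below e^2. *)
pose Z := 2 * m * K * B + 1.
have Z0 : 0 < Z by rewrite ltr_wpDl// !mulr_ge0// ltW.
have eta0 : 0 < e ^+ 2 / Z by rewrite divr_gt0// exprn_gt0.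
have [N0 NP] := cvF eta0; exists N0 => N NN.
set eta := e ^+ 2 / Z in eta0 NP.
have etaZ : eta * Z = e ^+ 2 by rewrite divfK// gt_eqF.
set P := cmb a N; have cP : cmeas P := cmeas_combo x a N.
have L1FN : L1f (Fn a N) := (interp_symbol_ifourier x hphi a N 0).1.
have L1F := L1f_limit.1.
have mP := combo_bound x a N.
have L1E : L1f (fun y => Fn a N y - F y) := L1fB L1FN L1F.
have iX : integ (fun y => symb phi y * cabs (P y) ^+ 2).
  apply: eq_integ (L1f_dot L1FN cP mP) => y.
  by rewrite /interp_symbol dotZl -cabs_sqr_dot.
set X := rint (fun y => symb phi y * cabs (P y) ^+ 2).
(* Write Fn = (Fn - F) + (F - gamma) + gamma: the middle term is orthogonal to [P]. *)
have XE : X = rint (fun y => dot (Fn a N y - F y) (P y)) + rint (fun y => dot (gam y) (P y)).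
  rewrite -[LHS]subr0 -(orth_diff a N) -/P.
  have iE := L1f_dot L1E cP mP; have iD := L1f_dot (L1fB L1F L1g) cP mP.
  have ig := L1f_dot L1g cP mP.
  rewrite -(rintB iX iD) -(rintD iE ig).
  apply: eq_rint => y.
  have -> : symb phi y * cabs (P y) ^+ 2 = dot (Fn a N y) (P y) by rewrite /interp_symbol dotZl -cabs_sqr_dot.
  by rewrite !dotBl; ring.
have [io ro] := @amalgam_pairing R (fun y => Fn a N y - F y) P (K * base_nrm P) eta L1E.1 cP
    (fun j => Bn_combo p0 q0 hr j a N) (NP N NN).
have errE : rint (fun y => dot (Fn a N y - F y) (P y)) <= K * B * eta.
  apply: le_trans (ler_norm _) _.
  apply: le_trans (normr_rint_le (L1f_dot L1E cP mP) io _) _ => [y|]; first exact: dot_le_cabs.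
  apply: le_trans ro _; apply: ler_wpM2r; first exact: ltW.
  by apply: ler_wpM2l => //; exact: hB.
set T := rint (fun y => cabs (gam y) ^+ 2 * (m / symb phi y)).
(* A weighted Young inequality in place of Cauchy-Schwarz: the term in [X] is absorbed on the left
   afterwards. *)
have ag : m * rint (fun y => dot (gam y) (P y)) <= 2^-1 * T + 2^-1 * m * X.
  have iw := integ_weight.
  rewrite -(rintZ m (L1f_dot L1g cP mP)) -(rintZ 2^-1 iw) -(rintZ (2^-1 * m) iX).
  rewrite -rintD; [|exact: integZ|exact: integZ].
  apply: le_rint => [||y]; [apply: integZ; exact: (L1f_dot L1g cP mP)|by apply: integD; exact: integZ|].
  have [yb|yb] := pselect (base y); last first.
    rewrite g_out// dot0l cabs0 expr0n/= mul0r !mulr0 add0r.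
    have m2 : 0 <= 2^-1 * m by rewrite mulr_ge0 ?invr_ge0// ltW.
    by apply: mulr_ge0 => //; rewrite mulr_ge0 ?sqr_ge0// symb_ge0.
  have s0 := lt_le_trans m0 (minf_le hphi yb).
  have dl : dot (gam y) (P y) <= cabs (gam y) * cabs (P y) by exact: le_trans (ler_norm _) (dot_le_cabs _ _).
  apply: le_trans (_ : m * (cabs (gam y) * cabs (P y)) <= _); first by rewrite ler_pM2l.
  (* the right-hand side minus the left-hand side is [m * s / 2 * (G / s - w) ^+ 2] *)
  set s := symb phi y in s0 *; set G := cabs (gam y); set w := cabs (P y).
  have : 0 <= m * s / 2 * (G / s - w) ^+ 2.
    by rewrite mulr_ge0 ?sqr_ge0// divr_ge0// mulr_ge0// ltW.
  suff -> : m * s / 2 * (G / s - w) ^+ 2 =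
    2^-1 * (G ^+ 2 * (m / s)) + 2^-1 * m * (s * w ^+ 2) - m * (G * w) by rewrite subr_ge0.
  by field; rewrite gt_eqF.
have T0 : 0 <= T by apply: rint_ge0 => y; exact: weight_ge0.
have tT : tau gam ^+ 2 = T by rewrite sqr_sqrtr.
have mX : m * X <= T + e ^+ 2.
  rewrite -etaZ /Z.
  have : m * X <= m * (K * B * eta) + (2^-1 * T + 2^-1 * m * X).
    by rewrite {1}XE mulrDr; apply: lerD => //; rewrite ler_pM2l.
  by move: eta0 => /ltW; move: (eta) => w w0; nra.
have nX : m * base_nrm P ^+ 2 <= X.
  have LP := L2f_combo x a N.
  rewrite /base_nrm nrm2 -(rintZ m LP.2).
  apply: le_rint => [||y]; [exact: integZ LP.2|exact: iX|].
  have [yb|yb] := pselect (base y).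
    by rewrite cut_in// ler_wpM2r ?sqr_ge0//; exact: minf_le.
  by rewrite cut_out// cabs0 expr0n/= mulr0 mulr_ge0 ?sqr_ge0// symb_ge0.
have t0 : 0 <= tau gam by exact: sqrtr_ge0.
(* On squares: m^2 ||P||^2 <= m X <= tau^2 + e^2 <= (tau + e)^2. *)
rewrite -(@ler_pXn2r _ 2) ?nnegrE; [|by []|by rewrite mulr_ge0 ?base_nrm_ge0// ltW|by rewrite addr_ge0// ltW].
apply: le_trans (_ : m * X <= _).
  by rewrite exprMn expr2 -mulrA ler_pM2l.
apply: le_trans mX _; rewrite -tT.
by move: e0 t0; move: (tau gam) => w e0 w0; nra.
Qed.

(** The bound (H2) on the tail contains the factor [m] that [weighted_bound] needs; the convergence
    of the symbols then allows the passage to [F]. *)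
Lemma AM_off_limit : (AM (off F) <= (K * C * tau gam)%:E)%E.
Proof.
apply/lee_addgt0Pr => e e0.
have C0 := tail_const_ge0; have K0 := riesz_ratio_ge0 p q.
pose Z := K * C + 1; have Z0 : 0 < Z by rewrite ltr_wpDl// mulr_ge0.
have eZ0 : 0 < e / Z by rewrite divr_gt0.
have [N1 h1] := weighted_bound eZ0; have [N2 h2] := cvF eZ0.
pose N := maxn N1 N2.
have hw := h1 N (leq_maxl _ _); have hA := h2 N (leq_maxr _ _).
have cN := cmeas_interp_symbol x hphi a N.
have -> : off F = (fun y => off (Fn a N) y - off (fun z => Fn a N z - F z) y).
  by apply/funext => y; rewrite /off /cut -mulrBl opprB addrC subrK.
apply: le_trans (AM_B (cmeas_off cN) (cmeas_off (cmeasB cN cF))) _.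
apply: (@le_trans _ _ ((K * base_nrm (cmb a N) * (C * m))%:E + (e / Z)%:E)%E).
  apply: leeD; first exact: AM_off_interp_symbol.
  by apply: le_trans (AM_off_le _) hA; exact: cmeasB.
rewrite -!EFinD lee_fin.
have e1 : e / Z * Z = e by rewrite divfK// gt_eqF.
apply: le_trans (_ : K * C * (tau gam + e / Z) + e / Z <= _).
  rewrite lerD2r (_ : K * base_nrm (cmb a N) * (C * m) = K * C * (m * base_nrm (cmb a N))); last by ring.
  by apply: ler_wpM2l => //; rewrite mulr_ge0.
by rewrite -[X in _ <= _ + X]e1 /Z; lra.
Qed.

Lemma core_bound : (AM (fun y => F y - gam y)%R <= ((K + 1) * (K * C * tau gam))%:E)%E.
Proof.
set D := (fun y => F y - gam y).
have [L1F L2F] := L1f_limit.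
have cD : cmeas D := cmeasB cF L1g.1.
have oD : off D = off F.
  apply/funext => y; rewrite /D /off; have [yb|yb] := pselect (base y).
    by rewrite !cut_out//; apply.
  by rewrite !cut_in// g_out// subr0.
have hY := AM_off_limit; rewrite -oD in hY.
have hb := base_bound cD (L2fB L2F L2g) (L1fB L1F L1g) orth_diff hY.
have -> : D = (fun y => cut (@base R) D y + off D y) by apply/funext => y; exact: cut_off.
have mb := @measurable_base R.
apply: le_trans (AM_D (cmeas_cut mb cD) (cmeas_off cD)) _.
(* The summand with factor [K] is for the part on the band, by [base_bound], the other for the part
   off it. *)
rewrite mulrDl mul1r EFinD; apply: leeD => //.
rewrite -blk0 AM_cut// /Bn blk0 L2norm_cut L2norm_nrm ?lee_fin//.
by apply: L2f_cut => //; exact: L2fB.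
Qed.

End CoreBound.

(** * The approximation error *)

Section Estimate.
Variable R : realType.
Local Notation mu := (@lebesgue_measure R).
Local Open Scope complex_scope.
Local Notation cmeas := (@cmeasurable R setT).
Implicit Types (u v g h G H : R -> R[i]) (j k m n : int).

Definition gamma g : R -> R[i] := cut (@base R) (fourier2 g).

Lemma gamma_L g : L2f g -> L1f (gamma g) /\ L2f (gamma g).
Proof.
move=> Lg; have LG := fourier2_L2f Lg; split; first exact: L1f_bounded_cut.
by apply: L2f_cut => //; exact: measurable_base.
Qed.

(** Continuity upgrades inversion from almost every to every point, so that the interpolation
    conditions at the nodes can be read on the Fourier side. *)
Lemma PW_inversion g : PW g -> forall t, g t = ifourier (gamma g) t.
Proof.
case=> /L2P Lg cg bg; have [L1g L2g] := gamma_L Lg; have LG := fourier2_L2f Lg.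
apply: (continuous_ae_eq cg).
  move=> t; apply: (@continuous_comp _ _ _ (fun t : R => - t) (fourier (gamma g) : R -> R[i]^o)).
    exact: opp_continuous.
  exact: continuous_fourier.
have iso := fourier2_isometry (fourier2P Lg) (is_fourier2_ifourier L1g L2g).
have [LI _] := L2f_ifourier L1g L2g.
have z : nrm (fun y => g y - ifourier (gamma g) y) = 0.
  rewrite -iso (ae_eq_nrm (v := fun=> 0)).
  - by rewrite nrm_cst0.
  - exact: cmeasB LG.1 L2g.1.
  - exact: (cmeas_cst 0).
  apply: ae_imp bg => y hy; rewrite /gamma; have [yb|yb] := pselect (base y).
    by rewrite cut_in// subrr.
  by rewrite cut_out// hy// subr0.
apply: ae_imp (nrm0_ae (L2fB Lg LI) z) => y /eqP.
by rewrite subr_eq0 => /eqP.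
Qed.

Lemma riesz_real (x : int -> R) : complete_interpolating x -> exists p q : R, [/\ 0 < p, 0 < q &
  forall c N, p * zpsum (fun n => cabs (c n) ^+ 2) N <= base_nrm (combo x c N) ^+ 2
    <= q * zpsum (fun n => cabs (c n) ^+ 2) N].
Proof.
case=> _ [p [q [p0 q0 h]]] _; exists p, q; split => // c N.
have [h1 h2] := h c N; have e := L2norm_combo x c N; rewrite /combo in e.
by move: h1 h2; rewrite e -EFin_expe !lee_fin => -> ->.
Qed.

(** The constant is chosen before [phi] and [g]: it depends on the nodes only, which makes the
    estimate uniform in alpha and in the frequency block. *)
Lemma core_estimate (x : int -> R) : complete_interpolating x -> exists2 K : R, 0 <= K &
  forall (phi : R -> R) (C : R) g h, interpolator phi ->
  (forall N, zpsum (fun j => if j == 0 then 0 else Msup phi j) N <= C * minf phi) ->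
  PW g -> is_interpolant phi x g h ->
  exists F, [/\ L1f F, L2f F, forall t, h t = ifourier F t &
    (AM (fun y => F y - gamma g y)%R <= (K * C * tau phi (gamma g))%:E)%E].
Proof.
move=> hx; have [p [q [p0 q0 hr]]] := riesz_real hx.
have hcomp : forall h, L2 (@base R) h -> forall e : R, 0 < e ->
  exists c N, (L2norm (@base R) (fun y => (h y - combo x c N y)%R) < e%:E)%E by case: hx.
exists ((riesz_ratio p q + 1) * riesz_ratio p q) => [|phi C g h hphi hC hg [a [la ha hh]]].
  by rewrite mulr_ge0 ?addr_ge0 ?riesz_ratio_ge0.
have [/L2P Lg _ _] := hg; have [L1g L2g] := gamma_L Lg.
have [F [cF cvF eF]] := interpolant_symbol p0 q0 hr hphi la.
have [L1F L2F] := L1f_limit p0 q0 hr hphi cF cvF.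
exists F; split => // [t|]; first by rewrite ha eF.
rewrite -2!mulrA [riesz_ratio p q * _]mulrA.
apply: (core_bound p0 q0 hr hcomp hphi hC L1g L2g _ la cF cvF) => [y yb|n].
  by rewrite /gamma cut_out.
by rewrite -eF -ha hh; exact: PW_inversion.
Qed.

Lemma fourier_sh k u xi : L1f u -> L1f (sh k u) /\ fourier (sh k u) xi = fourier u xi * expi (tpi R k * xi).
Proof.
move=> Lu.
have Ls : L1f (sh k u) by split; [exact: cmeas_sh Lu.1|exact: integ_shift Lu.2].
split=> //; apply: dot_ext => z; rewrite dot_fourier// dot_expi dot_fourier//; congr (_ * _).
have i : integ (fun y => dot (u y) (z * expi (- (tpi R k * xi)) * expi (y * xi))).
  apply: (L1f_dot (M := cabs z) Lu) => [|y].
    by apply: cmeasM; [exact: cmeas_cst|exact: measurable_expiM].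
  by rewrite !cabsM !cabs_expi !mulr1.
rewrite -(rint_shift (tpi R k) i); apply: eq_rint => y.
by rewrite -mulrA -expiD; congr (dot _ (_ * expi _)); ring.
Qed.

End Estimate.

(** * Series and block decompositions in the amalgam norm *)

Section BlockSeries.
Variable R : realType.
Local Notation mu := (@lebesgue_measure R).
Local Open Scope complex_scope.
Local Notation cmeas := (@cmeasurable R setT).
Implicit Types (u v g h G H : R -> R[i]) (j k m n : int).

Lemma cmeas_zpsum (F : int -> R -> R[i]) N : (forall m, cmeas (F m)) ->
  cmeas (fun y => zpsum (F ^~ y) N).
Proof.
move=> cF; rewrite (_ : (fun y => _) = (fun y => \sum_(n <- zseq N) F n y)); first exact: cmeas_sum.
by apply/funext => y; rewrite zpsumE.
Qed.

Lemma AM_sum (I : Type) (s : seq I) (F : I -> R -> R[i]) : (forall i, cmeas (F i)) ->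
  (AM (fun y => \sum_(i <- s) F i y)%R <= \sum_(i <- s) AM (F i))%E.
Proof.
move=> cF; elim: s => [|i s IH].
  rewrite big_nil (_ : (fun y => _) = (fun=> 0%R)); last by apply/funext => y; rewrite big_nil.
  rewrite /AM esum1// => j _; rewrite /Bn L2norm_cut (_ : cut _ _ = (fun=> 0%R)).
    rewrite L2norm_nrm; last exact: L2f0.
    by rewrite nrm_cst0.
  by apply/funext => y; rewrite /cut mul0r.
rewrite big_cons (_ : (fun y => _) = (fun y => F i y + \sum_(i <- s) F i y)%R); last first.
  by apply/funext => y; rewrite big_cons.
apply: (le_trans (AM_D (cF i) (cmeas_sum s cF))); exact: leeD.
Qed.

Lemma AM_zpsum (F : int -> R -> R[i]) (b : int -> R) N : (forall m, cmeas (F m)) ->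
  (forall m, (AM (F m) <= (b m)%:E)%E) ->
  (AM (fun y => zpsum (F ^~ y) N) <= (zpsum b N)%:E)%E.
Proof.
move=> cF Fb; rewrite (_ : (fun y => _) = (fun y => \sum_(n <- zseq N) F n y)); last first.
  by apply/funext => y; rewrite zpsumE.
apply: le_trans (AM_sum (zseq N) cF) _.
by rewrite zpsumE -sumEFin; apply: lee_sum.
Qed.

Lemma AM_series (F : int -> R -> R[i]) (b : int -> R) (B : R) : (forall m, cmeas (F m)) ->
  (forall m, (AM (F m) <= (b m)%:E)%E) -> (forall N, zpsum b N <= B) ->
  exists E, [/\ cmeas E, (AM E <= B%:E)%E & forall e : R, 0 < e -> exists N, forall M, (N <= M)%N ->
    (AM (fun y => zpsum (F ^~ y) M - E y)%R <= e%:E)%E].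
Proof.
move=> cF Fb bB.
have b0 m : 0 <= b m by rewrite -lee_fin (le_trans (AM_ge0 _) (Fb m)).
have bs : (\esum_(m in [set: int]) (b m)%:E < +oo)%E.
  by apply: (@le_lt_trans _ _ B%:E); [exact/esum_le_zpsum|exact: ltey].
have cS N : cmeas (fun y => zpsum (F ^~ y) N) by exact: cmeas_zpsum.
have cauchy0 (e : R) : 0 < e -> exists N, forall i l : nat, (N <= i)%N -> (i <= l)%N ->
    (AM (fun y => zpsum (F ^~ y) l - zpsum (F ^~ y) i)%R <= e%:E)%E.
  move=> e0; have [N NP] := zpsum_tail_small b0 bs e0; exists N => i l Ni il.
  (* The empty sum stands for the zero function, whose amalgam norm [AM_sum] bounds by 0. *)
  pose F' m : R -> R[i] := if (`|m|%N <= i)%N then fun y => \sum_(i <- [::]) F i y else F m.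
  rewrite (_ : (fun y => _) = (fun y => zpsum (F' ^~ y) l)); last first.
    apply/funext => y; rewrite zpsum_tail//; apply: eq_zpsum => m.
    by rewrite /F'; case: ifP; rewrite ?big_nil.
  apply: le_trans (AM_zpsum (b := fun m => if (`|m|%N <= i)%N then 0 else b m) l _ _) _.
  - by move=> m; rewrite /F'; case: ifP => // _; exact: (cmeas_sum [::] cF).
  - by move=> m; rewrite /F'; case: ifP => // _; rewrite (le_trans (AM_sum [::] cF))// big_nil.
  rewrite lee_fin -zpsum_tail//; apply: le_trans (NP l (leq_trans Ni il)).
  by rewrite lerD2l lerN2; exact: zpsum_nd.
have [||E [cE hE]] := @AM_complete R (fun N y => zpsum (F ^~ y) N) cS.
- by move=> N; exact: le_lt_trans (AM_zpsum N cF Fb) (ltey _).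
- move=> e /cauchy0[N NP]; exists N => i l Ni Nl; have [il|li] := leqP i l.
    by rewrite AM_BC; exact: NP.
  by apply: NP => //; exact: ltnW.
exists E; split => //; apply/lee_addgt0Pr => e /hE[N NP].
have -> : E = (fun y => zpsum (F ^~ y) N - (zpsum (F ^~ y) N - E y)).
  by apply/funext => y; rewrite opprB addrC subrK.
apply: le_trans (AM_B (cS N) (cmeasB (cS N) cE)) _.
apply: leeD; last exact: NP.
by apply: le_trans (AM_zpsum N cF Fb) _; rewrite lee_fin.
Qed.

Lemma Bn_sum_cut H j (s : seq int) : cmeas H -> j \notin s ->
  Bn j (fun y => \sum_(m <- s) cut (blk m) H y) = 0%E.
Proof.
move=> cH; have cc m : cmeas (cut (@blk R m) H) by apply: cmeas_cut => //; exact: measurable_blk.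
move=> js; apply/eqP; rewrite eq_le Bn_ge0 andbT.
elim: s js => [_|m s IH].
  (* Zero is written as the norm over block [j] of the piece of [H] on block [j + 1], so that a
     pointwise comparison applies. *)
  rewrite -(Bn_cut_out cH (_ : j != j + 1)); last by lia.
  apply: le_L2norm; [exact: measurable_blk| |exact: cc|].
    exact: (cmeas_sum [::] cc).
  by move=> y _; rewrite big_nil cabs0 cabs_ge0.
rewrite inE negb_or => /andP[jm js].
rewrite (_ : (fun y => _) = (fun y => cut (blk m) H y + \sum_(m <- s) cut (blk m) H y)%R); last first.
  by apply/funext => y; rewrite big_cons.
apply: le_trans (L2normD (@measurable_blk R j) (cc m) (cmeas_sum s cc)) _.
by rewrite [X in (X + _ <= _)%E](Bn_cut_out cH jm) add0e IH.
Qed.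

Lemma Bn_sum_cutC H j N : cmeas H ->
  (Bn j (fun y => H y - zpsum (fun m => cut (blk m) H y) N)%R <=
   if (`|j|%N <= N)%N then 0 else Bn j H)%E.
Proof.
move=> cH; have cc m : cmeas (cut (@blk R m) H) by apply: cmeas_cut => //; exact: measurable_blk.
case: ifP => jN.
  have jz : j \in zseq N by rewrite mem_zseq.
  pose s := rem j (zseq N).
  have js : j \notin s by rewrite /s mem_rem_uniqF ?zseq_uniq.
  rewrite (_ : (fun y => _) = (fun y => (H y - cut (blk j) H y) + - \sum_(m <- s) cut (blk m) H y)%R); last first.
    by apply/funext => y; rewrite zpsumE (big_rem _ jz)/= opprD addrA.
  apply: le_trans (L2normD (@measurable_blk R j) (cmeasB cH (cc j)) (cmeasN (cmeas_sum s cc))) _.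
  rewrite L2normN [X in (_ + X <= _)%E](Bn_sum_cut cH js) adde0.
  rewrite -(Bn_cut_out cH (_ : j != j + 1)); last by lia.
  apply: le_L2norm; [exact: measurable_blk|exact: cmeasB (cc j)|exact: cc|].
  by move=> y yj; rewrite [cut _ _ y](cut_in _ yj) subrr cabs0 cabs_ge0.
have js : j \notin zseq N by rewrite mem_zseq jN.
rewrite (_ : (fun y => _) = (fun y => H y + - \sum_(m <- zseq N) cut (blk m) H y)%R); last first.
  by apply/funext => y; rewrite zpsumE.
apply: le_trans (L2normD (@measurable_blk R j) cH (cmeasN (cmeas_sum (zseq N) cc))) _.
by rewrite L2normN [X in (_ + X <= _)%E](Bn_sum_cut cH js) adde0.
Qed.

Lemma AM_fin_Bn H : (AM H < +oo)%E -> exists b : int -> R,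
  [/\ forall m, Bn m H = (b m)%:E, forall m, 0 <= b m & (\esum_(m in [set: int]) (b m)%:E < +oo)%E].
Proof.
move=> Hoo; have e m : Bn m H = (fine (Bn m H))%:E.
  by rewrite fineK// ge0_fin_numE ?Bn_ge0// (le_lt_trans (le_Bn_AM m H)).
exists (fun m => fine (Bn m H)); split => // [m|]; first by rewrite fine_ge0// Bn_ge0.
by apply: le_lt_trans Hoo; apply: le_esum => m _; rewrite -e.
Qed.

Lemma AM_blocks H : cmeas H -> (AM H < +oo)%E -> forall e : R, 0 < e ->
  exists N, forall M, (N <= M)%N ->
    (AM (fun y => H y - zpsum (fun m => cut (blk m) H y) M)%R <= e%:E)%E.
Proof.
move=> cH /AM_fin_Bn[b [eb b0 bs]] e e0.
have [N NP] := zpsum_tail_small b0 bs e0; exists N => M NM.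
apply: (@AM_le_zpsum R _ (fun m => if (`|m|%N <= M)%N then 0 else b m)) => [m|L].
  by apply: le_trans (Bn_sum_cutC m M cH) _; rewrite eb; case: ifP.
have [LM|ML] := leqP L M; last first.
  rewrite -zpsum_tail; last exact: ltnW.
  apply: le_trans (NP L (leq_trans NM (ltnW ML))).
  by rewrite lerD2l lerN2; exact: zpsum_nd.
rewrite zpsumE big1_seq; first exact: ltW.
by move=> m /andP[_]; rewrite mem_zseq => mL; rewrite (leq_trans mL LM).
Qed.

End BlockSeries.

(** * The error of the modulated sum *)

Section Approximation.
Variable R : realType.
Local Notation mu := (@lebesgue_measure R).
Local Open Scope complex_scope.
Local Notation cmeas := (@cmeasurable R setT).
Implicit Types (u v h G H : R -> R[i]) (j k m n : int).

Lemma amalgam_normE u : L2f u -> amalgam_norm u = AM (fourier2 u).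
Proof.
move=> Lu; rewrite /amalgam_norm asboolT; last exact/L2P.
apply: eq_esum => m _; rewrite -L2norm_base_sh//; exact: (fourier2_L2f Lu).1.
Qed.

Variable f : R -> R[i].
Hypothesis hf : PWl1 f.
Local Notation H := (fourier2 f).

Lemma PWl1_L2f : L2f f. Proof. exact/L2P/hf.1. Qed.

Lemma AM_PWl1 : (AM H < +oo)%E.
Proof. by rewrite -(amalgam_normE PWl1_L2f) hf.2. Qed.

Lemma cmeas_hat : cmeas H. Proof. exact: (fourier2_L2f PWl1_L2f).1. Qed.

Lemma L1f_hat : L1f H.
Proof.
apply: (@AM_L1 _ H (fine (AM H)) cmeas_hat _).1.
by rewrite fineK// ge0_fin_numE ?AM_ge0// AM_PWl1.
Qed.

Lemma PWl1_inversion : {ae mu, forall t, f t = ifourier H t}.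
Proof. exact: fourier_inversion (fourier2P PWl1_L2f) L1f_hat. Qed.

Lemma continuous_ifourier G : L1f G -> continuous (ifourier G : R -> R[i]^o).
Proof.
move=> LG t; apply: (@continuous_comp _ _ _ (fun t : R => - t) (fourier G : R -> R[i]^o)).
  exact: opp_continuous.
exact: continuous_fourier.
Qed.

Lemma band_piece_gamma m g : is_band_piece f m g ->
  {ae mu, forall y, gamma g y = sh m (cut (blk m) H) y}.
Proof.
case=> _; apply: ae_imp => y ey; rewrite /gamma /sh /cut.
have {}ey : fourier2 g y = H (y + tpi R m) * (\1_(@base R) y)%:C := ey I.
rewrite ey -mulrA -rmorphM/=.
rewrite !indicE; have -> : (y + tpi R m \in blk m) = (y \in @base R).
  by apply/idP/idP; rewrite !inE /blk /= addrK.
by case: (y \in _); rewrite /= ?mulr1 ?mulr0.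
Qed.

Lemma cmeas_block m : cmeas (cut (@blk R m) H).
Proof. by apply: cmeas_cut; [exact: measurable_blk|exact: cmeas_hat]. Qed.

Lemma nrm_band_piece m g (b : R) : is_band_piece f m g -> Bn m H = b%:E -> nrm (gamma g) = b.
Proof.
move=> hg e; have [[/L2P Lg _ _] _] := hg; have [_ L2g] := gamma_L Lg.
have cs := cmeas_sh m (cmeas_block m).
apply: EFin_inj; rewrite -(L2norm_nrm L2g) -e.
rewrite (ae_eq_L2norm L2g.1 cs (band_piece_gamma hg)) -(L2norm_base_sh _ cmeas_hat) [RHS]L2norm_cut.
congr L2norm; apply/funext => y; rewrite /sh /cut; congr (_ * _).
rewrite !indicE; have -> // : (y + tpi R m \in blk m) = (y \in @base R).
by apply/idP/idP; rewrite !inE /blk /= addrK.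
Qed.

Variables (x : int -> R) (g : int -> R -> R[i]).
Hypothesis hg : forall m, is_band_piece f m (g m).

(** The blockwise errors [W m] form an absolutely convergent series in the amalgam norm, with sum
    [E], and the modulated sum is the inverse transform of H - E. The three bounds are then the
    amalgam norm of [E] and what it dominates. *)
Lemma modulated_sum_error (Ig : int -> R -> R[i]) (F : int -> R -> R[i]) (b : int -> R) (B : R) :
  (forall m, [/\ L1f (F m), L2f (F m), forall t, Ig m t = ifourier (F m) t &
    (AM (fun y => F m y - gamma (g m) y)%R <= (b m)%:E)%E]) ->
  (forall N, zpsum b N <= B) ->
  [/\ (L2norm setT (fun t => f t - modulated_sum Ig t)%R <= B%:E)%E,
      (amalgam_norm (fun t => f t - modulated_sum Ig t)%R <= B%:E)%E &
      forall t, cabs (ifourier H t - modulated_sum Ig t) <= B].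
Proof.
move=> hF bB; have cH := cmeas_hat; have LH := L1f_hat.
(* Modulation by e^{2 pi i m t} moves the transform of the m-th interpolant to block [m]. *)
pose G m := sh (- m) (F m).
have LG m : L1f (G m) by have [L _ _ _] := hF m; exact: (fourier_sh (- m) 0 L).1.
pose W m y := cut (blk m) H y - G m y.
have cW m : cmeas (W m) by exact: cmeasB (cmeas_block m) (LG m).1.
have Wb m : (AM (W m) <= (b m)%:E)%E.
  have [LF _ _] := hF m; apply: le_trans.
  rewrite -(AM_sh m (cW m)) AM_BC.
  have [[/L2P Lg _ _] _] := hg m; have [_ L2g] := gamma_L Lg.
  have cs := cmeas_sh m (cmeas_block m).
  rewrite (ae_eq_AM (H := fun y => gamma (g m) y - F m y)) ?lexx//.
  - exact: cmeas_sh.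
  - exact: cmeasB L2g.1 LF.1.
  apply: ae_imp (band_piece_gamma (hg m)) => y ->.
  by rewrite /W /G /sh tpiN addrK.
have [E [cE EB cvE]] := AM_series cW Wb bB.
have [LE ccE] := AM_L1 cE EB; have [L2E nE] := AM_L2 cE EB.
have L1W m : L1f (W m) by apply: L1fB => //; apply: L1f_cut => //; exact: measurable_blk.
have L1Z (U : int -> R -> R[i]) N t : (forall m, L1f (U m)) -> L1f (fun y => zpsum (U ^~ y) N) /\
    ifourier (fun y => zpsum (U ^~ y) N) t = zpsum (fun m => ifourier (U m) t) N.
  move=> LU; rewrite (_ : (fun y => _) = (fun y => \sum_(n <- zseq N) U n y)); last first.
    by apply/funext => y; rewrite zpsumE.
  by rewrite zpsumE; exact: (fourier_sum (zseq N) (- t) LU).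
have JE t : modulated_sum Ig t = ifourier (fun y => H y - E y) t.
  apply: limn_complex => e e0; have e2 : 0 < e / 2 by rewrite divr_gt0.
  have [N1 h1] := cvE _ e2; have [N2 h2] := AM_blocks cH AM_PWl1 e2.
  exists (maxn N1 N2) => N; rewrite geq_max => /andP[/h1{}h1 /h2{}h2].
  have [LGN eGN] := L1Z G N t LG.
  have -> : zpsum (fun m => expi (2 * pi * m%:~R * t) * Ig m t) N = ifourier (fun y => zpsum (G ^~ y) N) t.
    rewrite eGN; apply: eq_zpsum => m; have [LF _ -> _] := hF m.
    rewrite /ifourier (fourier_sh (- m) (- t) LF).2 mulrC tpiN mulrNN; by [].
  have LHE := L1fB LH LE.
  rewrite /ifourier -fourierB//; apply: le_trans (fourier_bound _ (L1fB LGN LHE)) _.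
  have cT : cmeas (fun y => zpsum (fun m => cut (blk m) H y) N) by exact: (cmeas_zpsum N cmeas_block).
  have cS := cmeas_zpsum N cW.
  apply: (AM_L1 (cmeasB LGN.1 LHE.1) _).2.
  (* The partial sum of the [G m] is that of the blocks of [H] minus that of the [W m], so its
     distance to H - E splits into two tails. *)
  rewrite (_ : (fun y => _) = (fun y => (E y - zpsum (W ^~ y) N) - (H y - zpsum (fun m => cut (blk m) H y) N))).
    apply: le_trans (AM_B (cmeasB cE cS) (cmeasB cH cT)) _.
    by rewrite [e]splitr EFinD; apply: leeD => //; rewrite AM_BC.
  by apply/funext => y; rewrite [zpsum (W ^~ y) N]zpsumB; ring.
have JE' : modulated_sum Ig = ifourier (fun y => H y - E y) by apply/funext => t; exact: JE.
have diff t : ifourier H t - modulated_sum Ig t = ifourier E t.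
  by rewrite JE /ifourier fourierB// opprB addrC subrK.
have ae : {ae mu, forall t, f t - modulated_sum Ig t = ifourier E t}.
  by apply: ae_imp PWl1_inversion => t ->; exact: diff.
have cJ : cmeas (modulated_sum Ig) by rewrite JE'; apply: cmeas_ifourier; exact: L1fB.
have cfJ := cmeasB PWl1_L2f.1 cJ.
have [LfJ eFJ] := fourier2_ifourier LE L2E cfJ ae.
have [LiE niE] := L2f_ifourier LE L2E.
split.
- by rewrite (ae_eq_L2norm cfJ LiE.1 ae) (L2norm_nrm LiE) niE lee_fin.
- by rewrite (amalgam_normE LfJ) (ae_eq_AM (fourier2_L2f LfJ).1 cE eFJ).
by move=> t; rewrite diff; apply: le_trans (fourier_bound _ LE) ccE.
Qed.

End Approximation.

(** * Passage to the limit in alpha *)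

Section Limit.
Variable R : realType.
Local Notation mu := (@lebesgue_measure R).
Local Open Scope complex_scope.
Variables (A : set R) (phi : R -> R -> R).
Hypothesis hphi : regular_family A phi.

(** Dominated convergence is used along sequences: if the claim fails, there is a sequence in [A]
    tending to infinity along which [tau] stays above [e]. The majorant is |G|^2, since m / sigma <=
    1 on the band. *)
Lemma tau_cvg0 (G : R -> R[i]) : L2f G -> (forall y, ~ base y -> G y = 0) ->
  forall e : R, 0 < e -> \forall alpha \near within A +oo_R, tau (phi alpha) G <= e.
Proof.
move=> LG G0 e e0; apply: contrapT => neg.
have pick k : exists alpha, [/\ A alpha, k%:R < alpha & e < tau (phi alpha) G].
  apply: contrapT => no; apply: neg.
  exists k%:R; split => // alpha ka Aa; rewrite leNgt; apply/negP => h; apply: no.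
  by exists alpha.
pose al k := projT1 (cid (pick k)).
have alP k : [/\ A (al k), k%:R < al k & e < tau (phi (al k)) G] by rewrite /al; case: cid.
have alcv : al k @[k --> \oo] --> within A +oo_R.
  move=> S [M [Mr MS]]; have [N _ NP] := nbhs_infty_ger M.
  exists N => // k /= Nk; have [Aa ka _] := alP k.
  by apply: MS => //; exact: le_lt_trans (NP k Nk) ka.
have hk k := regular_interpolator hphi (let: And3 Aa _ _ := alP k in Aa).
pose W k y := cabs (G y) ^+ 2 * (minf (phi (al k)) / symb (phi (al k)) y).
have W0 k y : 0 <= W k y by exact: weight_ge0.
have Wle k y : W k y <= cabs (G y) ^+ 2 by exact: weight_le.
have cv : rint (W k) @[k --> \oo] --> (0 : R).
  apply: (rint_dct0 (k := fun y => cabs (G y) ^+ 2)).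
  - by move=> k; exact: measurable_weight.
  - exact: LG.2.
  - by move=> k y; rewrite ger0_norm.
  apply: ae_imp (regular_ratio hphi) => y hy.
  have [yb|yb] := pselect (base y); last first.
    by apply: eq_cvgn_to (cvg_cst (0 : R)) => k; rewrite /W G0// cabs0 expr0n/= mul0r.
  rewrite -(mulr0 (cabs (G y) ^+ 2)); apply: cvgM; first exact: cvg_cst.
  exact: (cvg_comp _ _ alcv (hy yb)).
have e20 : 0 < e ^+ 2 by rewrite exprn_gt0.
move/cvgr0Pnorm_lt : cv => /(_ _ e20)[N _ NP].
have [_ _] := alP N; have := NP N (leqnn N).
rewrite ger0_norm; last by apply: rint_ge0.
move=> h1; rewrite ltNge => /negP; apply.
rewrite -(@ler_pXn2r _ 2) ?nnegrE ?sqrtr_ge0// ?(ltW e0)// sqr_sqrtr; last by apply: rint_ge0; exact: W0.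
exact: ltW.
Qed.

End Limit.

Section SmallSums.
Variable R : realType.

Lemma near_seq (T : eqType) (U : Type) (F : set_system U) {FF : Filter F} (s : seq T) (P : U -> T -> Prop) :
  (forall m, \forall al \near F, P al m) -> \forall al \near F, forall m, m \in s -> P al m.
Proof.
move=> h; elim: s => [|m s IH]; first exact: nearW.
apply: filterS2 (h m) IH => al Pm Ps n; rewrite inE => /orP[/eqP->//|]; exact: Ps.
Qed.

(** Dominated convergence for series: the tail is small uniformly in alpha by the majorant [b], and
    the head has finitely many terms. *)
Lemma zpsum_small (A : set R) (b : int -> R) (t : R -> int -> R) : (forall m, 0 <= b m) ->
  (\esum_(m in [set: int]) (b m)%:E < +oo)%E ->
  (forall alpha m, A alpha -> 0 <= t alpha m <= b m) ->
  (forall m (e : R), 0 < e -> \forall alpha \near within A +oo_R, t alpha m <= e) ->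
  forall e : R, 0 < e -> \forall alpha \near within A +oo_R, A alpha /\ forall N, zpsum (t alpha) N <= e.
Proof.
move=> b0 bs tb t0 e e0; have e2 : 0 < e / 2 by rewrite divr_gt0.
have [N0 h0] := zpsum_tail_small b0 bs e2.
(* More than the number of terms of the head, each of which is made at most e / 2 / c. *)
pose c : R := (size (zseq N0))%:R + 1; have c0 : 0 < c by rewrite ltr_wpDl.
have ec : 0 < e / 2 / c by rewrite divr_gt0.
have nA : \forall alpha \near within A +oo_R, A alpha by exact: withinT.
have nS : \forall alpha \near within A +oo_R, forall m, m \in zseq N0 -> t alpha m <= e / 2 / c.
  by apply: near_seq => m; exact: t0.
apply: filterS2 nA nS => alpha Aa sm; split => // N.
have ta m : 0 <= t alpha m by have /andP[] := tb alpha m Aa.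
pose M := maxn N N0.
apply: le_trans (zpsum_nd ta (leq_maxl N N0)) _; rewrite -/M.
have -> : zpsum (t alpha) M = zpsum (t alpha) N0 + (zpsum (t alpha) M - zpsum (t alpha) N0) by rewrite addrC subrK.
rewrite [leRHS]splitr; apply: lerD.
  rewrite zpsumE; apply: (@le_trans _ _ (\sum_(m <- zseq N0) e / 2 / c)).
    by rewrite big_seq [leRHS]big_seq; apply: ler_sum => m; exact: sm.
  rewrite big_const_seq count_predT iter_addr_0 -[_ *+ _]mulr_natr.
  rewrite -[leRHS](divfK (_ : c != 0)) ?gt_eqF//; apply: ler_wpM2l; first exact: ltW.
  by rewrite lerDl.
apply: le_trans (h0 M (leq_maxr _ _)); rewrite !zpsum_tail ?leq_maxr//.
apply: le_zpsum => m; case: ifP => // _.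
by have /andP[] := tb alpha m Aa.
Qed.

Lemma ereal_cvg0 (T : Type) (F : set_system T) {FF : Filter F} (u : T -> \bar R) :
  (forall al, (0 <= u al)%E) ->
  (forall e : R, 0 < e -> \forall al \near F, (u al <= e%:E)%E) -> u al @[al --> F] --> 0%E.
Proof.
move=> u0 h; have fin : \forall al \near F, u al \is a fin_num.
  by apply: filterS (h 1 ltr01) => al ua; rewrite ge0_fin_numE// (le_lt_trans ua)// ltey.
apply/fine_cvgP; split => //; apply/cvgr0Pnorm_le => e e0.
apply: filterS2 fin (h e e0) => al fa ua.
by rewrite /= ger0_norm ?fine_ge0// -lee_fin fineK.
Qed.

Lemma amalgam_norm_ge0 (f : R -> R[i]) : (0 <= amalgam_norm f)%E.
Proof. by rewrite /amalgam_norm; case: ifP => // _; apply: esum_ge0 => m _; exact: L2norm_ge0. Qed.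

End SmallSums.

Theorem theorem1 (R : realType)
  (f : R -> R[i]) (hf : PWl1 f)
  (x : int -> R) (hx : complete_interpolating x)
  (A : set R) (phi : R -> R -> R) (hphi : regular_family A phi)
  (g : int -> R -> R[i]) (hg : forall m : int, is_band_piece f m (g m))
  (Ig : R -> int -> R -> R[i])
  (hI : forall alpha : R, A alpha ->
     forall m : int, is_interpolant (phi alpha) x (g m) (Ig alpha m)) :
  let J := fun alpha : R => modulated_sum (Ig alpha) in
  [/\ L2norm setT (fun t => f t - J alpha t)
        @[alpha --> within A (+oo_R)] --> 0%E,
      amalgam_norm (fun t => f t - J alpha t)
        @[alpha --> within A (+oo_R)] --> 0%E &
      exists fc : R -> R[i],
        [/\ continuous (fc : R -> R[i]^o),
            f = fc %[ae (@lebesgue_measure R)] &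
            forall eps : R, 0 < eps ->
              \forall alpha \near within A (+oo_R),
                forall t : R, cabs (fc t - J alpha t) < eps]].
Proof.
move=> J.
have [K K0 core] := core_estimate hx.
have [C hC] : exists C : R, 0 <= C /\ forall alpha, A alpha -> forall N,
    zpsum (fun j => if j == 0 then 0 else Msup (phi alpha) j) N <= C * minf (phi alpha).
  (* The constant of (H2) is replaced by its absolute value, so that K C is nonnegative. *)
  have [C h] := regular_tail hphi; exists `|C|; split => // alpha Aa N.
  have hp := regular_interpolator hphi Aa.
  apply: (@le_trans _ _ (C * minf (phi alpha))); last first.
    by rewrite ler_wpM2r ?ler_norm// ltW// minf_gt0.
  have := h _ Aa; rewrite esum_mkcond => h'.
  apply: (esum_le_zpsum _ _).1 => [j|]; first by case: eqP => // _; exact: Msup_ge0.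
  apply: le_trans h'; apply: le_esum => j _.
  have [->|j0] := eqVneq j 0; first by case: ifP => // _; rewrite lee_fin Msup_ge0.
  by rewrite ifT// inE.
case: hC => C0 hC.
have [b [eb b0 bs]] := AM_fin_Bn (AM_PWl1 hf).
have Lg m : L2f (g m) by have [[/L2P]] := hg m.
have tb alpha m : A alpha -> 0 <= tau (phi alpha) (gamma (g m)) <= b m.
  move=> Aa; rewrite sqrtr_ge0/= -(nrm_band_piece hf (hg m) (eb m)).
  have [_ L2g] := gamma_L (Lg m).
  apply: (tau_le (regular_interpolator hphi Aa) L2g) => y yb.
  by rewrite /gamma cut_out.
have t0 m (e : R) : 0 < e -> \forall alpha \near within A +oo_R, tau (phi alpha) (gamma (g m)) <= e.
  move=> e0; have [_ L2g] := gamma_L (Lg m); apply: tau_cvg0 => //.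
  by move=> y yb; rewrite /gamma cut_out.
have small := zpsum_small b0 bs tb t0.
have near_bound (e : R) : 0 < e -> \forall alpha \near within A +oo_R,
    [/\ (L2norm setT (fun t => f t - J alpha t)%R <= e%:E)%E,
        (amalgam_norm (fun t => f t - J alpha t)%R <= e%:E)%E &
        forall t, cabs (ifourier (fourier2 f) t - J alpha t) <= e].
  (* The [+ 1] allows the division when K C = 0; a sum of the [tau] below e / Z gives a total error
     below [e]. *)
  move=> e0; pose Z := K * C + 1.
  have KC0 : 0 <= K * C by rewrite mulr_ge0.
  have Z0 : 0 < Z by rewrite ltr_wpDl.
  apply: filterS (small (e / Z) (divr_gt0 e0 Z0)) => alpha [Aa hN].
  have /choice[F hF] : forall m, exists F, [/\ L1f F, L2f F, forall t, Ig alpha m t = ifourier F t &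
      (AM (fun y => F y - gamma (g m) y)%R <= (K * C * tau (phi alpha) (gamma (g m)))%:E)%E].
    move=> m.
    exact: core _ _ _ _ (regular_interpolator hphi Aa) (hC _ Aa) (hg m).1 (hI _ Aa m).
  apply: (modulated_sum_error hf hg hF) => N.
  rewrite zpsumZ; apply: (@le_trans _ _ (K * C * (e / Z))); first by rewrite ler_wpM2l.
  rewrite mulrCA ger_pMr// ler_pdivrMr// mul1r /Z lerDl//.
split.
- apply: ereal_cvg0 => [alpha|e e0]; first exact: L2norm_ge0.
  by apply: filterS (near_bound e e0) => alpha [].
- apply: ereal_cvg0 => [alpha|e e0]; first exact: amalgam_norm_ge0.
  by apply: filterS (near_bound e e0) => alpha [].
(* The continuous representative of [f] is the inverse transform of its integrable transform. *)
exists (ifourier (fourier2 f)); split.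
- exact: continuous_ifourier (L1f_hat hf).
- by apply: ae_imp (PWl1_inversion hf) => t ? _.
(* Halving turns the non-strict bound into a strict one. *)
move=> e e0; have e2 : 0 < e / 2 by rewrite divr_gt0.
apply: filterS (near_bound _ e2) => alpha [_ _ h] t.
by apply: le_lt_trans (h t) _; rewrite ltr_pdivrMr// ltr_pMr// ltr1n.
Qed.
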